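(* Let $r\in\mathbb{N}$ and $\gamma_1,\ldots,\gamma_r\in\mathbb{C}$ with $\Re\gamma_j>0$ $(1\leqslant j\leqslant r)$. Then $$\zeta^{\rm des}_r((s_j);(\gamma_j))=\sum_{\substack{\boldsymbol{l}=(l_j)\in\mathbb{N}_0^r\\ \boldsymbol{m}=(m_j)\in\mathbb{Z}^r\\ \sum_{j=1}^rm_j=0}}a_{\boldsymbol{l},\boldsymbol{m}}\Bigl(\prod_{j=1}^r(s_j)_{l_j}\Bigr)\zeta_r(s_1+m_1,\ldots,s_r+m_r;(1);(\gamma_j))$$ holds for all $(s_j)\in\mathbb{C}^r$ (as an identity of meromorphic functions on $\mathbb{C}^r$).
   Context: $\mathbb{N}_0=\{0,1,2,\dots\}$; $(s)_0=1$ and $(s)_k=s(s+1)\cdots(s+k-1)$ for $k\in\mathbb{N}$. The integers $a_{\boldsymbol{l},\boldsymbol{m}}$ (only finitely many nonzero) are defined, with indeterminates $u_j,v_j$ $(1\leqslant j\leqslant r)$ and the convention $v_0^{-1}=0$, by $$\prod_{j=1}^r\Bigl(1-(u_jv_j+\cdots+u_rv_r)(v_j^{-1}-v_{j-1}^{-1})\Bigr)=\sum_{\substack{\boldsymbol{l}=(l_j)\in\mathbb{N}_0^r\\ \boldsymbol{m}=(m_j)\in\mathbb{Z}^r\\ \sum_jm_j=0}}a_{\boldsymbol{l},\boldsymbol{m}}\prod_{j=1}^ru_j^{l_j}v_j^{m_j}.$$ $\zeta_r((s_j);(1);(\gamma_j))$ denotes the meromorphic continuation to $\mathbb{C}^r$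 (known to exist) of $$\sum_{m_1=1}^\infty\cdots\sum_{m_r=1}^\infty\prod_{j=1}^r(m_1\gamma_1+\cdots+m_j\gamma_j)^{-s_j},$$ which converges absolutely for $\Re(s_{r-k+1}+\cdots+s_r)>k$ $(1\leqslant k\leqslant r)$. For $c\in\mathbb{R}$ put $$\widetilde{\mathfrak{H}}_r((t_j);(\gamma_j);c)=\prod_{j=1}^r\left(\frac{1}{\exp\left(\gamma_j\sum_{k=j}^rt_k\right)-1}-\frac{c}{\exp\left(c\gamma_j\sum_{k=j}^rt_k\right)-1}\right).$$ $\mathcal{C}$ is the Hankel contour: from $+\infty$ along the top side of the positive real axis, once counterclockwise around the origin on a circle of sufficiently small radius (depending on the $\gamma_j$), and back to $+\infty$ along the bottom side; $t^{s-1}$ is taken with $\arg t$ from $0$ to $2\pi$. The desingularized multiple zeta-function is $$\zeta^{\rm des}_r((s_j);(\gamma_j)):=\lim_{c\to1,\ c\in\mathbb{R}\setminus\{1\}}\frac{(-1)^r}{(c-1)^r}\prod_{k=1}^r\frac{1}{(e^{2\pi is_k}-1)\Gamma(s_k)}\int_{\mathcal{C}^r}\widetilde{\mathfrak{H}}_r((t_j);(\gamma_j);c)\prod_{k=1}^rt_k^{s_k-1}dt_k,$$ which extends to an entire function of $(s_j)\in\mathbb{C}^r$. *)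

(* Defs.v *)
From HB Require Import structures.
From mathcomp Require Import all_boot all_order all_algebra finmap.
From mathcomp Require Import complex.
From mathcomp Require Import all_classical all_reals all_analysis.
From mathcomp Require mpoly.
(* mpoly's notations clash with those of MathComp-Analysis; only its instances
   are needed. *)
Import (canonicals) mpoly.

Set Implicit Arguments.
Unset Strict Implicit.
Unset Printing Implicit Defensive.

Import Order.TTheory GRing.Theory Num.Theory numFieldNormedType.Exports.

Local Open Scope classical_set_scope.
Local Open Scope ring_scope.
Local Open Scope complex_scope.

(* The usual topology and norm of the complex numbers. *)
HB.instance Definition _ (R : realType) :=
  PseudoPointedMetric.copy (complex (Real.sort R)) (complex R)^o.
HB.instance Definition _ (R : realType) :=
  GRing.ComAlgebra.copy (complex (Real.sort R)) (complex R)^o.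
HB.instance Definition _ (R : realType) :=
  NormedModule.copy (complex (Real.sort R)) (complex R)^o.

Section ComplexFunctions.
Variable R : realType.
Local Notation C := (complex (Real.sort R)).

Definition cexp (z : C) : C :=
  (expR (complex.Re z))%:C * (cos (complex.Im z) +i* sin (complex.Im z)).

(* The principal branch, on the half-plane Re z > 0 only: all the bases
   m_1 gamma_1 + ... + m_j gamma_j lie there. *)
Definition clog (z : C) : C :=
  ln (complex.Re `|z|) +i* atan (complex.Im z / complex.Re z).

Definition cpow (z s : C) : C := cexp (s * clog z).

Definition cintegral (D : set R) (f : R -> C) : C :=
  (\int[lebesgue_measure]_(x in D) complex.Re (f x))
  +i* (\int[lebesgue_measure]_(x in D) complex.Im (f x)).

Definition rising (s : C) (k : nat) : C := \prod_(i < k) (s + i%:R).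

Definition euler_integral (s : C) : C :=
  cintegral `]0, +oo[ (fun x => cexp ((s - 1) * (ln x)%:C - x%:C)).

(* Euler's integral for Re s > 0, continued to the left by
   Gamma(s) = Gamma(s + n) / (s)_n, with n least such that Re s + n > 0. *)
Definition cGamma (s : C) : C :=
  let n := if 0 < complex.Re s then 0%N
           else (Num.truncn (- complex.Re s)).+1 in
  euler_integral (s + n%:R) / rising s n.

End ComplexFunctions.

Section SeveralVariables.
Variables (R : realType) (r : nat).
Local Notation C := (complex (Real.sort R)).
Implicit Types f g h : 'rV[C]_r -> C.

(* [differentiable] is Frechet differentiability over the scalar field C. *)
Definition entire f := forall z, differentiable f z.

Definition holomorphic_at f (p : 'rV[C]_r) := \forall z \near p, differentiable f z.

(* A meromorphic function is represented by a total function which is locally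
   a quotient g / h, h not vanishing identically on any nonempty open set.  Its
   values on the zero set of h are irrelevant. *)
Definition meromorphic f :=
  forall p : 'rV[C]_r, exists (V : set 'rV[C]_r) g h,
    [/\ open V, V p,
        forall z, V z -> differentiable g z /\ differentiable h z,
        V `<=` closure [set z | h z != 0]
      & forall z, V z -> h z != 0 -> f z = g z / h z].

(* Equality as meromorphic functions: the values agree wherever both sides are
   holomorphic (a dense open set, both being meromorphic). *)
Definition meromorphic_eq f g :=
  [/\ meromorphic f, meromorphic g
    & forall s, holomorphic_at f s -> holomorphic_at g s -> f s = g s].

End SeveralVariables.

(* The generating identity is stated in the field of fractions of
   Z[u_1, ..., u_r, v_1, ..., v_r], which contains the Laurent polynomials. *)
Section Coefficients.
Variable r : nat.
Local Notation F := {fraction (mpoly.mpoly (r + r) int)}.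

Definition indet (i : 'I_(r + r)) : F :=
  tofrac (mpoly.mpolyX int (mpoly.mnm1 i)).
Definition uvar (j : 'I_r) : F := indet (lshift r j).
Definition vvar (j : 'I_r) : F := indet (rshift r j).

(* v_{j-1}^{-1}; for the first index the sum is empty, i.e. v_0^{-1} = 0. *)
Definition vvar_pred_inv (j : 'I_r) : F :=
  \sum_(k < r | k.+1 == j :> nat) (vvar k)^-1.

Definition desing_coef
    (a : {fsfun ({ffun 'I_r -> nat} * {ffun 'I_r -> int})%type -> int with 0}) :=
  (forall l m, a (l, m) != 0 -> \sum_j m j = 0) /\
  \prod_(j < r) (1 - (\sum_(k < r | (j <= k)%N) uvar k * vvar k)
                     * ((vvar j)^-1 - vvar_pred_inv j))
  = \sum_(lm <- finsupp a)
      (a lm)%:~R * \prod_(j < r) (uvar j ^+ lm.1 j * vvar j ^ lm.2 j).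

End Coefficients.

Section Zeta.
Variables (R : realType) (r : nat).
Local Notation C := (complex (Real.sort R)).
Implicit Types (gamma s t w : 'rV[C]_r).

(* Re (s_{r-k+1} + ... + s_r) > k for 1 <= k <= r, where k = r - j. *)
Definition zeta_domain s :=
  forall j : 'I_r, (r - j)%:R < complex.Re (\sum_(k < r | (j <= k)%N) s 0 k).

Definition zeta_term gamma s (n : 'I_r -> nat) : C :=
  \prod_(j < r) cpow (\sum_(k < r | (k <= j)%N) (n k)%:R * gamma 0 k) (- s 0 j).

(* The multiple series converges absolutely on [zeta_domain], so its sum is the
   limit of the sums over the cubes {1, ..., N}^r. *)
Definition zeta_continuation gamma (Z : 'rV[C]_r -> C) :=
  meromorphic Z /\
  forall s, zeta_domain s ->
    (\sum_(n : {ffun 'I_r -> 'I_N}) zeta_term gamma s (fun k => (n k).+1))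
      @[N --> \oo] --> Z s.

Definition des_kernel gamma (c : R) t : C :=
  \prod_(j < r)
    let y := gamma 0 j * \sum_(k < r | (j <= k)%N) t 0 k in
    ((cexp y - 1)^-1 - c%:C / (cexp (c%:C * y) - 1)).

End Zeta.

(* The integral over the Hankel contour of radius e of f(log t) dt, where log t
   has imaginary part 0 on the top side, 2 pi on the bottom side and runs from
   0 to 2 pi on the circle. *)
Definition hankel (R : realType) (e : R) (f : complex R -> complex R) : complex R :=
  - cintegral `[e, +oo[ (fun x => f (ln x)%:C)
  + cintegral `[0, 2 * pi]
      (fun th => f (ln e +i* th) * ((0 +i* e) * cexp (0 +i* th)))
  + cintegral `[e, +oo[ (fun x => f (ln x +i* (2 * pi))).

Fixpoint hankel_iter (R : realType) (e : R) (n : nat) :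
    ('rV[complex R]_n -> complex R) -> complex R :=
  match n with
  | 0 => fun f => f 0
  | n'.+1 => fun f =>
      hankel e (fun w0 => hankel_iter e (fun w : 'rV_n' => f (row_mx w0%:M w)))
  end.

Section Desingularized.
Variables (R : realType) (r : nat).
Local Notation C := (complex (Real.sort R)).
Implicit Types (gamma s w : 'rV[C]_r).

(* With w_k = log t_k one has t_k^{s_k - 1} = exp ((s_k - 1) w_k).  Where some
   t_j + ... + t_r = 0, the kernel has a removable singularity and the formula
   gives a junk value; this happens on a null set of the contour. *)
Definition des_approx (e : R) gamma s (c : R) : C :=
  (-1) ^+ r / (c%:C - 1) ^+ r
  * (\prod_(k < r) ((cexp ((0 +i* (2 * pi)) * s 0 k) - 1) * cGamma (s 0 k))^-1)
  * hankel_iter e (fun w => des_kernel gamma c (map_mx (@cexp R) w)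
                            * \prod_(k < r) cexp ((s 0 k - 1) * w 0 k)).

(* The entire function given by the limit c -> 1.  The factors
   (e^{2 pi i s_k} - 1) Gamma(s_k) vanish or are indeterminate when s_k is an
   integer; at such points the value is the one prescribed by continuation. *)
Definition zeta_des gamma (D : 'rV[C]_r -> C) :=
  entire D /\
  \forall e \near (0 : R)^'+,
    forall s, (forall k (n : int), s 0 k != n%:~R) ->
      des_approx e gamma s c @[c --> (1 : R)^'] --> D s.

End Desingularized.

(* Main.v *)
(* When all Re s_k are large, dominated convergence allows the radius of the
   Hankel contours to tend to 0 and c to tend to 1 simultaneously: the integral
   becomes one over the two sides of the cut, with kernel prod_j h(y_j), where
   y_j = gamma_j (t_j + ... + t_r) and h(y) = sum_{n >= 1} (1 - n y) e^{-n y}.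
   For n in N^r put M_j = n_1 gamma_1 + ... + n_j gamma_j.  The substitution
   u_j = t_j M_j, v_j = 1 / M_j in the identity defining the coefficients
   expands prod_j (1 - n_j y_j) into monomials, while
   prod_j e^{-n_j y_j} = prod_k e^{-M_k t_k}; integrating termwise with
   int_0^oo t^{s+l-1} e^{-M t} dt = (s)_l Gamma(s) M^{-s-l}
   yields the combination of zeta values.  The identity theorem for meromorphic
   functions then removes the restriction on s. *)
From HB Require Import structures.
Require Import Defs.
From mathcomp Require Import all_boot all_order all_algebra finmap.
From mathcomp Require Import complex.
From mathcomp Require Import all_classical all_reals all_analysis.
From mathcomp Require Import measurable_realfun.
From mathcomp Require Import ring lra zify.
From mathcomp Require mpoly.
Import (canonicals) mpoly.

Set Implicit Arguments.
Unset Strict Implicit.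
Unset Printing Implicit Defensive.

Import Order.TTheory GRing.Theory Num.Theory numFieldNormedType.Exports.
Import ComplexField.Normc.

Local Open Scope classical_set_scope.
Local Open Scope ring_scope.
Local Open Scope complex_scope.

(** For each fixed small radius e, [zeta_des] provides only the limit c -> 1. A diagonal sequence
    (e_m, c_m) is extracted, and one dominated convergence treats both limits. Its crux is a bound
    uniform over the contours: each kernel factor is at most const |c - 1| exp(-k X_j), where X_j
    sums nonnegative parts of t_j, ..., t_r; the r factors |c - 1| absorb (c - 1)^{-r}. The series h
    is truncated at n <= N, so that expansion and termwise integration concern finite sums over {1,
    ..., N}^r, the very sums whose limit is [Z]; N -> oo is a second dominated convergence. Since
    the gamma_j are complex, so are the M_k, and the Gamma integral has to be rotated; this is done
    by differentiating along M^t, 0 <= t <= 1. Equality is first obtained near a point with all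
    coordinates P + 1/2, P a large integer: there no s_k is an integer, all zeta arguments lie in
    the domain of convergence, and no factor (e^{2 pi i s_k} - 1) Gamma(s_k) vanishes. The identity
    theorem rests on Goursat's lemma in the coordinate log z. *)

Local Notation Re := complex.Re.
Local Notation Im := complex.Im.

(** * Complex modulus, exponential and derivatives *)

Section ComplexModulus.
Variable R : realType.
Local Notation C := (complex (Real.sort R)).
Implicit Types z w : C.

Lemma normrcE z : `|z| = (normc z)%:C.
Proof. by case: z. Qed.

Lemma Re_normr z : Re `|z| = normc z.
Proof. by rewrite normrcE. Qed.

Lemma ler_normcD z w : normc (z + w) <= normc z + normc w.
Proof. exact: le_normcD. Qed.

Lemma normc_opp z : normc (- z) = normc z.
Proof. exact: normcN. Qed.

Lemma normc_ge0 z : 0 <= normc z.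
Proof. by case: z => a b; exact: sqrtr_ge0. Qed.

Lemma normc_eq0 z : (normc z == 0) = (z == 0).
Proof.
by apply/eqP/eqP => [/eq0_normc|->]; last exact: normc0.
Qed.

Lemma normc_gt0 z : (0 < normc z) = (z != 0).
Proof. by rewrite lt_neqAle normc_ge0 andbT eq_sym normc_eq0. Qed.

Lemma le_normcB z w : normc (z - w) <= normc z + normc w.
Proof. by rewrite -(normc_opp w); exact: ler_normcD. Qed.

Lemma ler_normcD4 z1 z2 z3 z4 : normc (z1 + z2 + z3 + z4) <=
  normc z1 + normc z2 + normc z3 + normc z4.
Proof.
by do 2 (apply: le_trans (ler_normcD _ _) _; rewrite lerD2r); exact: ler_normcD.
Qed.

Lemma normc_distC z w : normc (z - w) = normc (w - z).
Proof. by rewrite -normc_opp opprB. Qed.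

Lemma lerB_normc z w : normc z - normc w <= normc (z - w).
Proof. by rewrite lerBlDr (le_trans _ (ler_normcD _ _)) ?subrK. Qed.

Lemma lerB_normcD z w : normc z - normc w <= normc (z + w).
Proof. by rewrite -[w in leRHS]opprK -(normc_opp w) lerB_normc. Qed.

Lemma le_Re_normc z : `|Re z| <= normc z.
Proof.
case: z => a b /=; rewrite -sqrtr_sqr ler_wsqrtr// lerDl; exact: sqr_ge0.
Qed.

Lemma le_Im_normc z : `|Im z| <= normc z.
Proof.
case: z => a b /=; rewrite -sqrtr_sqr ler_wsqrtr// lerDr; exact: sqr_ge0.
Qed.

Lemma normc_real (x : R) : normc x%:C = `|x|.
Proof. by rewrite /= expr0n addr0 sqrtr_sqr. Qed.

Lemma normc_i : normc ('i%C : C) = 1.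
Proof. by rewrite /= expr0n add0r expr1n sqrtr1. Qed.

Lemma normc_le z : normc z <= `|Re z| + `|Im z|.
Proof.
case: z => a b.
rewrite [in leLHS](_ : a +i* b = a%:C + 'i%C * b%:C :> C); last first.
  by apply/eqP; rewrite eq_complex /= !mul0r !mul1r !subr0 !addr0 !add0r !eqxx.
apply: le_trans (ler_normcD _ _) _.
by rewrite normcM normc_i mul1r !normc_real.
Qed.

Lemma normc_nat n : normc (n%:R : C) = n%:R.
Proof. by rewrite -(rmorph_nat (real_complex R)) normc_real normr_nat. Qed.

Lemma normcX z n : normc (z ^+ n) = normc z ^+ n.
Proof. by elim: n => [|n IH]; rewrite ?expr0 ?normc1// !exprS normcM IH. Qed.

Lemma normc_prod (I : Type) (r : seq I) (P : pred I) (F : I -> C) :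
  normc (\prod_(i <- r | P i) F i) = \prod_(i <- r | P i) normc (F i).
Proof. by apply: (big_morph (@normc R)); [exact: normcM|exact: normc1]. Qed.

Lemma ler_normc_sum (I : Type) (r : seq I) (P : pred I) (F : I -> C) :
  normc (\sum_(i <- r | P i) F i) <= \sum_(i <- r | P i) normc (F i).
Proof.
elim/big_ind2: _ => [|x1 x2 y1 y2 h1 h2|//]; first by rewrite normc0.
by apply: le_trans (ler_normcD _ _) _; exact: lerD.
Qed.

Lemma cReD z w : Re (z + w) = Re z + Re w.
Proof. by case: z w => a b [c d]. Qed.

Lemma cImD z w : Im (z + w) = Im z + Im w.
Proof. by case: z w => a b [c d]. Qed.

Lemma cReN z : Re (- z) = - Re z.
Proof. by case: z. Qed.

Lemma cImN z : Im (- z) = - Im z.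
Proof. by case: z. Qed.

Lemma cReM z w : Re (z * w) =
  Re z * Re w - Im z * Im w.
Proof. by case: z w => a b [c d]. Qed.

Lemma cImM z w : Im (z * w) =
  Re z * Im w + Im z * Re w.
Proof. by case: z w => a b [c d]. Qed.

Lemma Re_sum (I : Type) (r : seq I) (P : pred I) (F : I -> C) :
  Re (\sum_(i <- r | P i) F i) = \sum_(i <- r | P i) Re (F i).
Proof. by apply: (big_morph (@Re R)); [exact: cReD|]. Qed.

Lemma eqcP z w : Re z = Re w -> Im z = Im w ->
  z = w.
Proof. by case: z w => a b [c d] /= -> ->. Qed.

Lemma normc_sqr z : normc z ^+ 2 = Re z ^+ 2 + Im z ^+ 2.
Proof. by case: z => a b; rewrite /= sqr_sqrtr// addr_ge0 ?sqr_ge0. Qed.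

(** For the partial order of [C] a positive tolerance is a positive real number, so the epsilon
    criterion over [R] is equivalent. *)
Lemma cvgcP (T : Type) (F : set_system T) {FF : Filter F} (f : T -> C) (l : C) :
  f x @[x --> F] --> l <->
  (forall eps : R, 0 < eps -> \forall x \near F, normc (f x - l) < eps).
Proof.
split=> [/cvgrPdist_lt h eps eps0|h].
  have e0 : (0 : C) < eps%:C by rewrite ltcR.
  have := h _ e0; apply: filterS => x.
  by rewrite normrcE ltcR normc_distC.
apply/cvgrPdist_lt => -[e e'] /=; rewrite ltcE /= => /andP[/eqP -> e0].
have := h _ e0; apply: filterS => x.
by rewrite normrcE ltcR normc_distC.
Qed.

Lemma cvgc_normc0 (T : Type) (F : set_system T) {FF : Filter F} (f : T -> C)
    (l : C) : f x @[x --> F] --> l <-> normc (f x - l) @[x --> F] --> (0 : R).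
Proof.
split=> [/cvgcP h|/cvgr0Pnorm_lt h].
  apply/cvgr0Pnorm_lt => e e0; have := h e e0.
  by apply: filterS => x; rewrite ger0_norm// normc_ge0.
by apply/cvgcP => e e0; have := h e e0; apply: filterS => x; rewrite ger0_norm ?normc_ge0.
Qed.

Lemma cvgc_Re (T : Type) (F : set_system T) {FF : Filter F} (f : T -> C) (l : C) :
  f x @[x --> F] --> l -> Re (f x) @[x --> F] --> Re l.
Proof.
move=> /cvgcP h; apply/cvgrPdist_lt => e e0.
have := h e e0; apply: filterS => x; apply: le_lt_trans.
by rewrite normc_distC -cReN -cReD; exact: le_Re_normc.
Qed.

Lemma cvgc_Im (T : Type) (F : set_system T) {FF : Filter F} (f : T -> C) (l : C) :
  f x @[x --> F] --> l -> Im (f x) @[x --> F] --> Im l.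
Proof.
move=> /cvgcP h; apply/cvgrPdist_lt => e e0.
have := h e e0; apply: filterS => x; apply: le_lt_trans.
by rewrite normc_distC -cImN -cImD; exact: le_Im_normc.
Qed.

Lemma cvgc_ReIm (T : Type) (F : set_system T) {FF : Filter F} (f : T -> C) (l : C) :
  Re (f x) @[x --> F] --> Re l ->
  Im (f x) @[x --> F] --> Im l ->
  f x @[x --> F] --> l.
Proof.
move=> /cvgrPdist_lt hr /cvgrPdist_lt hi; apply/cvgcP => e e0.
have e20 : 0 < e / 2 by rewrite divr_gt0.
have := hr _ e20; have := hi _ e20; apply: filterS2 => x h1 h2.
apply: le_lt_trans (normc_le _) _; rewrite cReD cReN cImD cImN.
by rewrite [ltRHS]splitr ltrD// distrC.
Qed.

Lemma cvgc_unique (T : Type) (F : set_system T) {FF : ProperFilter F}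
    (f : T -> C) (l l' : C) :
  f x @[x --> F] --> l -> f x @[x --> F] --> l' -> l = l'.
Proof. by move=> h1 h2; apply: (@cvg_unique _ (@norm_hausdorff C C)) h1 h2. Qed.

(** A unit factor turns a modulus into a real part. This reduces complex inequalities (mean value,
    modulus of an integral, vanishing of a value) to real ones. *)
Lemma exists_rotation z : exists2 u : C, normc u = 1 & (normc z)%:C = u * z.
Proof.
have [->|z0] := eqVneq z 0; first by exists 1; rewrite ?normc1// mulr0 normc0.
have nz0 : (normc z)%:C != 0 :> C.
  by rewrite -(rmorph0 (real_complex R)) (inj_eq (@complexI R)) normc_eq0.
exists (z^*%C / (normc z)%:C).
  rewrite normcM normcV normc_real ger0_norm ?normc_ge0//.
  have -> : normc z^*%C = normc z by rewrite -!Re_normr normcJ.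
  by rewrite divff// normc_eq0.
by rewrite mulrAC (mulrC z^*%C) -sqr_normc normrcE expr2 mulfK.
Qed.

End ComplexModulus.

Section ComplexExponential.
Variable R : realType.
Local Notation C := (complex (Real.sort R)).
Implicit Types z w : C.

Lemma Re_cexp z : Re (cexp z) = expR (Re z) * cos (Im z).
Proof. by rewrite /cexp cReM /= mul0r subr0. Qed.

Lemma Im_cexp z : Im (cexp z) = expR (Re z) * sin (Im z).
Proof. by rewrite /cexp cImM /= mul0r addr0. Qed.

Lemma cexpD z w : cexp (z + w) = cexp z * cexp w.
Proof.
by apply: eqcP; rewrite !(cReM, cImM, Re_cexp, Im_cexp, cReD, cImD) expRD ?cosD ?sinD; ring.
Qed.

Lemma cexp0 : cexp (0 : C) = 1.
Proof.
by apply: eqcP; rewrite ?Re_cexp ?Im_cexp /= expR0 ?cos0 ?sin0 ?mul1r.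
Qed.

Lemma normc_cexp z : normc (cexp z) = expR (Re z).
Proof.
rewrite /cexp normcM normc_real ger0_norm ?expR_ge0//=.
by rewrite cos2Dsin2 sqrtr1 mulr1.
Qed.

Lemma cexp_neq0 z : cexp z != 0.
Proof. by rewrite -normc_gt0 normc_cexp expR_gt0. Qed.

Lemma cexpN z : cexp (- z) = (cexp z)^-1.
Proof. by apply: (mulfI (cexp_neq0 z)); rewrite -cexpD subrr cexp0 divff ?cexp_neq0. Qed.

Lemma cexpB z w : cexp (z - w) = cexp z / cexp w.
Proof. by rewrite cexpD cexpN. Qed.

Lemma cexpMn z n : cexp (n%:R * z) = cexp z ^+ n.
Proof.
by elim: n => [|n IH]; rewrite ?mul0r ?cexp0// mulrS mulrDl mul1r cexpD IH exprS.
Qed.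

Lemma cexp_sum (I : Type) (r : seq I) (P : pred I) (F : I -> C) :
  cexp (\sum_(i <- r | P i) F i) = \prod_(i <- r | P i) cexp (F i).
Proof. by apply: (big_morph (@cexp R)); [exact: cexpD|exact: cexp0]. Qed.

Lemma cexp_real (x : R) : cexp x%:C = (expR x)%:C.
Proof. by apply: eqcP; rewrite ?Re_cexp ?Im_cexp /= ?cos0 ?sin0 ?mulr1 ?mulr0. Qed.

Lemma cexp_2ipi : cexp (0 +i* (2 * pi) : C) = 1.
Proof.
have -> : 2 * pi = pi *+ 2 :> R by rewrite mulr_natl.
by apply: eqcP; rewrite ?Re_cexp ?Im_cexp /= expR0 mul1r ?cos2pi ?sin2pi.
Qed.

End ComplexExponential.

Section ComplexDerivative.
Variable R : realType.
Local Notation C := (complex (Real.sort R)).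

(** Derivative in a real variable, taken componentwise so that the real mean value theorem and the
    real fundamental theorem of calculus apply. *)
Definition cderiv (f : R -> C) (x : R) (d : C) :=
  is_derive x (1 : R) (fun t => Re (f t)) (Re d) /\
  is_derive x (1 : R) (fun t => Im (f t)) (Im d).

Lemma cderiv_cst (a : C) x : cderiv (fun=> a) x 0.
Proof. by split; exact: is_derive_cst. Qed.

Lemma cderivD f g x a b : cderiv f x a -> cderiv g x b ->
  cderiv (fun t => f t + g t) x (a + b).
Proof.
move=> [f1 f2] [g1 g2]; split.
- rewrite cReD; under eq_fun do rewrite cReD; exact: is_deriveD.
- rewrite cImD; under eq_fun do rewrite cImD; exact: is_deriveD.
Qed.

Lemma cderivN f x a : cderiv f x a -> cderiv (fun t => - f t) x (- a).
Proof.
move=> [f1 f2]; split.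
- rewrite cReN; under eq_fun do rewrite cReN; exact: is_deriveN.
- rewrite cImN; under eq_fun do rewrite cImN; exact: is_deriveN.
Qed.

Lemma cderivM f g x a b : cderiv f x a -> cderiv g x b ->
  cderiv (fun t => f t * g t) x (a * g x + f x * b).
Proof.
move=> [f1 f2] [g1 g2]; split.
- rewrite cReD !cReM; under eq_fun do rewrite cReM.
  apply: (@is_derive_eq _ _ _ _ _ _ _ _ (is_deriveB (is_deriveM f1 g1) (is_deriveM f2 g2))).
  rewrite /GRing.scale /=; ring.
- rewrite cImD !cImM; under eq_fun do rewrite cImM.
  apply: (@is_derive_eq _ _ _ _ _ _ _ _ (is_deriveD (is_deriveM f1 g2) (is_deriveM f2 g1))).
  rewrite /GRing.scale /=; ring.
Qed.

Lemma cderiv_real (f : R -> R) (x d : R) : is_derive x (1 : R) f d ->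
  cderiv (fun t => (f t)%:C) x d%:C.
Proof. by move=> h; split => //=; exact: is_derive_cst. Qed.

Lemma cderiv_id x : cderiv (fun t => t%:C) x 1.
Proof. exact: (@cderiv_real id x 1). Qed.

Lemma cderiv_cexp f x a : cderiv f x a ->
  cderiv (fun t => cexp (f t)) x (a * cexp (f x)).
Proof.
move=> [f1 f2].
have h1 := is_derive1_comp (is_derive_expR (Re (f x))) f1.
have h2 := is_derive1_comp (is_derive_cos (Im (f x))) f2.
have h3 := is_derive1_comp (is_derive_sin (Im (f x))) f2.
split.
- rewrite cReM Re_cexp Im_cexp; under eq_fun do rewrite Re_cexp.
  apply: (@is_derive_eq _ _ _ _ _ _ _ _ (is_deriveM h1 h2)).
  rewrite /GRing.scale /=; ring.
- rewrite cImM Re_cexp Im_cexp; under eq_fun do rewrite Im_cexp.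
  apply: (@is_derive_eq _ _ _ _ _ _ _ _ (is_deriveM h1 h3)).
  rewrite /GRing.scale /=; ring.
Qed.

Lemma cderiv_continuous f x d : cderiv f x d ->
  {for x, continuous (fun t => Re (f t))} /\
  {for x, continuous (fun t => Im (f t))}.
Proof.
move=> [[/derivable1_diffP h1 _] [/derivable1_diffP h2 _]].
by split; [exact: (differentiable_continuous h1)|exact: (differentiable_continuous h2)].
Qed.

(** After a rotation f b - f a is its own modulus, and the real mean value theorem applies to Re (u
    f). *)
Lemma mean_value_normc (f df : R -> C) (a b M : R) : a <= b ->
  (forall x, a <= x <= b -> cderiv f x (df x)) ->
  (forall x, a <= x <= b -> normc (df x) <= M) ->
  normc (f b - f a) <= M * (b - a).
Proof.
rewrite le_eqVlt => /orP[/eqP <-|ab] hd hM; first by rewrite !subrr normc0 mulr0.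
have [u nu hu] := exists_rotation (f b - f a).
pose g t := Re (u * f t).
have dg x : a <= x <= b -> is_derive x 1 g (Re (u * df x)).
  move=> hx; have [+ _] := cderivM (cderiv_cst u x) (hd x hx).
  by rewrite mul0r add0r.
have [||c cab hc] := @MVT R g (fun x => Re (u * df x)) a b ab.
- by move=> x; rewrite in_itv /= => /andP[h1 h2]; apply: dg; rewrite !ltW.
- apply: derivable_within_continuous => x; rewrite in_itv /= => hx.
  by have [] := dg x hx.
have <- : g b - g a = normc (f b - f a).
  by rewrite /g -cReN -cReD -mulrBr -hu.
rewrite hc ler_wpM2r ?subr_ge0 ?(ltW ab)//.
apply: le_trans (ler_norm _) _; apply: le_trans (le_Re_normc _) _.
rewrite normcM nu mul1r; apply: hM; move: cab; rewrite in_itv /= => /andP[h1 h2].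
by rewrite !ltW.
Qed.

Lemma cderiv_scale (z : C) x : cderiv (fun t => t%:C * z) x z.
Proof.
have := cderivM (cderiv_id x) (cderiv_cst z x).
by rewrite mul1r mulr0 addr0.
Qed.

Lemma expR_seg (x t : R) : 0 <= t <= 1 -> expR (t * x) <= expR `|x|.
Proof.
move=> /andP[t0 t1]; rewrite ler_expR; apply: le_trans (ler_norm _) _.
by rewrite normrM ger0_norm// ler_piMl.
Qed.

Lemma normc_cexpB1 (z : C) :
  normc (cexp z - 1) <= normc z * expR `|Re z|.
Proof.
have := @mean_value_normc (fun t => cexp (t%:C * z)) (fun t => z * cexp (t%:C * z))
  0 1 (normc z * expR `|Re z|) ler01.
rewrite mul1r mul0r cexp0 subr0 mulr1; apply.
- by move=> x _; apply: cderiv_cexp; exact: cderiv_scale.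
- move=> x hx; rewrite normcM normc_cexp cReM /= mul0r subr0.
  by rewrite ler_wpM2l ?normc_ge0// expR_seg.
Qed.

(** Mean value inequality for e^{tz} - tz on [0, 1], whose derivative z (e^{tz} - 1) is controlled
    by [normc_cexpB1]. *)
Lemma normc_cexpB1B (z : C) :
  normc (cexp z - 1 - z) <= normc z ^+ 2 * expR `|Re z|.
Proof.
have := @mean_value_normc (fun t => cexp (t%:C * z) - t%:C * z)
  (fun t => z * cexp (t%:C * z) - z)
  0 1 (normc z ^+ 2 * expR `|Re z|) ler01.
rewrite mul1r mul0r cexp0 !subr0 mulr1.
rewrite (addrAC (cexp z)); apply.
- move=> x _; apply: cderivD; last exact/cderivN/cderiv_scale.
  by apply: cderiv_cexp; exact: cderiv_scale.
- move=> x /[dup] hx /andP[x0 x1].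
  rewrite -[X in _ - X]mulr1 -mulrBr normcM expr2 -mulrA ler_wpM2l ?normc_ge0//.
  apply: le_trans (normc_cexpB1 _) _.
  rewrite normcM normc_real ger0_norm//.
  rewrite ler_pM ?mulr_ge0 ?normc_ge0 ?expR_ge0//.
    by rewrite ler_piMl ?normc_ge0.
  rewrite cReM /= mul0r subr0 normrM (ger0_norm x0) -{2}(normr_id (Re z)).
  exact: expR_seg.
Qed.

End ComplexDerivative.

(** * Integrals of complex-valued functions *)

Local Arguments normc : simpl never.

Section ComplexMeasurable.
Variable R : realType.
Local Notation C := (complex (Real.sort R)).
Context d (T : measurableType d).
Implicit Types (D : set T) (f g : T -> C).

Definition cmeasurable D f :=
  measurable_fun D (fun x => Re (f x)) /\
  measurable_fun D (fun x => Im (f x)).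

Lemma cmeasurable_cst D (a : C) : cmeasurable D (fun=> a).
Proof. by split; exact: measurable_cst. Qed.

Lemma cmeasurable_real D (f : T -> R) :
  measurable_fun D f -> cmeasurable D (fun x => (f x)%:C).
Proof. by move=> mf; split => //=; exact: measurable_cst. Qed.

Lemma cmeasurable_complex D (f g : T -> R) :
  measurable_fun D f -> measurable_fun D g -> cmeasurable D (fun x => f x +i* g x).
Proof. by move=> mf mg; split. Qed.

Lemma cmeasurableD D f g : cmeasurable D f -> cmeasurable D g ->
  cmeasurable D (fun x => f x + g x).
Proof.
move=> [f1 f2] [g1 g2]; split.
- by under eq_fun do rewrite cReD; exact: measurable_funD.
- by under eq_fun do rewrite cImD; exact: measurable_funD.
Qed.

Lemma cmeasurableN D f : cmeasurable D f -> cmeasurable D (fun x => - f x).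
Proof.
move=> [f1 f2]; split.
- by under eq_fun do rewrite cReN; exact: measurable_funN.
- by under eq_fun do rewrite cImN; exact: measurable_funN.
Qed.

Lemma cmeasurableB D f g : cmeasurable D f -> cmeasurable D g ->
  cmeasurable D (fun x => f x - g x).
Proof. by move=> mf mg; apply: cmeasurableD => //; exact: cmeasurableN. Qed.

Lemma cmeasurableM D f g : cmeasurable D f -> cmeasurable D g ->
  cmeasurable D (fun x => f x * g x).
Proof.
move=> [f1 f2] [g1 g2]; split.
- by under eq_fun do rewrite cReM; apply: measurable_funB; exact: measurable_funM.
- by under eq_fun do rewrite cImM; apply: measurable_funD; exact: measurable_funM.
Qed.

Lemma cReV (z : C) : Re z^-1 =
  Re z * (Re z ^+ 2 + Im z ^+ 2)^-1.
Proof. by case: z. Qed.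

Lemma cImV (z : C) : Im z^-1 =
  - (Im z * (Re z ^+ 2 + Im z ^+ 2)^-1).
Proof. by case: z. Qed.

Lemma cmeasurableV D f : cmeasurable D f -> cmeasurable D (fun x => (f x)^-1).
Proof.
move=> [f1 f2].
have mV : measurable_fun D
    (fun x => (Re (f x) ^+ 2 + Im (f x) ^+ 2)^-1).
  (* The inverse is written as a power with exponent -1, because power functions are measurable on
     all of [R], zero included. *)
  under eq_fun do rewrite -powR_inv1 ?addr_ge0 ?sqr_ge0//.
  apply: (measurableT_comp (measurable_powR (-1))).
  by apply: measurable_funD; apply: measurable_funX.
split.
- by under eq_fun do rewrite cReV; exact: measurable_funM.
- by under eq_fun do rewrite cImV; apply: measurable_funN; exact: measurable_funM.
Qed.

Lemma cmeasurable_sum D (I : Type) (s : seq I) (P : pred I) (F : I -> T -> C) :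
  (forall i, P i -> cmeasurable D (F i)) ->
  cmeasurable D (fun x => \sum_(i <- s | P i) F i x).
Proof.
move=> h; elim: s => [|i s IH].
  by under eq_fun do rewrite big_nil; exact: cmeasurable_cst.
under eq_fun do rewrite big_cons.
by case Pi : (P i) => //; apply: cmeasurableD => //; exact: h.
Qed.

Lemma cmeasurable_prod D (I : Type) (s : seq I) (P : pred I) (F : I -> T -> C) :
  (forall i, P i -> cmeasurable D (F i)) ->
  cmeasurable D (fun x => \prod_(i <- s | P i) F i x).
Proof.
move=> h; elim: s => [|i s IH].
  by under eq_fun do rewrite big_nil; exact: cmeasurable_cst.
under eq_fun do rewrite big_cons.
by case Pi : (P i) => //; apply: cmeasurableM => //; exact: h.
Qed.

Lemma cmeasurable_cexp D f : cmeasurable D f -> cmeasurable D (fun x => cexp (f x)).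
Proof.
move=> [f1 f2]; have me : measurable_fun D (fun x => expR (Re (f x))).
  exact: (measurableT_comp (@measurable_expR R)).
have mc : measurable_fun D (fun x => cos (Im (f x))).
  apply: measurableT_comp f2; apply: continuous_measurable_fun; exact: continuous_cos.
have ms : measurable_fun D (fun x => sin (Im (f x))).
  apply: measurableT_comp f2; apply: continuous_measurable_fun; exact: continuous_sin.
split.
- by under eq_fun do rewrite Re_cexp; exact: measurable_funM.
- by under eq_fun do rewrite Im_cexp; exact: measurable_funM.
Qed.

Lemma cmeasurableS (D E : set T) f : measurable E -> D `<=` E ->
  cmeasurable E f -> cmeasurable D f.
Proof. by move=> mE DE [f1 f2]; split; exact: measurable_funS DE _. Qed.

End ComplexMeasurable.

Lemma cmeasurable_comp (R : realType) d (T : measurableType d) d' (T' : measurableType d') (p : T' -> T)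
    (f : T -> complex (Real.sort R)) :
  measurable_fun setT p -> cmeasurable setT f ->
  cmeasurable setT (fun t => f (p t)).
Proof.
by move=> mp [f1 f2]; split; [exact: measurableT_comp f1 mp|exact: measurableT_comp f2 mp].
Qed.

Section ComplexIntegral.
Variable R : realType.
Local Notation C := (complex (Real.sort R)).
Local Notation mu := (@lebesgue_measure R).
Implicit Types (D : set R) (f g : R -> C).

Definition cintegrable D f :=
  mu.-integrable D (EFin \o (fun x => Re (f x))) /\
  mu.-integrable D (EFin \o (fun x => Im (f x))).

Lemma eq_integrable_EFin D (f g : R -> R) : measurable D ->
  (forall x, D x -> f x = g x) ->
  mu.-integrable D (EFin \o f) -> mu.-integrable D (EFin \o g).
Proof.
move=> mD fg; apply: eq_integrable => // x.
by rewrite inE /= => Dx; rewrite fg.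
Qed.

Lemma integrableZl_EFin D (a : R) (f : R -> R) : measurable D ->
  mu.-integrable D (EFin \o f) -> mu.-integrable D (EFin \o (fun x => a * f x)).
Proof.
move=> mD fi; have := @integrableZl _ _ _ mu D mD a _ fi.
by apply: (@eq_integrable _ _ _ mu D mD) => x _; rewrite /= EFinM.
Qed.

Lemma integrableD_EFin D (f g : R -> R) : measurable D ->
  mu.-integrable D (EFin \o f) -> mu.-integrable D (EFin \o g) ->
  mu.-integrable D (EFin \o (fun x => f x + g x)).
Proof.
move=> mD fi gi; exact: (@integrableD _ _ _ mu D mD _ _ fi gi).
Qed.

Lemma integrableB_EFin D (f g : R -> R) : measurable D ->
  mu.-integrable D (EFin \o f) -> mu.-integrable D (EFin \o g) ->
  mu.-integrable D (EFin \o (fun x => f x - g x)).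
Proof.
move=> mD fi gi; exact: (@integrableB _ _ _ mu D mD _ _ fi gi).
Qed.

Lemma cintegrable_dominated D f (g : R -> R) : measurable D -> cmeasurable D f ->
  mu.-integrable D (EFin \o g) -> (forall x, D x -> normc (f x) <= g x) ->
  cintegrable D f.
Proof.
move=> mD [f1 f2] ig fg; split; apply: le_integrable ig => //=.
- exact/measurable_EFinP.
- move=> x Dx; rewrite lee_fin; apply: le_trans (le_Re_normc _) _.
  exact: le_trans (fg _ Dx) (ler_norm _).
- exact/measurable_EFinP.
- move=> x Dx; rewrite lee_fin; apply: le_trans (le_Im_normc _) _.
  exact: le_trans (fg _ Dx) (ler_norm _).
Qed.

Lemma cintegrable_measurable D f : cintegrable D f -> cmeasurable D f.
Proof.
by move=> [/measurable_int/measurable_EFinP h1 /measurable_int/measurable_EFinP h2].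
Qed.

Lemma eq_cintegral D g f : (forall x, D x -> f x = g x) ->
  cintegral D f = cintegral D g.
Proof.
move=> fg; rewrite /cintegral; congr (_ +i* _);
  by apply: eq_Rintegral => x; rewrite inE => Dx; rewrite fg.
Qed.

Lemma eq_cintegrable D g f : measurable D -> (forall x, D x -> f x = g x) ->
  cintegrable D f -> cintegrable D g.
Proof.
move=> mD fg [f1 f2]; split.
- by apply: (eq_integrable_EFin mD _ f1) => x Dx; rewrite fg.
- by apply: (eq_integrable_EFin mD _ f2) => x Dx; rewrite fg.
Qed.

Lemma cintegrable0 D : cintegrable D (fun=> 0).
Proof. by split; exact: integrable0. Qed.

Lemma cintegrableD D f g : measurable D -> cintegrable D f -> cintegrable D g ->
  cintegrable D (fun x => f x + g x).
Proof.
move=> mD [f1 f2] [g1 g2]; split.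
- by apply: (eq_integrable_EFin mD _ (integrableD_EFin mD f1 g1)) => x _; rewrite cReD.
- by apply: (eq_integrable_EFin mD _ (integrableD_EFin mD f2 g2)) => x _; rewrite cImD.
Qed.

Lemma cintegralD D f g : measurable D -> cintegrable D f -> cintegrable D g ->
  cintegral D (fun x => f x + g x) = cintegral D f + cintegral D g.
Proof.
move=> mD [f1 f2] [g1 g2]; rewrite /cintegral; apply: eqcP; rewrite /= -RintegralD//;
  by apply: eq_Rintegral => x _; rewrite ?cReD ?cImD.
Qed.

Lemma cintegrableZ D (a : C) f : measurable D -> cintegrable D f ->
  cintegrable D (fun x => a * f x).
Proof.
move=> mD [f1 f2]; split.
- apply: (eq_integrable_EFin mD _ (integrableB_EFin mD
    (integrableZl_EFin (Re a) mD f1) (integrableZl_EFin (Im a) mD f2))).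
  by move=> x _; rewrite cReM.
- apply: (eq_integrable_EFin mD _ (integrableD_EFin mD
    (integrableZl_EFin (Re a) mD f2) (integrableZl_EFin (Im a) mD f1))).
  by move=> x _; rewrite cImM.
Qed.

Lemma cintegralZ D (a : C) f : measurable D -> cintegrable D f ->
  cintegral D (fun x => a * f x) = a * cintegral D f.
Proof.
move=> mD [f1 f2]; rewrite /cintegral.
have e1 c := integrableZl_EFin c mD f1.
have e2 c := integrableZl_EFin c mD f2.
apply: eqcP; rewrite ?cReM ?cImM /= -!RintegralZl// -?RintegralB -?RintegralD//;
  by apply: eq_Rintegral => x _; rewrite ?cReM ?cImM.
Qed.

Lemma cintegrableN D f : measurable D -> cintegrable D f ->
  cintegrable D (fun x => - f x).
Proof.
move=> mD /(cintegrableZ (-1) mD); apply: eq_cintegrable => // x _.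
by rewrite mulN1r.
Qed.

Lemma cintegralN D f : measurable D -> cintegrable D f ->
  cintegral D (fun x => - f x) = - cintegral D f.
Proof.
move=> mD fi; rewrite -mulN1r -cintegralZ//.
by apply: eq_cintegral => x _; rewrite mulN1r.
Qed.

Lemma cintegrableB D f g : measurable D -> cintegrable D f -> cintegrable D g ->
  cintegrable D (fun x => f x - g x).
Proof. by move=> mD fi gi; apply: cintegrableD => //; exact: cintegrableN. Qed.

Lemma cintegralB D f g : measurable D -> cintegrable D f -> cintegrable D g ->
  cintegral D (fun x => f x - g x) = cintegral D f - cintegral D g.
Proof.
move=> mD fi gi; rewrite cintegralD//; last exact: cintegrableN.
by rewrite cintegralN.
Qed.

Lemma cintegral0 D : cintegral D (fun=> 0) = 0 :> C.
Proof. by rewrite /cintegral /= /Rintegral integral0. Qed.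

Lemma cintegrable_sum D (I : Type) (s : seq I) (F : I -> R -> C) : measurable D ->
  (forall i, cintegrable D (F i)) -> cintegrable D (fun x => \sum_(i <- s) F i x).
Proof.
move=> mD h; elim: s => [|i s IH].
  by under eq_fun do rewrite big_nil; exact: cintegrable0.
by under eq_fun do rewrite big_cons; exact: cintegrableD.
Qed.

Lemma cintegral_sum D (I : Type) (s : seq I) (F : I -> R -> C) : measurable D ->
  (forall i, cintegrable D (F i)) ->
  cintegral D (fun x => \sum_(i <- s) F i x) = \sum_(i <- s) cintegral D (F i).
Proof.
move=> mD h; elim: s => [|i s IH].
  by under eq_fun do rewrite big_nil; rewrite cintegral0 big_nil.
under eq_fun do rewrite big_cons.
by rewrite cintegralD// ?IH ?big_cons//; exact: cintegrable_sum.
Qed.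

(** A rotation makes the integral real, so that only the real part of u f, which is at most g, has
    to be integrated. *)
Lemma le_normc_cintegral D f (g : R -> R) : measurable D -> cmeasurable D f ->
  mu.-integrable D (EFin \o g) -> (forall x, D x -> normc (f x) <= g x) ->
  normc (cintegral D f) <= \int[mu]_(x in D) g x.
Proof.
move=> mD mf ig fg; have fi := cintegrable_dominated mD mf ig fg.
have [u nu hu] := exists_rotation (cintegral D f).
have -> : normc (cintegral D f) = Re (u * cintegral D f) by rewrite -hu.
have [ui _] := cintegrableZ u mD fi.
rewrite -cintegralZ//= le_Rintegral// => x Dx.
apply: le_trans (ler_norm _) _; apply: le_trans (le_Re_normc _) _.
by rewrite normcM nu mul1r fg.
Qed.

(** The bound by g passes to the pointwise limit, which is therefore integrable; dominated
    convergence is then applied to real and imaginary parts. *)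
Lemma cvg_cintegral D (F : nat -> R -> C) f (g : R -> R) : measurable D ->
  (forall n, cmeasurable D (F n)) -> (forall x, D x -> F n x @[n --> \oo] --> f x) ->
  mu.-integrable D (EFin \o g) -> (forall n x, D x -> normc (F n x) <= g x) ->
  cintegrable D f /\ cintegral D (F n) @[n --> \oo] --> cintegral D f.
Proof.
move=> mD mF Ff ig Fg.
have fin (h1 : R -> R) : mu.-integrable D (EFin \o h1) ->
    (\int[mu]_(x in D) (h1 x)%:E \is a fin_num)%E by exact: integrable_fin_num.
have Fi n := cintegrable_dominated mD (mF n) ig (Fg n).
have mf : cmeasurable D f.
  split.
    apply: (@measurable_fun_cvg _ _ _ D (fun n x => Re (F n x))) => //.
      by move=> n; have [] := mF n.
    by move=> x Dx; apply: cvgc_Re; exact: Ff.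
  apply: (@measurable_fun_cvg _ _ _ D (fun n x => Im (F n x))) => //.
    by move=> n; have [] := mF n.
  by move=> x Dx; apply: cvgc_Im; exact: Ff.
have fi : cintegrable D f.
  apply: (cintegrable_dominated mD mf ig) => x Dx.
  rewrite leNgt; apply/negP => lt.
  have /cvgcP/(_ (normc (f x) - g x)) := Ff x Dx.
  rewrite subr_gt0 => /(_ lt) [n _ /(_ n (leqnn n))] /=.
  rewrite normc_distC ltNge => /negP; apply.
  apply: le_trans (lerB_normc _ _); rewrite lerB//; exact: Fg.
split => //; apply: cvgc_ReIm => /=.
- have := @dominated_cvg _ _ _ mu D mD (fun n => EFin \o (fun x => Re (F n x)))
    (EFin \o (fun x => Re (f x))) (EFin \o g).
  move=> /(_ _ _ _ ig) h; have {h} : (\int[mu]_(x in D) (Re (F n x))%:E)%E @[n --> \oo]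
      --> (\int[mu]_(x in D) (Re (f x))%:E)%E.
    apply: h => //.
    + by move=> n; apply/measurable_EFinP; have [] := mF n.
    + move=> x Dx; apply/cvg_EFin; first exact: nearW.
      by apply: cvgc_Re; exact: Ff.
    + move=> n x Dx /=; rewrite lee_fin.
      exact: le_trans (le_Re_normc _) (Fg n x Dx).
  have /= e := fineK (fin _ fi.1).
  by rewrite -{1}e => /fine_cvg.
- have := @dominated_cvg _ _ _ mu D mD (fun n => EFin \o (fun x => Im (F n x)))
    (EFin \o (fun x => Im (f x))) (EFin \o g).
  move=> /(_ _ _ _ ig) h; have {h} : (\int[mu]_(x in D) (Im (F n x))%:E)%E @[n --> \oo]
      --> (\int[mu]_(x in D) (Im (f x))%:E)%E.
    apply: h => //.
    + by move=> n; apply/measurable_EFinP; have [] := mF n.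
    + move=> x Dx; apply/cvg_EFin; first exact: nearW.
      by apply: cvgc_Im; exact: Ff.
    + move=> n x Dx /=; rewrite lee_fin.
      exact: le_trans (le_Im_normc _) (Fg n x Dx).
  have /= e := fineK (fin _ fi.2).
  by rewrite -{1}e => /fine_cvg.
Qed.

(** [Rintegral] is [fine] of the difference of the integrals of the positive and negative parts.
    Tonelli makes each of them measurable in the parameter, and [fine] is measurable, whatever value
    it takes where the integral diverges. *)
Lemma measurable_Rintegral_param d (T : measurableType d) D (f : T * R -> R) :
  measurable D -> measurable_fun setT f ->
  measurable_fun setT (fun t => \int[mu]_(x in D) f (t, x)).
Proof.
move=> mD mf; pose F : T * R -> \bar R := fun p => (f p * \1_D p.2)%:E.
have mF : measurable_fun setT F.
  apply/measurable_EFinP; apply: measurable_funM => //.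
  have m1 : measurable_fun setT (\1_D : R -> R) by exact: measurable_indic.
  exact: (measurableT_comp m1 measurable_snd).
have h1 := @measurable_fun_fubini_tonelli_F _ _ _ _ _ mu (F^\+)%E
  (measurable_funepos mF) (fun x => funepos_ge0 F x).
have h2 := @measurable_fun_fubini_tonelli_F _ _ _ _ _ mu (F^\-)%E
  (measurable_funeneg mF) (fun x => funeneg_ge0 F x).
have -> : (fun t => \int[mu]_(x in D) f (t, x)) =
    fine \o (fun t => fubini_F mu (F^\+)%E t - fubini_F mu (F^\-)%E t)%E.
  apply/funext => t; rewrite /Rintegral /=; congr fine.
  rewrite integral_mkcond integralE /fubini_F; congr (_ - _)%E;
    apply: eq_integral => x _; rewrite !(funeposE, funenegE) /F /patch /= indicE;
    by case: ifPn => _; rewrite ?mulr1 ?mulr0.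
by apply: measurableT_comp => //; exact: emeasurable_funB.
Qed.

Lemma cmeasurable_cintegral_param d (T : measurableType d) D (f : T * R -> C) :
  measurable D -> cmeasurable setT f ->
  cmeasurable setT (fun t => cintegral D (fun x => f (t, x))).
Proof.
move=> mD [f1 f2]; split => /=.
- exact: (measurable_Rintegral_param mD f1).
- exact: (measurable_Rintegral_param mD f2).
Qed.

Lemma integrable_cst_itv (a b : R) (c : R) :
  mu.-integrable `[a, b] (EFin \o (fun=> c)).
Proof.
apply: continuous_compact_integrable; first exact: segment_compact.
by apply: continuous_subspaceT => x; exact: cvg_cst.
Qed.

Lemma Rintegral_cst_itv (a b c : R) : a <= b ->
  \int[mu]_(x in `[a, b]) c = c * (b - a).
Proof.
move=> ab; rewrite Rintegral_cst//; congr (_ * _).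
have := lebesgue_measure_itv `[a, b]; rewrite /= lte_fin => ->.
by move: ab; rewrite le_eqVlt => /orP[/eqP ->|->//]; rewrite ltxx subrr.
Qed.

Lemma le_normc_cintegral_itv f (a b M : R) : a <= b -> cmeasurable `[a, b] f ->
  (forall x, a <= x <= b -> normc (f x) <= M) ->
  normc (cintegral `[a, b] f) <= M * (b - a).
Proof.
move=> ab mf fM; rewrite -Rintegral_cst_itv//.
apply: (@le_normc_cintegral _ _ (fun=> M)) => //; exact: integrable_cst_itv.
Qed.

Lemma cintegral_cst_itv (a b : R) (c : C) : a <= b ->
  cintegral `[a, b] (fun=> c) = c * (b - a)%:C.
Proof.
move=> ab; rewrite /cintegral !Rintegral_cst_itv//.
by apply: eqcP; rewrite ?cReM ?cImM /= mulr0 ?subr0 ?add0r.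
Qed.

Lemma cintegrable_continuous (a b : R) f :
  (forall x, a <= x <= b -> {for x, continuous (fun t => Re (f t))} /\
    {for x, continuous (fun t => Im (f t))}) ->
  cintegrable `[a, b] f.
Proof.
move=> h; split; apply: continuous_compact_integrable; try exact: segment_compact.
- apply/continuous_in_subspaceT => x /[!inE] /=; rewrite in_itv => hx.
  by have [] := h x hx.
- apply/continuous_in_subspaceT => x /[!inE] /=; rewrite in_itv => hx.
  by have [] := h x hx.
Qed.

Lemma Rintegral_split (a b c : R) (g : R -> R) : a <= b -> b <= c ->
  mu.-integrable `[a, c] (EFin \o g) ->
  \int[mu]_(x in `[a, c]) g x =
  \int[mu]_(x in `[a, b]) g x + \int[mu]_(x in `[b, c]) g x.
Proof.
move=> ab bc ig; have := @Rintegral_itvB R g (BLeft a) (BRight c) b ig.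
rewrite !bnd_simp => /(_ ab bc) h.
have ib : mu.-integrable `]b, c] (EFin \o g).
  by apply: integrableS ig => //; apply: subset_itvr; rewrite bnd_simp.
by rewrite -(Rintegral_itv_obnd_cbnd ib) -h addrC subrK.
Qed.

Lemma cintegral_split (a b c : R) f : a <= b -> b <= c -> cintegrable `[a, c] f ->
  cintegral `[a, c] f = cintegral `[a, b] f + cintegral `[b, c] f.
Proof. by move=> ab bc [f1 f2]; rewrite /cintegral !(@Rintegral_split a b c). Qed.

Lemma cintegral_mkcond D (E : set R) f : E `<=` D ->
  cintegral E f = cintegral D (fun x => if x \in E then f x else 0).
Proof.
move=> ED.
have key (g h : R -> R) : (forall x, h x = if x \in E then g x else 0) ->
   \int[mu]_(x in E) g x = \int[mu]_(x in D) h x.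
  move=> hh; rewrite -(setIidr ED) Rintegral_mkcondr; apply: eq_Rintegral => x _.
  by rewrite /patch hh.
by rewrite /cintegral; congr (_ +i* _); apply: key => x; case: ifP.
Qed.

End ComplexIntegral.

(** * Goursat's lemma and the identity principle in a disc *)

Local Opaque cexp.

Section Goursat.
Variable R : realType.
Local Notation C := (complex (Real.sort R)).
Local Notation mu := (@lebesgue_measure R).

Lemma nbhs_normcP (p : C) (P : C -> Prop) :
  (\forall z \near p, P z) <->
  (exists2 e : R, 0 < e & forall z : C, normc (z - p) < e -> P z).
Proof.
split.
  move=> /nbhs_ballP [[e e'] /=]; rewrite ltcE /= => /andP[/eqP -> e0] h.
  exists e => // z hz; apply: h; rewrite -ball_normE.
  by move: hz; rewrite normc_distC -ltcR -(normrcE (p - z)).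
move=> [e e0 h]; apply/nbhs_ballP; exists e%:C => /=; first by rewrite ltcR.
by move=> z; rewrite -ball_normE /= normrcE ltcR normc_distC; exact: h.
Qed.

(** Complex differentiability in the form consumed by Goursat's argument: approximation by an affine
    function with error e |z - p|. *)
Definition cdiff_at (F : C -> C) (p : C) := exists a : C, forall e : R, 0 < e ->
  exists2 d : R, 0 < d & forall z : C, normc (z - p) < d ->
    normc (F z - F p - a * (z - p)) <= e * normc (z - p).

Lemma differentiable_cdiff_at (F : C -> C) p : differentiable F p -> cdiff_at F p.
Proof.
move=> /derivable1_diffP/cvg_ex[a /cvgcP ha]; exists a => e e0.
have /(_ e e0) := ha; rewrite near_withinE => /nbhs_normcP[d d0 hd].
exists d => // z zd; have [->|zp] := eqVneq z p.
  by rewrite !subrr mulr0 subrr normc0 mulr0.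
have n0 : z - p != 0 by rewrite subr_eq0.
have := hd (z - p); rewrite subr0 => /(_ zd n0).
rewrite /= [_ *: 1]mulr1 subrK => /ltW h.
have -> : F z - F p - a * (z - p) =
    ((z - p)^-1 *: (F z - F p) - a) * (z - p).
  by rewrite mulrBl [(_ *: _)]/(_ * _) mulrAC mulVf// mul1r.
by rewrite normcM ler_wpM2r// normc_ge0.
Qed.

Lemma differentiable_cexp (p : C) : differentiable (@cexp R) p.
Proof.
apply/derivable1_diffP/cvg_ex; exists (cexp p); apply/cvgcP => e e0.
rewrite near_withinE; apply/nbhs_normcP.
(* |h| < 1 bounds e^{|Re h|} by e^1 in the quadratic remainder; the factor 2 is slack. *)
pose d := Num.min 1 (e / (normc (cexp p) * expR 1 * 2)).
have c0 : 0 < normc (cexp p) * expR 1.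
  by rewrite mulr_gt0 ?expR_gt0// normc_gt0 cexp_neq0.
exists d; first by rewrite lt_min ltr01 divr_gt0// mulr_gt0.
move=> h; rewrite subr0 lt_min => /andP[h1 h2] h0 /=.
rewrite [_ *: 1]mulr1.
have -> : h^-1 *: (cexp (h + p) - cexp p) - cexp p =
    cexp p * (cexp h - 1 - h) * h^-1.
  have sc (x y : C) : x *: y = x * y by [].
  rewrite sc cexpD; move: (cexp h) (cexp p) => u v.
  have e1 : v = v * (h : C) / h by rewrite mulfK.
  by rewrite [X in _ - X = _]e1; ring.
have nh : 0 < normc h by rewrite normc_gt0.
rewrite normcM normcV ltr_pdivrMr// (normcM (cexp p)).
apply: (@le_lt_trans _ _ (normc (cexp p) * (normc h ^+ 2 * expR 1))).
  rewrite ler_wpM2l ?normc_ge0//; apply: le_trans (normc_cexpB1B _) _.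
  rewrite ler_wpM2l ?sqr_ge0// ler_expR; apply: le_trans (le_Re_normc _) _.
  exact: ltW.
have -> : normc (cexp p) * (normc h ^+ 2 * expR 1) =
    (normc h * (normc (cexp p) * expR 1)) * normc h by ring.
rewrite ltr_pM2r//; move: h2; rewrite ltr_pdivlMr ?mulr_gt0 ?expR_gt0 ?normc_gt0 ?cexp_neq0// => h2.
apply: le_lt_trans h2; rewrite ler_wpM2l ?normc_ge0//.
by rewrite ler_peMr ?ler1n// ltW.
Qed.

Lemma cdiff_at_continuous F p : cdiff_at F p -> forall e : R, 0 < e ->
  exists2 d : R, 0 < d & forall z : C, normc (z - p) < d -> normc (F z - F p) < e.
Proof.
move=> [a ha] e e0; have [d d0 hd] := ha 1 ltr01.
exists (Num.min d (e / (normc a + 2))).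
  by rewrite lt_min d0 divr_gt0// ltr_wpDl// normc_ge0.
move=> z; rewrite lt_min => /andP[zd ze].
have := hd z zd; rewrite mul1r => h.
have -> : F z - F p = (F z - F p - a * (z - p)) + a * (z - p) by rewrite subrK.
apply: le_lt_trans (ler_normcD _ _) _; rewrite normcM.
move: ze; rewrite ltr_pdivlMr ?ltr_wpDl ?normc_ge0//.
have := normc_ge0 (z - p); have := normc_ge0 a; nra.
Qed.

Lemma cdiff_at_line F (g : R -> C) x : cdiff_at F (g x) ->
  (forall y, normc (g y - g x) = `|y - x|) ->
  {for x, continuous (fun t => Re (F (g t)))} /\
  {for x, continuous (fun t => Im (F (g t)))}.
Proof.
move=> /cdiff_at_continuous hF hg.
have h : F (g t) @[t --> x] --> F (g x).
  apply/cvgcP => e e0; have [d d0 hd] := hF e e0.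
  near=> y; apply: hd; rewrite hg.
  by near: y; apply: cvgr_distC_lt.
by split; [exact: cvgc_Re h|exact: cvgc_Im h].
Unshelve. all: by end_near. Qed.

Definition hside (F : C -> C) (a b y : R) := cintegral `[a, b] (fun x => F (x +i* y)).
Definition vside (F : C -> C) (c d x : R) := cintegral `[c, d] (fun y => F (x +i* y)).
(** The contour integral of F(z) dz along the boundary of [a, b] x [c, d], counterclockwise; dz = i
    dy on the vertical sides. *)
Definition boundary_integral (F : C -> C) (a b c d : R) : C :=
  hside F a b c - hside F a b d + 'i%C * (vside F c d b - vside F c d a).

Section Rectangle.
Variables (F : C -> C) (h : R).
(** A left half-plane is the domain that matters: w |-> e^w maps it onto a disc punctured at 0. *)
Hypothesis Fd : forall p : C, Re p < h -> cdiff_at F p.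

Lemma normc_horizontal (x x' y : R) : normc ((x +i* y) - (x' +i* y) : C) = `|x - x'|.
Proof. by rewrite /normc /= subrr expr0n addr0 sqrtr_sqr. Qed.

Lemma normc_vertical (x y y' : R) : normc ((x +i* y) - (x +i* y') : C) = `|y - y'|.
Proof. by rewrite /normc /= subrr expr0n add0r sqrtr_sqr. Qed.

Lemma hside_integrable (a b y : R) : b < h ->
  cintegrable `[a, b] (fun x => F (x +i* y)).
Proof.
move=> bh; apply: cintegrable_continuous => x /andP[_ xb].
apply: cdiff_at_line; first by apply: Fd; exact: le_lt_trans bh.
by move=> z; exact: normc_horizontal.
Qed.

Lemma vside_integrable (c d x : R) : x < h ->
  cintegrable `[c, d] (fun y => F (x +i* y)).
Proof.
move=> xh; apply: cintegrable_continuous => y _.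
apply: cdiff_at_line; first exact: Fd.
by move=> z; exact: normc_vertical.
Qed.

Lemma boundary_integral_split (a m b c n d : R) : a <= m <= b -> b < h ->
  c <= n <= d ->
  boundary_integral F a b c d = boundary_integral F a m c n +
    boundary_integral F m b c n + boundary_integral F a m n d +
    boundary_integral F m b n d.
Proof.
move=> /andP[am mb] bh /andP[cn nd].
have mh := le_lt_trans mb bh; have ah := le_lt_trans am mh.
have H y : hside F a b y = hside F a m y + hside F m b y.
  exact: cintegral_split am mb (hside_integrable _ _ bh).
have V x : x < h -> vside F c d x = vside F c n x + vside F n d x.
  by move=> xh; exact: cintegral_split cn nd (vside_integrable _ _ xh).
by rewrite /boundary_integral !H !V//; ring.
Qed.

(** An affine function has zero boundary integral, so F may be replaced by its difference from al +
    be (z - p); the four sides then contribute at most M times the perimeter. *)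
Lemma boundary_integral_affine_le (al be p : C) (a b c d M : R) : a <= b -> b < h ->
  c <= d ->
  (forall x y, a <= x <= b -> c <= y <= d ->
    normc (F (x +i* y) - al - be * ((x +i* y) - p)) <= M) ->
  normc (boundary_integral F a b c d) <= 2 * M * ((b - a) + (d - c)).
Proof.
move=> ab bh cd hM.
pose A (z : C) : C := al + be * (z - p).
have Ad z : cdiff_at A z.
  exists be => e e0; exists 1 => // w _.
  have -> : A w - A z - be * (w - z) = 0 by rewrite /A; ring.
  by rewrite normc0 mulr_ge0 ?normc_ge0// ltW.
have Hi y : cintegrable `[a, b] (fun x => A (x +i* y)).
  apply: cintegrable_continuous => x _; apply: cdiff_at_line => // z.
  exact: normc_horizontal.
have Vi x : cintegrable `[c, d] (fun y => A (x +i* y)).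
  apply: cintegrable_continuous => y _; apply: cdiff_at_line => // z.
  exact: normc_vertical.
have A0 : boundary_integral A a b c d = 0.
  rewrite /boundary_integral /hside /vside -!cintegralB//.
  rewrite (@eq_cintegral _ _ (fun=> be * (0 +i* (c - d)))); last first.
    move=> x _; have -> : 0 +i* (c - d) = (x +i* c) - (x +i* d) :> C.
      by apply: eqcP; rewrite /= ?subrr.
    by rewrite /A; ring.
  rewrite [in X in _ + X](@eq_cintegral _ _ (fun=> be * ((b - a) +i* 0))); last first.
    move=> x _; have -> : (b - a) +i* 0 = (b +i* x) - (a +i* x) :> C.
      by apply: eqcP; rewrite /= ?subrr.
    by rewrite /A; ring.
  rewrite !cintegral_cst_itv//.
  by case: (be) => b1 b2; apply: eqcP; rewrite !(cReD, cImD, cReM, cImM) /=; ring.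
have -> : boundary_integral F a b c d =
    boundary_integral (fun z => F z - A z) a b c d.
  rewrite -[LHS]subr0 -A0 /boundary_integral /hside /vside.
  have ah := le_lt_trans ab bh.
  have FH y := hside_integrable a y bh.
  have FV x xh := @vside_integrable c d x xh.
  by rewrite !cintegralB//; [ring|exact: FV|exact: FV].
have hM' x y : a <= x <= b -> c <= y <= d -> normc (F (x +i* y) - A (x +i* y)) <= M.
  by move=> xab ycd; rewrite /A opprD addrA; exact: hM.
have hb y : c <= y <= d -> normc (hside (fun z => F z - A z) a b y) <= M * (b - a).
  move=> ycd; apply: le_normc_cintegral_itv => //.
    apply: cintegrable_measurable; apply: cintegrableB => //.
    exact: hside_integrable.
  by move=> x xab; exact: hM'.
have vb x : a <= x <= b -> normc (vside (fun z => F z - A z) c d x) <= M * (d - c).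
  move=> xab; apply: le_normc_cintegral_itv => //.
    apply: cintegrable_measurable; apply: cintegrableB => //.
    by apply: vside_integrable; case/andP: xab => _ xb; exact: le_lt_trans bh.
  by move=> y ycd; exact: hM'.
have h1 : normc (hside (fun z => F z - A z) a b c) <= M * (b - a).
  by apply: hb; rewrite lexx.
have h2 : normc (hside (fun z => F z - A z) a b d) <= M * (b - a).
  by apply: hb; rewrite lexx cd.
have h3 : normc (vside (fun z => F z - A z) c d a) <= M * (d - c).
  by apply: vb; rewrite lexx.
have h4 : normc (vside (fun z => F z - A z) c d b) <= M * (d - c).
  by apply: vb; rewrite lexx ab.
apply: le_trans (ler_normcD _ _) _; rewrite normcM normc_i mul1r mulrDr.
rewrite -mulrA -mulrA !mulr_natl !mulr2n.
by apply: lerD; (apply: le_trans (le_normcB _ _) _); apply: lerD.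
Qed.

Lemma goursat (a b c d : R) : a <= b -> b < h -> c <= d ->
  boundary_integral F a b c d = 0.
Proof.
move=> ab bh cd; apply/eqP; rewrite -normc_eq0; apply/eqP.
set eta := normc _; apply/eqP; rewrite eq_le normc_ge0 andbT leNgt.
apply/negP => eta0.
pose w n : R := (b - a) / 2 ^+ n; pose l n : R := (d - c) / 2 ^+ n.
have w0 n : 0 <= w n by rewrite divr_ge0 ?subr_ge0// exprn_ge0.
have l0 n : 0 <= l n by rewrite divr_ge0 ?subr_ge0// exprn_ge0.
have wS n : w n = w n.+1 + w n.+1.
  by rewrite /w exprS; field; rewrite expf_neq0.
have lS n : l n = l n.+1 + l n.+1.
  by rewrite /l exprS; field; rewrite expf_neq0.
(* [q] is the lower left corner of a rectangle reached after n halvings which still carries the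
   share 4^{-n} of the initial integral. Only abscissas are confined, because [Fd] restricts only
   real parts. *)
pose P n (q : R * R) := [/\ a <= q.1, q.1 + w n <= b &
  eta <= 4 ^+ n * normc (boundary_integral F q.1 (q.1 + w n) q.2 (q.2 + l n))].
pose next n (q q' : R * R) := [/\ P n.+1 q', q.1 <= q'.1, q'.1 + w n.+1 <= q.1 + w n,
  q.2 <= q'.2 & q'.2 + l n.+1 <= q.2 + l n].
have step n q : P n q -> exists q', next n q q'.
  move=> [qa qb qe].
  pose B x y := normc (boundary_integral F x (x + w n.+1) y (y + l n.+1)).
  suff [q' [hq' eq1 eq2]] : exists q' : R * R, [/\ eta <= 4 ^+ n.+1 * B q'.1 q'.2,
      q'.1 = q.1 \/ q'.1 = q.1 + w n.+1 & q'.2 = q.2 \/ q'.2 = q.2 + l n.+1].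
    have e1 : 0 <= w n.+1 <= w n by rewrite w0 (wS n) lerDl w0.
    have e2 : 0 <= l n.+1 <= l n by rewrite l0 (lS n) lerDl l0.
    have [e1a e1b] := andP e1; have [e2a e2b] := andP e2.
    have c1 : q.1 <= q'.1 /\ q'.1 + w n.+1 <= q.1 + w n.
      by case: eq1 => ->; rewrite ?(wS n) ?addrA lexx ?lerDl ?lerD2l; split => //.
    have c2 : q.2 <= q'.2 /\ q'.2 + l n.+1 <= q.2 + l n.
      by case: eq2 => ->; rewrite ?(lS n) ?addrA lexx ?lerDl ?lerD2l; split => //.
    case: c1 c2 => c1 c1' [c2 c2']; exists q'; split => //; split => //.
      exact: le_trans c1.
    exact: le_trans qb.
  (* If all four quarters fell below their share, so would their sum, which is the integral over the
     parent rectangle. *)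
  apply: contrapT => /forallNP hn.
  have lt q' : (q'.1 = q.1 \/ q'.1 = q.1 + w n.+1) ->
      (q'.2 = q.2 \/ q'.2 = q.2 + l n.+1) -> 4 ^+ n.+1 * B q'.1 q'.2 < eta.
    by move=> h1 h2; rewrite ltNge; apply/negP => h3; apply: (hn q').
  have := lt (q.1, q.2) (or_introl erefl) (or_introl erefl).
  have := lt (q.1 + w n.+1, q.2) (or_intror erefl) (or_introl erefl).
  have := lt (q.1, q.2 + l n.+1) (or_introl erefl) (or_intror erefl).
  have := lt (q.1 + w n.+1, q.2 + l n.+1) (or_intror erefl) (or_intror erefl).
  rewrite [(_, _).1]/= [(_, _).2]/= => h1 h2 h3 h4.
  have tri : normc (boundary_integral F q.1 (q.1 + w n) q.2 (q.2 + l n)) <=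
      B q.1 q.2 + B (q.1 + w n.+1) q.2 + B q.1 (q.2 + l n.+1) +
      B (q.1 + w n.+1) (q.2 + l n.+1).
    have ew : q.1 + w n = q.1 + w n.+1 + w n.+1 by rewrite (wS n) addrA.
    have el : q.2 + l n = q.2 + l n.+1 + l n.+1 by rewrite (lS n) addrA.
    rewrite (@boundary_integral_split _ (q.1 + w n.+1) _ _ (q.2 + l n.+1)).
    - rewrite ew el; exact: ler_normcD4.
    - by rewrite ew !lerDl w0.
    - exact: le_lt_trans bh.
    - by rewrite el !lerDl l0.
  have := le_trans qe (ler_wpM2l (exprn_ge0 n (ler0n R 4)) tri).
  move: h1 h2 h3 h4; rewrite exprS.
  move: (B _ _) (B _ _) (B _ _) (B _ _) (4 ^+ n) => b1 b2 b3 b4 t.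
  clear; lra.
have P0 : P 0%N (a, c).
  rewrite /P /w /l /= expr0 !divr1 !subrKC lexx; split => //.
  by rewrite mul1r /eta.
pose u := fix u n : R * R := if n is n'.+1 then get [set q' | next n' (u n') q'] else (a, c).
have uP n : P n (u n) /\ next n (u n) (u n.+1).
  have nx m : P m (u m) -> next m (u m) (u m.+1).
    by move=> /step [q' hq']; exact: (@getPex _ [set q' | next m (u m) q'] (ex_intro _ q' hq')).
  by elim: n => [|n [_ [Pn _ _ _ _]]]; split => //; apply: nx.
(* Nested intervals [f n, f n + v n] share the supremum of their left ends. *)
have key (f : nat -> R) (v : nat -> R) : (forall n, 0 <= v n) ->
    (forall n, f n <= f n.+1) -> (forall n, f n.+1 + v n.+1 <= f n + v n) ->
    exists X, forall n, f n <= X <= f n + v n.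
  move=> v0 fi fv; exists (sup (range f)) => n.
  have mono m k : (m <= k)%N -> f m <= f k.
    by move/subnK => <-; elim: (k - m)%N => // j IH; exact: le_trans IH (fi _).
  have mono' m k : (m <= k)%N -> f k + v k <= f m + v m.
    by move/subnK => <-; elim: (k - m)%N => // j IH; exact: le_trans (fv _) IH.
  have ub : ubound (range f) (f n + v n).
    move=> _ [m _ <-]; case: (leqP m n) => mn.
      by apply: le_trans (mono _ _ mn) _; rewrite lerDl.
    apply: le_trans (mono' _ _ (ltnW mn)); by rewrite lerDl.
  apply/andP; split.
    by apply: ub_le_sup; [exists (f n + v n)|exists n].
  by apply: ge_sup => //; exists (f n); exists n.
have [X hX] : exists X, forall n, (u n).1 <= X <= (u n).1 + w n.
  by apply: key => // n; have [_ []] := uP n.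
have [Y hY] : exists Y, forall n, (u n).2 <= Y <= (u n).2 + l n.
  by apply: key => // n; have [_ []] := uP n.
have Xh : X < h.
  apply: le_lt_trans bh; have /andP[_ h1] := hX 0%N.
  by apply: le_trans h1 _; have [[_]] := uP 0%N.
have [be hbe] := @Fd (X +i* Y) Xh.
pose S := (b - a) + (d - c).
have S0 : 0 <= S by rewrite addr_ge0// subr_ge0.
(* With this tolerance the affine estimate, multiplied by 4^n, gives eta 2 S^2 / (2 S^2 + 1) < eta
   for every n; the + 1 also covers S = 0. *)
have e0 : 0 < eta / (2 * S ^+ 2 + 1).
  by rewrite divr_gt0// ltr_wpDl// mulr_ge0// sqr_ge0.
have [dl dl0 hdl] := hbe _ e0.
have [n hn] : exists n, S / 2 ^+ n < dl.
  exists (Num.truncn (S / dl)).+1.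
  rewrite ltr_pdivrMr ?exprn_gt0// mulrC -ltr_pdivrMr//.
  apply: lt_trans (truncnS_gt _) _; rewrite -natrX ltr_nat.
  exact: ltn_expl.
have [[Pa Pb Pe] _] := uP n.
have wl : w n + l n = S / 2 ^+ n by rewrite /w /l -mulrDl.
have := @boundary_integral_affine_le (F (X +i* Y)) be (X +i* Y) (u n).1 ((u n).1 + w n)
  (u n).2 ((u n).2 + l n) (eta / (2 * S ^+ 2 + 1) * (S / 2 ^+ n)).
rewrite !lerDl w0 l0 => /(_ isT (le_lt_trans Pb bh) isT) /=.
have bnd x y : (u n).1 <= x <= (u n).1 + w n -> (u n).2 <= y <= (u n).2 + l n ->
  normc ((x +i* y) - (X +i* Y) : C) <= S / 2 ^+ n.
  move=> /andP[x1 x2] /andP[y1 y2]; apply: le_trans (normc_le _) _ => /=.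
  have /andP[h1 h2] := hX n; have /andP[h3 h4] := hY n.
  by rewrite -wl lerD// ler_norml; apply/andP; split; lra.
move=> hh; have {}hh := hh _.
have : normc (boundary_integral F (u n).1 ((u n).1 + w n) (u n).2 ((u n).2 + l n)) <=
    2 * (eta / (2 * S ^+ 2 + 1) * (S / 2 ^+ n)) * (S / 2 ^+ n).
  rewrite -wl; have := hh.
  rewrite (_ : (u n).1 + w n - (u n).1 + ((u n).2 + l n - (u n).2) = w n + l n); last by ring.
  rewrite -!wl; apply => x y hx hy.
  apply: le_trans (hdl _ (le_lt_trans (bnd x y hx hy) hn)) _.
  by rewrite wl ler_wpM2l ?(ltW e0)//; exact: bnd.
move=> le1; move: Pe; apply/negP; rewrite -ltNge.
apply: (@le_lt_trans _ _ (4 ^+ n * (2 * (eta / (2 * S ^+ 2 + 1) * (S / 2 ^+ n)) * (S / 2 ^+ n)))).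
  by rewrite ler_wpM2l// exprn_ge0.
have -> : 4 ^+ n * (2 * (eta / (2 * S ^+ 2 + 1) * (S / 2 ^+ n)) * (S / 2 ^+ n)) =
    eta * (2 * S ^+ 2) / (2 * S ^+ 2 + 1).
  rewrite (_ : 4 = 2 * 2 :> R) ?exprMn; last by rewrite -natrM.
  by field; rewrite ?expf_neq0// gt_eqF// ltr_wpDl// mulr_ge0// sqr_ge0.
rewrite ltr_pdivrMr; first by rewrite mulrDr mulr1 ltrDl.
by rewrite ltr_wpDl// mulr_ge0// sqr_ge0.
Qed.

End Rectangle.

Lemma integrable_continuous_itv (a b : R) (g : R -> R) : continuous g ->
  mu.-integrable `[a, b] (EFin \o g).
Proof.
move=> cg; apply: continuous_compact_integrable; first exact: segment_compact.
exact: continuous_subspaceT.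
Qed.

(** The left side is the restriction to w = i th of an entire function of w, so the real kernel can
    be carried along under Goursat's lemma. *)
Lemma cos_cexp (th : R) :
  (2 + cexp (0 +i* th) + cexp (- (0 +i* th))) / 4 = ((1 + cos th) / 2)%:C :> C.
Proof.
have -> : 2 + cexp (0 +i* th) + cexp (- (0 +i* th)) = (2 * (1 + cos th))%:C :> C.
  by apply: eqcP; rewrite !(cReD, cImD, Re_cexp, Im_cexp) /= oppr0 expR0 ?cosN ?sinN; ring.
have -> : 4 = (4 : R)%:C :> C by rewrite rmorph_nat.
by rewrite -fmorphV -rmorphM; congr (_ %:C); field.
Qed.

Definition ccos_kernel (th : R) := (1 + cos th) / 2.

Lemma continuous_ccos_kernelX n : continuous (fun th => ccos_kernel th ^+ n).
Proof.
move=> x; apply: (@continuous_comp _ _ _ ccos_kernel (fun y => y ^+ n)); last exact: exprn_continuous.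
by apply: cvgMl; apply: cvgD; [exact: cvg_cst|exact: continuous_cos].
Qed.

(* Test functions [((1 + cos th) / 2) ^ n] concentrate at [th = 0]. *)
Lemma vanishing_moments_eq0 (c : R -> R) : continuous c ->
  (forall n, \int[mu]_(x in `[- pi, pi]) (c x * ccos_kernel x ^+ n) = 0) ->
  c 0 <= 0.
Proof.
move=> cc hc; rewrite leNgt; apply/negP => c0.
have pi0 := @pi_gt0 R.
have pipi : - pi <= pi :> R by rewrite ge0_cp// ltW.
have k01 x : 0 <= ccos_kernel x <= 1.
  rewrite /ccos_kernel; have := @cos_geN1 R x; have := @cos_le1 R x => h1 h2.
  by apply/andP; split; lra.
have k0 : ccos_kernel 0 = 1 by rewrite /ccos_kernel cos0; field.
have [dl dl0 hdl] : exists2 d : R, 0 < d <= pi & forall x, `|x| < d -> c 0 / 2 <= c x.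
  have /cvgrPdist_le/(_ (c 0 / 2)) := cc 0.
  rewrite divr_gt0// => /(_ isT)/nbhs_ballP[d /= d0 hd].
  exists (Num.min d pi); first by rewrite lt_min d0 pi0 ge_min lexx orbT.
  move=> x; rewrite lt_min => /andP[xd _]; have := hd x.
  rewrite /ball /= sub0r normrN => /(_ xd); rewrite ler_norml => /andP[_ h]; lra.
have [M hM] : exists M, forall x, - pi <= x <= pi -> - M <= c x.
  have [x _ hx] := @EVT_min R c (- pi) pi pipi (continuous_subspaceT cc).
  by exists (- c x) => y hy; rewrite opprK; apply: hx; rewrite in_itv.
have [d0 dpi] := andP dl0.
pose ka := (1 - cos dl) / 2.
have ka0 : 0 < ka.
  rewrite divr_gt0// subr_gt0 -[ltRHS]cos0.
  by rewrite ltr_cos// in_itv /= ?lexx ltW.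
(* [A] is such that the minorant c 0 / 2 - A (1 - kernel) drops to -M' or below once |x| >= dl,
   where 1 - kernel >= ka. *)
pose M' := Num.max M 0; pose A := (M' + c 0 / 2) / ka.
have M'0 : 0 <= M' by rewrite le_max lexx orbT.
have A0 : 0 < A by rewrite divr_gt0// ltr_wpDl// divr_gt0.
have cA x : - pi <= x <= pi -> c 0 / 2 - A * (1 - ccos_kernel x) <= c x.
  move=> hx; have /andP[kx0 kx1] := k01 x.
  have [xd|xd] := ltP `|x| dl.
    by apply: le_trans (hdl x xd); rewrite gerBl mulr_ge0 ?subr_ge0 ?(ltW A0).
  have kk : ka <= 1 - ccos_kernel x.
    rewrite /ka /ccos_kernel.
    suff : cos x <= cos dl by move=> h; lra.
    have xpi : `|x| <= pi by rewrite ler_norml.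
    have -> : cos x = cos `|x| by case: (ger0P x) => //; rewrite cosN.
    by rewrite leNgt ltr_cos -?leNgt// in_itv /= ?normr_ge0 ?(ltW d0).
  apply: (@le_trans _ _ (- M')); last first.
    apply: le_trans (hM x hx); rewrite lerN2 le_max lexx//.
  rewrite lerBlDr -lerBlDl opprK addrC.
  apply: (@le_trans _ _ (A * ka)); last by rewrite ler_wpM2l// ltW.
  by rewrite /A mulfVK ?gt_eqF.
pose K n := \int[mu]_(x in `[- pi, pi]) (ccos_kernel x ^+ n).
have ik n := integrable_continuous_itv (- pi) pi (@continuous_ccos_kernelX n).
have K0 n : 0 <= K n.
  by apply: Rintegral_ge0 => x _; rewrite exprn_ge0//; have /andP[] := k01 x.
have ick n : mu.-integrable `[- pi, pi] (EFin \o (fun x => c x * ccos_kernel x ^+ n)).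
  apply: integrable_continuous_itv => x; apply: cvgM; first exact: cc.
  exact: continuous_ccos_kernelX.
have iZ n (a : R) : mu.-integrable `[- pi, pi] (EFin \o (fun x => a * ccos_kernel x ^+ n)).
  by apply: integrableZl_EFin.
(* The minorant is integrated against the n-th power of the kernel, whose moment with c vanishes.
   Hence the masses [K n] decay at ratio q = 1 - c 0 / (2 A) < 1. *)
have rec n : (c 0 / 2 - A) * K n + A * K n.+1 <= 0.
  rewrite -[leRHS](hc n) /K -!RintegralZl// -RintegralD//.
  apply: le_Rintegral => //; first exact: integrableD_EFin.
  move=> x /=; rewrite in_itv /= => hx.
  rewrite exprS; have := cA x hx.
  have : 0 <= ccos_kernel x ^+ n by rewrite exprn_ge0//; have /andP[] := k01 x.
  move: (ccos_kernel x ^+ n) => t t0 h.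
  have := ler_wpM2r t0 h; lra.
pose q := 1 - c 0 / 2 / A.
have recq n : K n.+1 <= q * K n.
  rewrite -(ler_pM2l A0) mulrA.
  have -> : A * q = A - c 0 / 2 by rewrite /q; field; rewrite gt_eqF.
  have := rec n; lra.
have q1 : q < 1 by rewrite /q gtrBl// divr_gt0// divr_gt0.
pose q0 := Num.max q 0.
have q00 : 0 <= q0 by rewrite le_max lexx orbT.
have q01 : q0 < 1 by rewrite gt_max q1 ltr01.
have Kle n : K n <= q0 ^+ n * K 0%N.
  elim: n => [|n IH]; first by rewrite expr0 mul1r.
  apply: le_trans (recq n) _; apply: (@le_trans _ _ (q0 * K n)).
    by rewrite ler_wpM2r// le_max lexx.
  by rewrite exprS -mulrA ler_wpM2l.
(* Near 0 the kernel is at least p > q0, so K n >= 2 dd p^n, which contradicts K n <= q0^n K 0 for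
   large n. *)
have [p [p0 q0p p1]] : exists p, [/\ 0 < p, q0 < p & p < 1].
  by exists ((1 + q0) / 2); split; lra.
have [dd dd0 hdd] : exists2 d : R, 0 < d <= pi &
    forall x, - d <= x <= d -> p <= ccos_kernel x.
  have h : {for 0, continuous ccos_kernel} := @continuous_ccos_kernelX 1 0.
  have {h} /cvgrPdist_le/(_ (1 - p)) := h.
  rewrite subr_gt0 p1 => /(_ isT)/nbhs_ballP[d /= dp hd].
  exists (Num.min (d / 2) pi); first by rewrite lt_min divr_gt0// pi0 ge_min lexx orbT.
  move=> x /andP[x1 x2]; have := hd x.
  rewrite /ball /= sub0r normrN k0.
  have -> : `|x| < d.
    apply: (@le_lt_trans _ _ (d / 2)); last by rewrite ltr_pdivrMr//; lra.
    rewrite ler_norml; apply/andP; split.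
      by apply: le_trans x1; rewrite lerN2 ge_min lexx.
    by apply: le_trans x2 _; rewrite ge_min lexx.
  by move=> /(_ isT); rewrite ler_norml => /andP[_ h]; lra.
have [ddp ddpi] := andP dd0.
have Kge n : p ^+ n * (2 * dd) <= K n.
  have dd2 : - dd <= dd by rewrite ge0_cp// ltW.
  rewrite /K (@Rintegral_split R _ (- dd))//; last 2 first.
  - by rewrite lerN2.
  - by apply: le_trans ddpi.
  rewrite (@Rintegral_split R (- dd) dd)//; last first.
    apply: integrable_continuous_itv; exact: continuous_ccos_kernelX.
  have h1 : 0 <= \int[mu]_(x in `[- pi, - dd]) (ccos_kernel x ^+ n).
    by apply: Rintegral_ge0 => x _; rewrite exprn_ge0//; have /andP[] := k01 x.
  have h2 : 0 <= \int[mu]_(x in `[dd, pi]) (ccos_kernel x ^+ n).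
    by apply: Rintegral_ge0 => x _; rewrite exprn_ge0//; have /andP[] := k01 x.
  have h3 : p ^+ n * (2 * dd) <= \int[mu]_(x in `[- dd, dd]) (ccos_kernel x ^+ n).
    have -> : 2 * dd = dd - - dd by ring.
    rewrite -Rintegral_cst_itv//; apply: le_Rintegral => //.
    - exact: integrable_cst_itv.
    - apply: integrable_continuous_itv; exact: continuous_ccos_kernelX.
    - move=> x /=; rewrite in_itv /= => hx; rewrite lerXn2r//.
      + by rewrite nnegrE ltW.
      + by rewrite nnegrE; have /andP[] := k01 x.
      + exact: hdd.
  by rewrite addrCA; apply: le_trans h3 _; rewrite lerDl addr_ge0.
have bnd n : 2 * dd <= (q0 / p) ^+ n * K 0%N.
  rewrite expr_div_n mulrAC ler_pdivlMr ?exprn_gt0// mulrC.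
  exact: le_trans (Kge n) (Kle n).
have : 2 * dd <= 0 * K 0%N.
  have cv : (q0 / p) ^+ n * K 0%N @[n --> \oo] --> 0 * K 0%N.
    apply: cvgMl; apply: cvg_expr.
    by rewrite ger0_norm ?divr_ge0// ?(ltW p0)// ltr_pdivrMr// mul1r.
  rewrite -(cvg_lim _ cv)//; apply: limr_ge; first by apply/cvg_ex; exists (0 * K 0%N).
  exact: nearW.
rewrite mul0r; apply/negP; rewrite -ltNge; lra.
Qed.

Lemma expipi (x : R) : cexp (x +i* pi) = cexp (x +i* - pi) :> C.
Proof.
by apply: eqcP; rewrite ?Re_cexp ?Im_cexp /= ?cosN ?sinN ?sinpi ?oppr0.
Qed.

(* On [Re w = 0] the integrand is [f (e ^ w)] times a real kernel concentrating at [w = 0];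
   it vanishes far to the left, and its integrals over [Im w = +- pi] cancel. *)
Lemma holomorphic_disc_zero (f : C -> C) (rho rho0 : R) : 1 < rho ->
  (forall z, normc z < rho -> differentiable f z) -> 0 < rho0 ->
  (forall z, normc z < rho0 -> f z = 0) -> f 1 = 0.
Proof.
move=> rho1 fd rho0_gt0 f0.
pose G n (w : C) : C := f (cexp w) * ((2 + cexp w + cexp (- w)) / 4) ^+ n.
have Gd n p : Re p < ln rho -> cdiff_at (G n) p.
  move=> hp; apply: differentiable_cdiff_at; apply: differentiableM.
    apply: (@differentiable_comp _ _ _ _ (@cexp R) f); first exact: differentiable_cexp.
    by apply: fd; rewrite normc_cexp -ltr_ln ?posrE ?expR_gt0 ?expRK// (lt_trans _ rho1).
  apply: (@differentiable_comp _ _ _ _ (fun w => (2 + cexp w + cexp (- w)) / 4) (fun y : C => y ^+ n)); last first.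
    by apply/derivable1_diffP; exact: exprn_derivable.
  apply: differentiableM; last exact: differentiable_cst.
  apply: differentiableD; first apply: differentiableD.
  - exact: differentiable_cst.
  - exact: differentiable_cexp.
  - apply: (@differentiable_comp _ _ _ _ (fun w : C => - w) (@cexp R)); last exact: differentiable_cexp.
    exact: differentiableN.
have lr : 0 < ln rho by rewrite ln_gt0.
(* At an abscissa at most ln rho0 - 1 the point e^w lies in the small disc where f vanishes; the
   minimum with 0 keeps this side to the left of Re w = 0. *)
pose a := Num.min 0 (ln rho0 - 1).
have a0 : a <= 0 by rewrite ge_min lexx.
have pipi : - pi <= pi :> R by rewrite ge0_cp// ltW// pi_gt0.
have V n : vside (G n) (- pi) pi 0 = 0.
  have := goursat (Gd n) a0 lr pipi; rewrite /boundary_integral.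
  have -> : hside (G n) a 0 (- pi) = hside (G n) a 0 pi.
    apply: eq_cintegral => x _; rewrite /G expipi.
    have -> : - (x +i* - pi) = - x +i* pi :> C by apply: eqcP; rewrite /= ?opprK.
    have -> : - (x +i* pi) = - x +i* - pi :> C by apply: eqcP.
    by rewrite expipi.
  move: (hside (G n) a 0 pi) => H; rewrite subrr add0r.
  have -> : vside (G n) (- pi) pi a = 0.
    rewrite /vside (@eq_cintegral _ _ (fun=> 0)) ?cintegral0// => y _.
    rewrite /G f0 ?mul0r// normc_cexp /=.
    have : a < ln rho0 by rewrite /a gt_min ltrBlDr ltrDl ltr01 orbT.
    by rewrite -ltr_expR lnK// posrE.
  rewrite subr0 => /eqP; rewrite mulf_eq0 => /orP[/eqP h|/eqP//].
  by have := @normc_i R; rewrite h normc0 => /eqP; rewrite eq_sym oner_eq0.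
have i0 (th : R) : normc (cexp (0 +i* th)) = 1 by rewrite normc_cexp /= expR0.
have cf (u : C) : continuous (fun th : R => Re (u * f (cexp (0 +i* th)))).
  move=> x.
  have h1 : {for x, continuous (fun th : R => Re (f (cexp (0 +i* th))))} /\
      {for x, continuous (fun th : R => Im (f (cexp (0 +i* th))))}.
    apply: (@cdiff_at_line (fun w => f (cexp w)) (fun th => 0 +i* th)); last first.
      by move=> y; exact: normc_vertical.
    apply: differentiable_cdiff_at.
    apply: (@differentiable_comp _ _ _ _ (@cexp R) f); first exact: differentiable_cexp.
    by apply: fd; rewrite i0.
  have -> : (fun th : R => Re (u * f (cexp (0 +i* th)))) = (fun th : R =>
      Re u * Re (f (cexp (0 +i* th))) -
      Im u * Im (f (cexp (0 +i* th)))).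
    by apply/funext => th; rewrite cReM.
  case: h1 => hr hi; apply: cvgB; apply: cvgMr; [exact: hr|exact: hi].
have mom (u : C) n :
    \int[mu]_(x in `[- pi, pi]) (Re (u * f (cexp (0 +i* x))) * ccos_kernel x ^+ n) = 0.
  have e : u * vside (G n) (- pi) pi 0 = 0 by rewrite V mulr0.
  have /(congr1 (@Re R)) := e.
  rewrite /vside -cintegralZ//; last by apply: (@vside_integrable (G n) (ln rho)) => //; exact: Gd.
  rewrite /cintegral /= => h0; rewrite -[RHS]h0; apply: eq_Rintegral => x _.
  rewrite /G cos_cexp -/(ccos_kernel x) -rmorphXn mulrA [in RHS]cReM /= mulr0 subr0//.
(* The rotation makes the tested real function take the value |f 1| at th = 0. *)
have [u nu hu] := exists_rotation (f 1).
have := vanishing_moments_eq0 (cf u) (mom u).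
have -> : 0 +i* 0 = 0 :> C by [].
rewrite cexp0 -hu /= => h.
by apply/eqP; rewrite -normc_eq0 eq_le normc_ge0 andbT.
Qed.

End Goursat.

Local Transparent cexp.

(** * Meromorphic functions of several variables *)

Lemma differentiable_idt (K : numFieldType) (U : normedModType K) (x : U) :
  differentiable (fun y : U => y) x.
Proof. by have [] := is_diff_id x. Qed.

Section IdentityTheorem.
Variables (R : realType).
Local Notation C := (complex (Real.sort R)).

(** The substitution w |-> p + w (z - p) moves p to 0 and z to 1, and the disc to one of radius rho
    / |z - p| > 1. *)
Lemma holomorphic_disc_eq0 (f : C -> C) (p : C) (rho : R) :
  (forall z : C, normc (z - p) < rho -> differentiable f z) ->
  (\forall z \near p, f z = 0) -> forall z : C, normc (z - p) < rho -> f z = 0.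
Proof.
move=> fd /nbhs_normcP[e e0 fe] z zr.
have [->|zp] := eqVneq z p; first by apply: fe; rewrite subrr normc0.
have d0 : 0 < normc (z - p) by rewrite normc_gt0 subr_eq0.
pose f1 (w : C) : C := f (p + w * (z - p)).
have -> : f z = f1 1 by rewrite /f1 mul1r addrC subrK.
apply: (@holomorphic_disc_zero R f1 (rho / normc (z - p)) (e / normc (z - p))).
- by rewrite ltr_pdivlMr// mul1r.
- move=> w; rewrite (ltr_pdivlMr _ _ d0) -normcM => hw.
  apply: (@differentiable_comp _ _ _ _ (fun w : C => p + w * (z - p)) f).
    apply: differentiableD; first exact: differentiable_cst.
    by apply: differentiableM; [exact: differentiable_idt|exact: differentiable_cst].
  by apply: fd; rewrite addrAC subrr add0r.
- by rewrite divr_gt0.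
- by move=> w; rewrite (ltr_pdivlMr _ _ d0) -normcM => hw; apply: fe; rewrite addrAC subrr add0r.
Qed.

Variable r : nat.
Local Notation V := 'rV[C]_r.
Implicit Types (u v w : V) (f g h F : V -> C).

(** The norm of a row vector over [C] is an element of [C]; its real part is the same norm as a real
    number. *)
Definition vnorm v : R := Re `|v|.

Lemma vnormE v : `|v| = (vnorm v)%:C.
Proof.
rewrite /vnorm; have : 0 <= `|v| by exact: normr_ge0.
by case: `|v| => a b; rewrite lecE /= => /andP[/eqP -> _].
Qed.

Lemma vnorm_ge0 v : 0 <= vnorm v.
Proof. by rewrite -lecR -vnormE; exact: normr_ge0. Qed.

Lemma ler_vnormD u v : vnorm (u + v) <= vnorm u + vnorm v.
Proof. by rewrite -lecR rmorphD /= -!vnormE; exact: ler_normD. Qed.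

Lemma vnormZ (a : C) v : vnorm (a *: v) = normc a * vnorm v.
Proof. by apply: (@complexI R); rewrite rmorphM /= -!vnormE normrZ normrcE. Qed.

Lemma nbhs_vnormP (p : V) (P : V -> Prop) :
  (\forall z \near p, P z) <->
  (exists2 e : R, 0 < e & forall z : V, vnorm (z - p) < e -> P z).
Proof.
split.
  move=> /nbhs_ballP [[e e'] /=]; rewrite ltcE /= => /andP[/eqP -> e0] h.
  exists e => // z hz; apply: h; rewrite -ball_normE.
  by rewrite -ltcR -vnormE distrC in hz; exact: hz.
move=> [e e0 h]; apply/nbhs_ballP; exists e%:C => /=; first by rewrite ltcR.
move=> z; rewrite -ball_normE => hz; apply: h.
by rewrite -ltcR -vnormE distrC; exact: hz.
Qed.

Lemma differentiable_line w v (l : C) : differentiable (fun l : C => w + l *: v) l.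
Proof.
apply: differentiableD; first exact: differentiable_cst.
by apply: differentiableZl; exact: differentiable_idt.
Qed.

Lemma identity_ball g (p : V) (e : R) :
  (forall z : V, vnorm (z - p) < e -> differentiable g z) ->
  forall w : V, vnorm (w - p) < e -> (\forall z \near w, g z = 0) ->
  forall z : V, vnorm (z - p) < e -> g z = 0.
Proof.
move=> gd w we gw z ze.
pose u (l : C) : V := w + l *: (z - w).
have ud l : differentiable u l by exact: differentiable_line.
pose m := Num.max (vnorm (w - p)) (vnorm (z - p)).
have me : m < e by rewrite gt_max we ze.
(* By convexity the segment stays within m of p, and a shift of the parameter by less than rho uses
   less than the margin e - m; the + 1 avoids a zero denominator. *)
pose rho := (e - m) / (vnorm (z - w) + 1).
have n1 : 0 < vnorm (z - w) + 1 by rewrite ltr_wpDl// vnorm_ge0.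
have rho0 : 0 < rho by rewrite divr_gt0// subr_gt0.
have ue (t : R) (l : C) : 0 <= t <= 1 -> normc (l - t%:C) < rho -> vnorm (u l - p) < e.
  move=> /andP[t0 t1] hl.
  have -> : u l - p = (1 - t)%:C *: (w - p) + t%:C *: (z - p) + (l - t%:C) *: (z - w).
    by apply/rowP => i; rewrite !mxE rmorphB rmorph1; ring.
  apply: le_lt_trans (ler_vnormD _ _) _.
  have h1 : vnorm ((1 - t)%:C *: (w - p) + t%:C *: (z - p)) <= m.
    apply: le_trans (ler_vnormD _ _) _; rewrite !vnormZ !normc_real.
    rewrite !ger0_norm ?subr_ge0//.
    have -> : m = (1 - t) * m + t * m by ring.
    by apply: lerD; rewrite ler_wpM2l ?subr_ge0// le_max lexx ?orbT.
  rewrite vnormZ; apply: (@le_lt_trans _ _ (m + normc (l - t%:C) * (vnorm (z - w) + 1))).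
    by rewrite lerD// ler_wpM2l ?normc_ge0// lerDl.
  by rewrite -ltrBrDl -ltr_pdivlMr.
have gud (t : R) (l : C) : 0 <= t <= 1 -> normc (l - t%:C) < rho ->
    differentiable (fun l => g (u l)) l.
  move=> ht hl; apply: (@differentiable_comp _ _ _ _ u g); first exact: ud.
  by apply: gd; exact: ue ht hl.
pose N := (Num.truncn rho^-1).+1.
have Nrho : N%:R^-1 < rho.
  by rewrite invf_plt ?posrE ?ltr0n//; exact: truncnS_gt.
have N0 : 0 < N%:R :> R by rewrite ltr0n.
(* Vanishing near n/N extends to the disc of radius rho about n/N, which is a neighbourhood of
   (n+1)/N because 1/N < rho. *)
have key n : (n <= N)%N -> \forall l \near ((n%:R / N%:R)%:C : C), g (u l) = 0.
  elim: n => [_|n IH nN].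
    rewrite mul0r.
    have cu : {for (0 : C), continuous u} := differentiable_continuous (ud 0).
    have gu : nbhs (u 0) [set z | g z = 0] by rewrite /u scale0r addr0.
    exact: cu _ gu.
  have t01 : 0 <= (n%:R / N%:R : R) <= 1.
    by rewrite divr_ge0 ?ler0n//= ler_pdivrMr// mul1r ler_nat ltnW.
  have z0 := holomorphic_disc_eq0 (fun l hl => gud _ l t01 hl) (IH (ltnW nN)).
  have dd : normc ((n.+1%:R / N%:R)%:C - (n%:R / N%:R)%:C : C) = N%:R^-1.
    rewrite -rmorphB normc_real -mulrBl -natrB// subSnn mul1r.
    by rewrite ger0_norm// invr_ge0.
  apply/nbhs_normcP; exists (rho - N%:R^-1); first by rewrite subr_gt0.
  move=> l hl; apply: z0.
  have -> : l - (n%:R / N%:R)%:C = (l - (n.+1%:R / N%:R)%:C) +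
     ((n.+1%:R / N%:R)%:C - (n%:R / N%:R)%:C) by rewrite addrA subrK.
  by apply: le_lt_trans (ler_normcD _ _) _; rewrite dd -ltrBrDr.
have /nbhs_singleton := key N (leqnn N).
by rewrite divff ?gt_eqF// /u scale1r addrC subrK.
Qed.

Lemma meromorphic_entire f : entire f -> meromorphic f.
Proof.
move=> fe p; exists setT, f, (fun=> 1); split.
- exact: openT.
- by [].
- by move=> z _; split; [exact: fe|exact: differentiable_cst].
- by move=> z _; apply: subset_closure; exact: oner_neq0.
- by move=> z _ _; rewrite divr1.
Qed.

Lemma neq0_near h (y : V) : differentiable h y -> h y != 0 -> \forall z \near y, h z != 0.
Proof.
move=> /differentiable_continuous hc h0.
have : \forall t \near h y, t != 0.
  apply/nbhs_normcP; exists (normc (h y)); first by rewrite normc_gt0.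
  move=> t; apply: contraTneq => ->.
  by rewrite sub0r normc_opp ltxx.
exact: hc.
Qed.

(** The common denominator h1 h2 is nonzero on a dense set: h1 is nonzero at some point of any given
    open set, hence around it, and there h2 is nonzero somewhere. *)
Lemma meromorphicD f g : meromorphic f -> meromorphic g ->
  meromorphic (fun z => f z + g z).
Proof.
move=> fm gm p.
have [V1 [g1 [h1 [oV1 V1p d1 c1 e1]]]] := fm p.
have [V2 [g2 [h2 [oV2 V2p d2 c2 e2]]]] := gm p.
exists (V1 `&` V2), (fun z => g1 z * h2 z + g2 z * h1 z), (fun z => h1 z * h2 z); split.
- exact: openI.
- by [].
- move=> z [z1 z2]; have [dg1 dh1] := d1 z z1; have [dg2 dh2] := d2 z z2.
  by split; [apply: differentiableD; exact: differentiableM|exact: differentiableM].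
- move=> z [z1 z2] B Bz.
  have VB : nbhs z ((V1 `&` V2) `&` B).
    by apply: filterI => //; apply: open_nbhs_nbhs; split => //; exact: openI.
  move/nbhs_interior : VB => VBi.
  have [y' [/= hy1' yi]] := c1 z z1 _ VBi.
  have [[y'1 y'2] y'B] := interior_subset yi.
  have nb : nbhs y' ((V1 `&` V2) `&` B `&` [set t | h1 t != 0]).
    by apply: filterI => //; apply: neq0_near => //; have [] := d1 y' y'1.
  have [t [/= ht [[[t1 t2] tB] ht1]]] := c2 y' y'2 _ nb.
  by exists t; split => //=; rewrite mulf_neq0.
- move=> z [z1 z2]; rewrite mulf_eq0 negb_or => /andP[hz1 hz2].
  by rewrite e1// e2//; field; rewrite hz1 hz2.
Qed.

Lemma meromorphicMl k f : entire k -> meromorphic f -> meromorphic (fun z => k z * f z).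
Proof.
move=> ke fm p; have [V1 [g1 [h1 [oV1 V1p d1 c1 e1]]]] := fm p.
exists V1, (fun z => k z * g1 z), h1; split; [by []|by []| |by []|].
- by move=> z /d1 [dg dh]; split; [apply: differentiableM; [exact: ke|exact: dg]|exact: dh].
- by move=> z z1 hz; rewrite e1// mulrA.
Qed.

Lemma meromorphic_sum (I : Type) (s : seq I) (F : I -> V -> C) :
  (forall i, meromorphic (F i)) -> meromorphic (fun z => \sum_(i <- s) F i z).
Proof.
move=> h; elim: s => [|i s IH].
  under eq_fun do rewrite big_nil.
  by apply: meromorphic_entire => z; exact: differentiable_cst.
by under eq_fun do rewrite big_cons; exact: meromorphicD.
Qed.

Lemma meromorphic_shift f v : meromorphic f -> meromorphic (fun z => f (z + v)).
Proof.
move=> fm p; have [V1 [g1 [h1 [oV1 V1p d1 c1 e1]]]] := fm (p + v).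
have dv (x : V) w : differentiable (fun z : V => z + w) x.
  by apply: differentiableD; [exact: differentiable_idt|exact: differentiable_cst].
have cv (x : V) w : {for x, continuous (fun z : V => z + w)}.
  exact: differentiable_continuous.
exists ((fun z => z + v) @^-1` V1), (fun z => g1 (z + v)), (fun z => h1 (z + v)); split => //.
- by apply: open_comp => // x _; exact: cv.
- move=> z /= /d1 [dg dh]; split.
    exact: (differentiable_comp (dv z v) dg).
  exact: (differentiable_comp (dv z v) dh).
- move=> z /= z1 B Bz.
  have nb : nbhs (z + v) [set y | B (y - v)].
    have := @cv (z + v) (- v) B; rewrite /= addrK; apply; exact: Bz.
  have [y [/= hy By]] := c1 _ z1 _ nb.
  by exists (y - v); split => //=; rewrite subrK.
- by move=> z /= z1 hz; rewrite e1.
Qed.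

(** The closure A of the interior of the zero set is shown to be open; taking the closure absorbs
    the polar sets, where F has arbitrary values. Connectedness of the real segment from s0 to s1
    puts s1 in A, and continuity at s1 concludes. *)
Lemma meromorphic_identity F (s0 s1 : V) : meromorphic F ->
  (\forall z \near s0, F z = 0) -> {for s1, continuous F} -> F s1 = 0.
Proof.
move=> Fm F0 Fc.
pose O := [set s : V | \forall z \near s, F z = 0].
pose A := closure O.
have Aopen : open A.
  rewrite openE => p Ap.
  have [V1 [g [h [oV1 V1p d c e]]]] := Fm p.
  have [eps eps0 hV] : exists2 e : R, 0 < e & forall z : V, vnorm (z - p) < e -> V1 z.
    by apply/nbhs_vnormP; apply: open_nbhs_nbhs.
  apply/nbhs_vnormP; exists eps; first exact: eps0.
  have [w [Ow we]] : exists w : V, O w /\ vnorm (w - p) < eps.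
    have nb : nbhs p [set z : V | vnorm (z - p) < eps].
      by apply/nbhs_vnormP; exists eps.
    by have [w [Ow we]] := Ap _ nb; exists w.
  (* F = 0 gives g = 0 only off the zeros of h; as these have dense complement and g is continuous,
     g vanishes on a full neighbourhood. *)
  have gw : \forall z \near w, g z = 0.
    have Fg (z : V) : V1 z -> F z = 0 -> h z != 0 -> g z = 0.
      move=> Vz Fz hz; have := e z Vz hz; rewrite Fz => /esym/eqP.
      by rewrite mulf_eq0 invr_eq0 (negbTE hz) orbF => /eqP.
    have nw : \forall z \near w, V1 z by apply: open_nbhs_nbhs; split => //; exact: hV.
    have nn : \forall z \near w, V1 z /\ F z = 0 by apply: filterI.
    move/nbhs_interior : nn; apply: filterS => z zi.
    have [V1z _] := interior_subset zi.
    apply: contrapT => /eqP gz.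
    have [dg dh] := d z V1z.
    have [t [/= ht [[V1t Ft] gt]]] := c z V1z _ (filterI zi (neq0_near dg gz)).
    by move: gt; rewrite (Fg t) ?eqxx.
  have g0 := identity_ball (fun z hz => (d z (hV z hz)).1) we gw.
  move=> z ze B Bz.
  have V1z := hV z ze.
  have nb : nbhs z ([set z : V | vnorm (z - p) < eps] `&` B).
    apply: filterI => //; apply/nbhs_vnormP; exists (eps - vnorm (z - p)).
      by rewrite subr_gt0.
    move=> y hy; rewrite /= -(subrK z y) -addrA.
    by apply: le_lt_trans (ler_vnormD _ _) _; rewrite -ltrBrDr.
  move/nbhs_interior : nb => nb.
  (* Around a nearby point t with h t != 0 one has F = g / h = 0, so t belongs to O. *)
  have [t [/= ht ti]] := c z V1z _ nb.
  have [te tB] := interior_subset ti.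
  exists t; split; last exact: tB.
  have [_ dht] := d t (hV t te).
  have : \forall y \near t, vnorm (y - p) < eps /\ h y != 0.
    apply: filterI; last exact: (neq0_near dht ht).
    by apply: filterS ti => y [ye _]; exact: ye.
  apply: filterS => y [ye hy].
  by rewrite (e y (hV y ye) hy) (g0 y ye) mul0r.
have A0 : A s0 by exact: subset_closure.
pose u (t : R) : V := s0 + t%:C *: (s1 - s0).
have cu : continuous u.
  move=> t.
  have cl := differentiable_continuous (differentiable_line s0 (s1 - s0) t%:C).
  have cr : (x%:C : C) @[x --> t] --> t%:C.
    apply/cvgcP => e e0; near=> x.
    rewrite -rmorphB normc_real.
    by near: x; apply: cvgr_distC_lt.
  exact: (@continuous_comp _ _ _ (fun x : R => x%:C) (fun l : C => s0 + l *: (s1 - s0)) t).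
have TT : u @^-1` A = setT.
  have cT : connected [set: R] by apply/connected_intervalP => x y _ _ z _.
  apply: cT.
  - by exists 0; rewrite /= /u scale0r addr0.
  - exists (u @^-1` A); last by rewrite setTI.
    by apply: open_comp Aopen => x _; exact: cu.
  - exists (u @^-1` A); last by rewrite setTI.
    by apply: closed_comp (@closed_closure _ O) => x _; exact: cu.
have A1 : A s1.
  have : (u @^-1` A) 1 by rewrite TT.
  by rewrite /= /u scale1r addrC subrK.
apply: contrapT => /eqP F1.
have nn : \forall z \near s1, F z != 0.
  have : \forall t \near F s1, t != 0.
    apply/nbhs_normcP; exists (normc (F s1)); first by rewrite normc_gt0.
    move=> t; apply: contraTneq => ->.
    by rewrite sub0r normc_opp ltxx.
  exact: Fc.
have [t [/= Ot Ft]] := A1 _ nn.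
by move: Ft; rewrite (nbhs_singleton Ot) eqxx.
Unshelve. all: by end_near. Qed.

Lemma entire_coord (j : 'I_r) : entire (fun z : V => z 0 j).
Proof. by move=> z; exact: differentiable_coord. Qed.

Lemma entire_prod (I : Type) (s : seq I) (F : I -> V -> C) :
  (forall i, entire (F i)) -> entire (fun z => \prod_(i <- s) F i z).
Proof.
move=> h; elim: s => [|i s IH].
  under eq_fun do rewrite big_nil.
  by move=> z; exact: differentiable_cst.
by under eq_fun do rewrite big_cons; move=> z; apply: differentiableM; [exact: h|exact: IH].
Qed.

Lemma entire_rising (j : 'I_r) n : entire (fun z : V => rising (z 0 j) n).
Proof.
apply: entire_prod => i z; apply: differentiableD; last exact: differentiable_cst.
exact: entire_coord.
Qed.

End IdentityTheorem.

(** * Iterated contour integrals *)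

Section IteratedContour.
Variable R : realType.
Local Notation C := (complex (Real.sort R)).
Local Notation mu := (@lebesgue_measure R).

(* Row vectors carry no sigma-algebra here: measurability in the coordinates is tested by
   composition with all measurable families of arguments. *)
Definition jmeasurable d (T : measurableType d) n (f : T -> 'rV[C]_n -> C) :=
  forall d' (T' : measurableType d') (p : T' -> T) (g : T' -> 'rV[C]_n),
    measurable_fun setT p -> (forall k, cmeasurable setT (fun t => g t 0 k)) ->
    cmeasurable setT (fun t => f (p t) (g t)).

Definition vmeasurable n (f : 'rV[C]_n -> C) :=
  forall d (T : measurableType d) (g : T -> 'rV[C]_n),
    (forall k, cmeasurable setT (fun t => g t 0 k)) ->
    cmeasurable setT (fun t => f (g t)).

Lemma vjmeasurable n (f : 'rV[C]_n -> C) d (T : measurableType d) :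
  vmeasurable f -> jmeasurable (fun _ : T => f).
Proof. by move=> h d' T' p g _ mg; exact: h. Qed.

Lemma row_mx_lshift0 n (w0 : C) (w : 'rV[C]_n) : row_mx w0%:M w 0 (lshift n 0) = w0.
Proof. by rewrite row_mxEl mxE eqxx mulr1n. Qed.

Lemma cmeasurable_row_mx d (T : measurableType d) n (w0 : T -> C) (g : T -> 'rV[C]_n) :
  cmeasurable setT w0 -> (forall k, cmeasurable setT (fun t => g t 0 k)) ->
  forall k, cmeasurable setT (fun t => row_mx (w0 t)%:M (g t) 0 k).
Proof.
move=> m0 mg k; case: (split_ordP k) => j ->.
  by rewrite (ord1 j); under eq_fun do rewrite row_mx_lshift0.
by under eq_fun do rewrite row_mxEr.
Qed.

Lemma jmeasurable_row_mx d (T : measurableType d) n (f : T -> 'rV[C]_n.+1 -> C)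
    d1 (T1 : measurableType d1) (q : T1 -> T) (w0 : T1 -> C) :
  jmeasurable f -> measurable_fun setT q -> cmeasurable setT w0 ->
  @jmeasurable _ T1 n (fun t w => f (q t) (row_mx (w0 t)%:M w)).
Proof.
move=> jf mq mw0 d' T' p g mp mg.
apply: (jf _ _ (q \o p) (fun t => row_mx (w0 (p t))%:M (g t))).
  exact: measurableT_comp.
by apply: cmeasurable_row_mx => //; exact: cmeasurable_comp mp mw0.
Qed.

(* A contour integral is handled through the functional [I] it defines. *)
Fixpoint iterI (I : (C -> C) -> C) n : ('rV[C]_n -> C) -> C :=
  match n with
  | 0 => fun f => f 0
  | n'.+1 => fun f => I (fun w0 => iterI I (fun w : 'rV_n' => f (row_mx w0%:M w)))
  end.

Lemma hankel_iterE (e : R) n (f : 'rV[C]_n -> C) : hankel_iter e f = iterI (hankel e) f.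
Proof.
elim: n f => [//|n IH] f /=; congr (hankel e _); apply/funext => w0; exact: IH.
Qed.

(** Joint measurability survives one integration; this lets an inner iterated integral serve as
    integrand of the next one. *)
Definition measurable_functional (I : (C -> C) -> C) :=
  forall d (T : measurableType d) (f : T -> C -> C),
    (forall d' (T' : measurableType d') (p : T' -> T) (g : T' -> C),
      measurable_fun setT p -> cmeasurable setT g ->
      cmeasurable setT (fun t => f (p t) (g t))) ->
    cmeasurable setT (fun t => I (f t)).

Lemma cmeasurable_iterI I : measurable_functional I ->
  forall n d (T : measurableType d) (f : T -> 'rV[C]_n -> C),
  jmeasurable f -> cmeasurable setT (fun t => iterI I (f t)).
Proof.
move=> hI; elim=> [|n IH] d T f jf /=.
  apply: (jf _ _ id (fun=> 0)); first exact: measurable_id.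
  by move=> k; exact: cmeasurable_cst.
apply: (hI _ _ (fun t w0 => iterI I (fun w : 'rV_n => f t (row_mx w0%:M w)))).
move=> d' T' p g mp mg.
apply: (IH _ _ (fun t w => f (p t) (row_mx (g t)%:M w))).
exact: jmeasurable_row_mx.
Qed.

Definition fmeasurable (phi : C -> C) :=
  forall d (T : measurableType d) (g : T -> C),
    cmeasurable setT g -> cmeasurable setT (fun t => phi (g t)).

Lemma fmeasurable_iterI I : measurable_functional I ->
  forall n (f : 'rV[C]_n.+1 -> C), vmeasurable f ->
  fmeasurable (fun w0 => iterI I (fun w : 'rV_n => f (row_mx w0%:M w))).
Proof.
move=> hI n f mf d T g mg.
apply: (cmeasurable_iterI hI (f := fun t w => f (row_mx (g t)%:M w))).
apply: (@jmeasurable_row_mx _ T n (fun=> f) _ T id) => //.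
exact: vjmeasurable.
Qed.

Lemma vmeasurable_row_mx n (f : 'rV[C]_n.+1 -> C) (w0 : C) : vmeasurable f ->
  vmeasurable (fun w : 'rV[C]_n => f (row_mx w0%:M w)).
Proof.
move=> mf d T g mg; apply: mf; apply: cmeasurable_row_mx => //.
Qed.

(** In the variable t = e^w this is the dominating function e^{-dl |t|}, integrable against |dt|. *)
Definition weight (dl : R) (w : C) := expR (- (dl * normc (cexp w))).

Lemma weight_ge0 dl w : 0 <= weight dl w.
Proof. exact: expR_ge0. Qed.

Definition bounded_functional (dl H : R) (S : set C) (I : (C -> C) -> C) :=
  forall (phi : C -> C) B, fmeasurable phi ->
    (forall w, S w -> normc (phi w) <= B * weight dl w) -> normc (I phi) <= B * H.

Definition on_contour (S : set C) n (w : 'rV[C]_n) := forall k, S (w 0 k).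

Lemma on_contour_row_mx S n w0 (w : 'rV[C]_n) : S w0 -> on_contour S w ->
  @on_contour S n.+1 (row_mx w0%:M w).
Proof.
move=> S0 Sw; rewrite -[n.+1]/(1 + n)%N => k; case: (split_ordP k) => j ->.
  by rewrite (ord1 j) row_mx_lshift0.
by rewrite row_mxEr.
Qed.

Lemma prod_row_mx n (F : C -> R) w0 (w : 'rV[C]_n) :
  \prod_(k < n.+1) F (row_mx w0%:M w 0 k) = F w0 * \prod_(k < n) F (w 0 k).
Proof.
rewrite -[n.+1]/(1 + n)%N big_split_ord big_ord1 row_mx_lshift0; congr (_ * _).
by apply: eq_bigr => k _; rewrite row_mxEr.
Qed.

Lemma iterI_bound dl H S I : measurable_functional I -> bounded_functional dl H S I ->
  forall n (f : 'rV[C]_n -> C) B, vmeasurable f ->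
  (forall w, on_contour S w -> normc (f w) <= B * \prod_k weight dl (w 0 k)) ->
  normc (iterI I f) <= B * H ^+ n.
Proof.
move=> mI bI; elim=> [|n IH] f B mf bf /=.
  have := bf 0; rewrite big_ord0 mulr1 => h; apply: h => -[].
  by [].
rewrite exprSr mulrA; apply: bI; first exact: fmeasurable_iterI.
move=> w0 S0; rewrite mulrAC; apply: IH; first exact: vmeasurable_row_mx.
move=> w Sw; rewrite -mulrA -prod_row_mx; apply: bf.
exact: on_contour_row_mx.
Qed.

(** Dominated convergence in which the contour itself moves with m and degenerates to a limit
    functional [J]. *)
Definition converging_functionals (dl : R) (S : nat -> set C) (I : nat -> (C -> C) -> C)
    (L : set C) (J : (C -> C) -> C) :=
  forall (phi : nat -> C -> C) (psi : C -> C) (B : R),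
    (forall m, fmeasurable (phi m)) ->
    (\forall m \near \oo, forall w, S m w -> normc (phi m w) <= B * weight dl w) ->
    (forall w, L w -> phi m w @[m --> \oo] --> psi w) ->
    I m (phi m) @[m --> \oo] --> J psi.

(** Induction on the number of variables: for the outermost integral, the inner iterated integrals
    are dominated by [iterI_bound] and converge pointwise by the induction hypothesis. *)
Lemma iterI_cvg dl H S I L J :
  (forall m, measurable_functional (I m)) ->
  (forall m, bounded_functional dl H (S m) (I m)) ->
  (forall w, L w -> \forall m \near \oo, S m w) ->
  converging_functionals dl S I L J ->
  forall n (f : nat -> 'rV[C]_n -> C) (g : 'rV[C]_n -> C) B,
  (forall m, vmeasurable (f m)) ->
  (\forall m \near \oo, forall w, on_contour (S m) w ->
     normc (f m w) <= B * \prod_k weight dl (w 0 k)) ->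
  (forall w, on_contour L w -> f m w @[m --> \oo] --> g w) ->
  iterI (I m) (f m) @[m --> \oo] --> iterI J g.
Proof.
move=> mI bI LS cI; elim=> [|n IH] f g B mf bf cf /=.
  by apply: cf => -[].
apply: (cI _ _ (B * H ^+ n)).
- by move=> m; apply: fmeasurable_iterI.
- move: bf; apply: filterS => m bf w0 S0; rewrite mulrAC.
  apply: (iterI_bound (mI m) (bI m)); first exact: vmeasurable_row_mx.
  move=> w Sw; rewrite -mulrA -prod_row_mx; apply: bf.
  exact: on_contour_row_mx.
- move=> w0 L0; apply: (IH _ _ (B * weight dl w0)).
  + by move=> m; exact: vmeasurable_row_mx.
  + move: (LS w0 L0) bf; apply: filterS2 => m S0 bf w Sw.
    rewrite -mulrA -prod_row_mx; apply: bf.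
    exact: on_contour_row_mx.
  + move=> w Lw; apply: cf; exact: on_contour_row_mx.
Qed.

(* The two sides of the cut, with logarithms [ln x] and [ln x + 2 pi i]. *)
Definition cut_lines : set C :=
  [set w | exists2 x : R, 0 < x & w = ln x +i* 0 \/ w = ln x +i* (2 * pi)].

Definition hankel_set (e : R) : set C :=
  [set w | (exists2 x : R, e <= x & w = ln x +i* 0 \/ w = ln x +i* (2 * pi)) \/
           (exists2 th : R, 0 <= th <= 2 * pi & w = ln e +i* th)].

(** What remains of [hankel e] as e -> 0: the outgoing lower side minus the incoming upper side, the
    circle having shrunk away. *)
Definition cut_integral (phi : C -> C) : C :=
  cintegral `]0, +oo[ (fun x => phi (ln x +i* (2 * pi)) - phi (ln x +i* 0)).

Lemma integrable_expRN (dl : R) : 0 < dl ->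
  mu.-integrable `[0, +oo[ (EFin \o (fun x => expR (- (dl * x)))).
Proof.
move=> dl0.
have h := integrable_exponential_pdf dl0.
have h2 : mu.-integrable `[0, +oo[ (EFin \o (fun x => exponential_pdf dl x)).
  by apply: integrableS h.
have h3 := integrableZl_EFin dl^-1 (measurable_itv _) h2.
apply: eq_integrable_EFin h3 => // x; rewrite /= in_itv /= andbT => x0.
by rewrite exponential_pdfE// mulrA mulVf ?gt_eqF// mul1r mulNr.
Qed.

Lemma integrable_expRN_pos (dl : R) : 0 < dl ->
  mu.-integrable `]0, +oo[ (EFin \o (fun x => expR (- (dl * x)))).
Proof.
move=> dl0; apply: integrableS (integrable_expRN dl0) => //.
by move=> x /=; rewrite !in_itv /= !andbT; exact: ltW.
Qed.

Lemma normc_cexp_ln (x y : R) : 0 < x -> normc (cexp (ln x +i* y)) = x.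
Proof. by move=> x0; rewrite normc_cexp /= lnK. Qed.

Lemma cmeasurable_ln_line (y : R) : cmeasurable setT (fun x : R => ln x +i* y).
Proof. by apply: cmeasurable_complex; [exact: measurable_ln|exact: measurable_cst]. Qed.

Lemma fmeasurable_line phi (y : R) (D : set R) : fmeasurable phi ->
  cmeasurable D (fun x : R => phi (ln x +i* y)).
Proof.
move=> mphi; apply: (@cmeasurableS _ _ _ D setT) => //.
exact: mphi (cmeasurable_ln_line y).
Qed.

Definition tailmass (dl : R) := \int[mu]_(x in `]0, +oo[) expR (- (dl * x)).

Lemma bounded_cut_integral dl : 0 < dl ->
  bounded_functional dl (2 * tailmass dl) cut_lines cut_integral.
Proof.
move=> dl0 phi B mphi hB.
have ig := integrableZl_EFin (2 * B) (measurable_itv `]0, +oo[) (integrable_expRN_pos dl0).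
have -> : B * (2 * tailmass dl) = \int[mu]_(x in `]0, +oo[) (2 * B * expR (- (dl * x))).
  by rewrite RintegralZl ?(integrable_expRN_pos dl0)// mulrCA mulrA.
apply: le_normc_cintegral => //.
  by apply: cmeasurableB; exact: fmeasurable_line.
move=> x /=; rewrite in_itv /= andbT => x0.
apply: le_trans (le_normcB _ _) _.
have h y : y = 0 \/ y = 2 * pi -> normc (phi (ln x +i* y)) <= B * expR (- (dl * x)).
  move=> hy; rewrite -{2}(normc_cexp_ln y x0); apply: hB.
  by exists x => //; case: hy => ->; [left|right].
have -> : 2 * B * expR (- (dl * x)) = B * expR (- (dl * x)) + B * expR (- (dl * x)) by ring.
apply: lerD; apply: h; [by right|by left].
Qed.

Lemma measurable_cut_integral : measurable_functional cut_integral.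
Proof.
move=> d T f mf.
apply: (cmeasurable_cintegral_param (f := fun p : T * R =>
  f p.1 (ln p.2 +i* (2 * pi)) - f p.1 (ln p.2 +i* 0))) => //.
by apply: cmeasurableB; apply: mf; try exact: measurable_fst;
   apply: cmeasurable_complex; try exact: measurable_cst;
   exact: measurableT_comp (@measurable_ln R) measurable_snd.
Qed.

Lemma cvg_cut_integral dl : 0 < dl ->
  converging_functionals dl (fun=> cut_lines) (fun=> cut_integral) cut_lines cut_integral.
Proof.
move=> dl0 phi psi B mphi [N _ hB] cphi.
have ig := integrableZl_EFin (2 * B) (measurable_itv `]0, +oo[) (integrable_expRN_pos dl0).
(* The domination holds only from rank N on, whereas [cvg_cintegral] asks for it at every rank. *)
rewrite -(cvg_shiftn N).
apply: (proj2 (cvg_cintegral (g := fun x => 2 * B * expR (- (dl * x))) _ _ _ _ _)) => //.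
- by move=> n; apply: cmeasurableB; exact: fmeasurable_line.
- move=> x /=; rewrite in_itv /= andbT => x0.
  have c2 : phi m (ln x +i* (2 * pi)) @[m --> \oo] --> psi (ln x +i* (2 * pi)).
    by apply: cphi; exists x => //; right.
  have c0 : phi m (ln x +i* 0) @[m --> \oo] --> psi (ln x +i* 0).
    by apply: cphi; exists x => //; left.
  move: c2 c0; rewrite -(cvg_shiftn N) -[X in _ -> X -> _](cvg_shiftn N) => s2 s0.
  exact: (cvgB s2 s0).
- move=> n x /=; rewrite in_itv /= andbT => x0.
  apply: le_trans (le_normcB _ _) _.
  have h y : y = 0 \/ y = 2 * pi ->
      normc (phi (n + N)%N (ln x +i* y)) <= B * expR (- (dl * x)).
    move=> hy; rewrite -{2}(normc_cexp_ln y x0); apply: hB; first exact: leq_addl.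
    by exists x => //; case: hy => ->; [left|right].
  have -> : 2 * B * expR (- (dl * x)) = B * expR (- (dl * x)) + B * expR (- (dl * x)) by ring.
  apply: lerD; apply: h; [by right|by left].
Qed.

Lemma cmeasurable_circle (e : R) : cmeasurable setT (fun th : R => ln e +i* th).
Proof. by apply: cmeasurable_complex; [exact: measurable_cst|exact: measurable_id]. Qed.

Lemma cmeasurable_circle_jac (e : R) :
  cmeasurable setT (fun th : R => (0 +i* e) * cexp (0 +i* th) : C).
Proof.
apply: cmeasurableM; first exact: cmeasurable_cst.
apply: cmeasurable_cexp; apply: cmeasurable_complex; first exact: measurable_cst.
exact: measurable_id.
Qed.

Lemma normc_circle_jac (e th : R) : 0 < e -> normc ((0 +i* e) * cexp (0 +i* th)) = e.
Proof.
move=> e0; rewrite normcM normc_cexp /= expR0 mulr1.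
by rewrite /normc expr0n add0r sqrtr_sqr ger0_norm// ltW.
Qed.

Lemma measurable_hankel (e : R) : measurable_functional (hankel e).
Proof.
move=> d T f mf.
have m1 y : cmeasurable setT (fun t => cintegral `[e, +oo[ (fun x => f t (ln x +i* y))).
  apply: (cmeasurable_cintegral_param (f := fun p : T * R => f p.1 (ln p.2 +i* y))) => //.
  apply: mf; first exact: measurable_fst.
  apply: cmeasurable_complex; last exact: measurable_cst.
  exact: measurableT_comp (@measurable_ln R) measurable_snd.
apply: cmeasurableD; last exact: m1.
apply: cmeasurableD; first by apply: cmeasurableN; exact: m1.
apply: (cmeasurable_cintegral_param (f := fun p : T * R =>
  f p.1 (ln e +i* p.2) * ((0 +i* e) * cexp (0 +i* p.2)))) => //.
apply: cmeasurableM.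
  apply: mf; first exact: measurable_fst.
  exact: cmeasurable_comp (@measurable_snd _ _ T _) (cmeasurable_circle e).
exact: cmeasurable_comp (@measurable_snd _ _ T _) (cmeasurable_circle_jac e).
Qed.

Lemma Rintegral_sub (e dl : R) : 0 < e -> 0 < dl ->
  \int[mu]_(x in `[e, +oo[) expR (- (dl * x)) <= tailmass dl.
Proof.
move=> e0 dl0; rewrite -lee_fin /tailmass /Rintegral !fineK.
- apply: ge0_subset_integral => //.
  + apply/measurable_EFinP; apply: measurable_funS (measurableT) _ _ => //.
    apply: measurableT_comp => //; apply: measurable_funN; apply: measurable_funM => //.
  + by move=> x /=; rewrite !in_itv /= !andbT; exact: lt_le_trans.
- apply: integrable_fin_num => //; exact: integrable_expRN_pos.
- apply: integrable_fin_num => //; apply: integrableS (integrable_expRN dl0) => //.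
  by move=> x /=; rewrite !in_itv /= !andbT; apply: le_trans; exact: ltW.
Qed.

Lemma circle_bound (dl e B : R) phi : 0 < e -> 0 <= B -> 0 < dl -> fmeasurable phi ->
  (forall w, hankel_set e w -> normc (phi w) <= B * weight dl w) ->
  normc (cintegral `[0, 2 * pi]
    (fun th => phi (ln e +i* th) * ((0 +i* e) * cexp (0 +i* th)))) <= B * e * (2 * pi).
Proof.
move=> e0 B0 dl0 mphi hB; rewrite -[X in _ <= _ * X]subr0.
apply: le_normc_cintegral_itv.
- by rewrite mulr_ge0// pi_ge0.
- apply: cmeasurableM; apply: (@cmeasurableS _ _ _ _ setT) => //.
    exact: mphi (cmeasurable_circle e).
  exact: cmeasurable_circle_jac.
move=> th hth; rewrite normcM normc_circle_jac// ler_wpM2r ?(ltW e0)//.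
apply: le_trans (hB _ _) _; first by right; exists th.
rewrite ler_piMr// /weight -expR0 ler_expR oppr_le0 mulr_ge0 ?(ltW dl0)//.
exact: normc_ge0.
Qed.

Lemma ray_bound (dl e B y : R) phi : 0 < e -> 0 < dl -> fmeasurable phi ->
  y = 0 \/ y = 2 * pi ->
  (forall w, hankel_set e w -> normc (phi w) <= B * weight dl w) ->
  normc (cintegral `[e, +oo[ (fun x => phi (ln x +i* y))) <= B * tailmass dl.
Proof.
move=> e0 dl0 mphi hy hB.
have ie : mu.-integrable `[e, +oo[ (EFin \o (fun x => expR (- (dl * x)))).
  apply: integrableS (integrable_expRN dl0) => //.
  by move=> x /=; rewrite !in_itv /= !andbT; apply: le_trans; exact: ltW.
have B0 : 0 <= B.
  have h : hankel_set e (ln e +i* 0) by left; exists e => //; left.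
  have := le_trans (normc_ge0 _) (hB _ h).
  by rewrite pmulr_lge0// expR_gt0.
apply: (@le_trans _ _ (\int[mu]_(x in `[e, +oo[) (B * expR (- (dl * x))))).
  apply: le_normc_cintegral => //.
  - exact: fmeasurable_line.
  - exact: integrableZl_EFin.
  - move=> x /=; rewrite in_itv /= andbT => ex.
    have x0 := lt_le_trans e0 ex.
    rewrite -{2}(normc_cexp_ln y x0); apply: hB.
    by left; exists x => //; case: hy => ->; [left|right].
by rewrite RintegralZl// ler_wpM2l//; exact: Rintegral_sub.
Qed.

(** The constant is independent of e: each side costs at most [tailmass dl], and the circle at most
    its length 2 pi e <= 2 pi. *)
Lemma bounded_hankel dl e : 0 < dl -> 0 < e <= 1 ->
  bounded_functional dl (2 * tailmass dl + 2 * pi) (hankel_set e) (hankel e).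
Proof.
move=> dl0 /andP[e0 e1] phi B mphi hB.
have B0 : 0 <= B.
  have h : hankel_set e (ln e +i* 0) by left; exists e => //; left.
  have := le_trans (normc_ge0 _) (hB _ h).
  by rewrite pmulr_lge0// expR_gt0.
rewrite /hankel; apply: le_trans (ler_normcD _ _) _.
have h1 := ray_bound e0 dl0 mphi (or_introl erefl) hB.
have h2 := ray_bound e0 dl0 mphi (or_intror erefl) hB.
have h3 := circle_bound e0 B0 dl0 mphi hB.
have h4 := ler_normcD (- cintegral `[e, +oo[ (fun x => phi (ln x +i* 0)))
  (cintegral `[0, 2 * pi] (fun th => phi (ln e +i* th) * ((0 +i* e) * cexp (0 +i* th)))).
rewrite normc_opp in h4.
have h5 : B * e * (2 * pi) <= B * (2 * pi).
  by rewrite ler_wpM2r ?mulr_ge0 ?pi_ge0// ler_piMr.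
have -> : B * (2 * tailmass dl + 2 * pi) = B * tailmass dl + B * (2 * pi) + B * tailmass dl.
  ring.
apply: lerD => //; apply: le_trans h4 _; apply: lerD => //.
exact: le_trans h3 h5.
Qed.

Lemma cintegral_ray_mkcond (e : R) (f : R -> C) : 0 < e ->
  cintegral `[e, +oo[ f = cintegral `]0, +oo[ (fun x => if e <= x then f x else 0).
Proof.
move=> e0; rewrite (@cintegral_mkcond _ `]0, +oo[).
  by apply: eq_cintegral => x _; rewrite mem_setE in_itv /= andbT.
by move=> x; rewrite /= !in_itv /= !andbT; exact: lt_le_trans.
Qed.

(** Each side is extended by 0 to ]0, +oo[, where dominated convergence applies; the circle
    contributes O(e m). *)
Lemma cvg_hankel dl (e : nat -> R) : 0 < dl ->
  (forall m, 0 < e m <= 1) -> e m @[m --> \oo] --> (0 : R) ->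
  converging_functionals dl (fun m => hankel_set (e m)) (fun m => hankel (e m))
    cut_lines cut_integral.
Proof.
move=> dl0 he ce phi psi B mphi [N _ hB] cphi.
have e0 m : 0 < e m by case/andP: (he m).
have B0 : 0 <= B.
  have h : hankel_set (e N) (ln (e N) +i* 0) by left; exists (e N) => //; left.
  have := le_trans (normc_ge0 _) (hB N (leqnn _) _ h).
  by rewrite pmulr_lge0// expR_gt0.
have ig := integrableZl_EFin B (measurable_itv `]0, +oo[) (integrable_expRN_pos dl0).
have ray y : y = 0 \/ y = 2 * pi ->
    cintegrable `]0, +oo[ (fun x => psi (ln x +i* y)) /\
    cintegral `[e m, +oo[ (fun x => phi m (ln x +i* y)) @[m --> \oo] -->
    cintegral `]0, +oo[ (fun x => psi (ln x +i* y)).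
  move=> hy.
  have ln_y x : 0 < x -> cut_lines (ln x +i* y).
    by move=> x0; exists x => //; case: hy => ->; [left|right].
  have [] := cvg_cintegral (D := `]0, +oo[%classic)
    (F := fun m x => if e (m + N)%N <= x then phi (m + N)%N (ln x +i* y) else 0)
    (f := fun x => psi (ln x +i* y)) (measurable_itv _) _ _ ig _.
  - move=> m.
    have -> : (fun x => if e (m + N)%N <= x then phi (m + N)%N (ln x +i* y) else 0) =
       (fun x => (\1_(`[e (m + N)%N, +oo[%classic) x)%:C * phi (m + N)%N (ln x +i* y)).
      apply/funext => x; rewrite indicE mem_setE in_itv /= andbT.
      by case: (e (m + N)%N <= x); rewrite ?mul1r ?mul0r.
    apply: cmeasurableM; last exact: fmeasurable_line.
    apply: cmeasurable_real; exact: measurable_indic.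
  - move=> x /=; rewrite in_itv /= andbT => x0.
    have cp := cphi _ (ln_y x x0).
    move: (cp); rewrite -(cvg_shiftn N) => cp'.
    apply: cvg_trans cp'; apply: near_eq_cvg.
    have : \forall m \near \oo, e m < x by apply: (cvgr_lt _ ce).
    move=> [M _ hM]; exists M => // m /= Mm.
    by rewrite (ltW (hM _ _))//= (leq_trans Mm) ?leq_addr.
  - move=> m x /=; rewrite in_itv /= andbT => x0.
    case: ifPn => ex; last by rewrite normc0 mulr_ge0// expR_ge0.
    rewrite -{2}(normc_cexp_ln y x0); apply: hB; first exact: leq_addl.
    by left; exists x => //; case: hy => ->; [left|right].
  move=> hi hc; split => //; rewrite -(cvg_shiftn N).
  by under eq_fun do rewrite (cintegral_ray_mkcond _ (e0 _)).
have [i0 c0] := ray 0 (or_introl erefl).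
have [i1 c1] := ray (2 * pi) (or_intror erefl).
have cc : cintegral `[0, 2 * pi] (fun th => phi m (ln (e m) +i* th) *
    ((0 +i* e m) * cexp (0 +i* th))) @[m --> \oo] --> (0 : C).
  apply/cvgcP => eps eps0.
  have : \forall m \near \oo, e m < eps / (B * (2 * pi) + 1).
    by apply: (cvgr_lt _ ce); rewrite divr_gt0// ltr_wpDl// mulr_ge0// mulr_ge0// pi_ge0.
  have nN : \forall m \near \oo, (N <= m)%N by exists N.
  move: nN; apply: filterS2 => m Nm; rewrite ltr_pdivlMr; last first.
    by rewrite ltr_wpDl// mulr_ge0// mulr_ge0// pi_ge0.
  move=> he'; rewrite subr0.
  apply: le_lt_trans (circle_bound (e0 m) B0 dl0 (mphi m) (hB m Nm)) _.
  apply: le_lt_trans he'; rewrite -mulrA mulrCA ler_wpM2l ?(ltW (e0 m))//.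
  by rewrite lerDl.
have -> : cut_integral psi = - cintegral `]0, +oo[ (fun x => psi (ln x +i* 0)) + 0 +
    cintegral `]0, +oo[ (fun x => psi (ln x +i* (2 * pi))).
  by rewrite /cut_integral (cintegralB (measurable_itv _) i1 i0) addr0 addrC.
exact: (cvgD (cvgD (cvgN c0) cc) c1).
Qed.

Lemma near_hankel_set (e : nat -> R) : e m @[m --> \oo] --> (0 : R) ->
  forall w, cut_lines w -> \forall m \near \oo, hankel_set (e m) w.
Proof.
move=> ce w [x x0 hw].
have : \forall m \near \oo, e m < x by apply: (cvgr_lt _ ce).
by apply: filterS => m em; left; exists x => //; exact: ltW.
Qed.

(** Linearity, one variable at a time: the factor in the outermost variable is a constant for the
    inner integrals and joins the coefficient. *)
Lemma iterI_cut_sum_prod n (I : Type) (s : seq I) (c : I -> C) (f : I -> 'I_n -> C -> C) :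
  (forall i k, cintegrable `]0, +oo[
     (fun x => f i k (ln x +i* (2 * pi)) - f i k (ln x +i* 0))) ->
  iterI cut_integral (fun w : 'rV[C]_n => \sum_(i <- s) c i * \prod_k f i k (w 0 k)) =
  \sum_(i <- s) c i * \prod_k cut_integral (f i k).
Proof.
elim: n c f => [|n IH] c f hf /=.
  by apply: eq_bigr => i _; rewrite !big_ord0.
have step w0 : iterI cut_integral (fun w : 'rV[C]_n => \sum_(i <- s) c i *
    \prod_(k < n.+1) f i k (row_mx w0%:M w 0 k)) =
    \sum_(i <- s) c i * \prod_(k < n) cut_integral (f i (lift ord0 k)) * f i ord0 w0.
  transitivity (iterI cut_integral (fun w : 'rV[C]_n => \sum_(i <- s) (c i * f i ord0 w0) *
     \prod_(k < n) f i (lift ord0 k) (w 0 k))).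
    congr (iterI _ _); apply/funext => w; apply: eq_bigr => i _.
    rewrite big_ord_recl -mulrA; congr (_ * (_ * _)).
      have -> : ord0 = lshift n (ord0 : 'I_1) by apply: val_inj.
      by rewrite row_mx_lshift0.
    apply: eq_bigr => k _; congr (f i _ _).
    have -> : lift ord0 k = rshift 1 k by apply: val_inj.
    by rewrite row_mxEr.
  rewrite (IH (fun i => c i * f i ord0 w0) (fun i k => f i (lift ord0 k))); last first.
    by move=> i k; exact: hf.
  by apply: eq_bigr => i _; rewrite mulrAC.
rewrite /cut_integral.
under eq_cintegral do rewrite !step -sumrB.
under eq_cintegral do under eq_bigr do rewrite -mulrBr.
rewrite cintegral_sum//; last by move=> i; apply: cintegrableZ.
apply: eq_bigr => i _; rewrite cintegralZ// big_ord_recl -mulrA; congr (_ * _).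
by rewrite mulrC.
Qed.

End IteratedContour.

(** * The kernel and its limits *)

Section KernelEstimates.
Variable R : realType.
Local Notation C := (complex (Real.sort R)).

Section SequencesInC.
Variables (f g : nat -> C) (a b : C).
Hypothesis fa : f m @[m --> \oo] --> a.
Hypothesis gb : g m @[m --> \oo] --> b.

Lemma cvgcD : f m + g m @[m --> \oo] --> a + b.
Proof. exact: (@cvgD _ C^o _ _ _ f g a b fa gb). Qed.

Lemma cvgcM : f m * g m @[m --> \oo] --> a * b.
Proof. exact: (@cvgM _ _ _ _ f g a b fa gb). Qed.

Lemma cvgcB : f m - g m @[m --> \oo] --> a - b.
Proof. exact: (@cvgB _ C^o _ _ _ f g a b fa gb). Qed.

Lemma cvgcN : - f m @[m --> \oo] --> - a.
Proof. exact: (@cvgN _ C^o _ _ _ f a fa). Qed.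

Lemma cvgcV : a != 0 -> (f m)^-1 @[m --> \oo] --> a^-1.
Proof. by move=> a0; exact: (@cvgV _ _ _ _ f a a0 fa). Qed.

End SequencesInC.

Lemma cvgc_cst (c : C) : (fun _ : nat => c) m @[m --> \oo] --> c.
Proof. exact: (@cvg_cst C^o). Qed.
Arguments cvgc_cst c : clear implicits.

Section SequencesAndConstants.
Variables (f : nat -> C) (a : C).
Hypothesis fa : f m @[m --> \oo] --> a.

Lemma cvgcMl (c : C) : c * f m @[m --> \oo] --> c * a.
Proof. exact: (@cvgcM (fun=> c) f c a (cvgc_cst c) fa). Qed.

Lemma cvgcMr (c : C) : f m * c @[m --> \oo] --> a * c.
Proof. exact: (@cvgcM f (fun=> c) a c fa (cvgc_cst c)). Qed.

Lemma cvgcBl (c : C) : c - f m @[m --> \oo] --> c - a.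
Proof. exact: (@cvgcB (fun=> c) f c a (cvgc_cst c) fa). Qed.

Lemma cvgcBr (c : C) : f m - c @[m --> \oo] --> a - c.
Proof. exact: (@cvgcB f (fun=> c) a c fa (cvgc_cst c)). Qed.

Lemma cvgcDr (c : C) : f m + c @[m --> \oo] --> a + c.
Proof. exact: (@cvgcD f (fun=> c) a c fa (cvgc_cst c)). Qed.

End SequencesAndConstants.
Arguments cvgcMl {f a} fa c.
Arguments cvgcMr {f a} fa c.
Arguments cvgcBl {f a} fa c.
Arguments cvgcBr {f a} fa c.
Arguments cvgcDr {f a} fa c.

Definition gker (c : R) (y : C) : C :=
  (cexp y - 1)^-1 - c%:C / (cexp (c%:C * y) - 1).

(** The derivative of c / (e^{cy} - 1) in c at c = 1, that is, minus the derivative of [gker]; it is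
    also the closed form of h. *)
Definition hker (y : C) : C := (cexp y - 1 - y * cexp y) / (cexp y - 1) ^+ 2.

(** With e^{cy} = e^y e^{hy} the numerator splits into a part quadratic in h and a part linear in h,
    both O(y^2) at y = 0, as is the denominator. This makes the size O(h) visible down to y = 0. *)
Lemma gkerE (c : R) (y : C) (h := c - 1) : cexp y - 1 != 0 -> cexp (c%:C * y) - 1 != 0 ->
  gker c y = (cexp y * (cexp (h%:C * y) - 1 - h%:C * y) +
    h%:C * ((y - 1) * (cexp y - 1 - y) + y ^+ 2)) /
    ((cexp y - 1) * (cexp (c%:C * y) - 1)).
Proof.
move=> n1 n2.
have ec : cexp (c%:C * y) = cexp y * cexp (h%:C * y).
  by rewrite -cexpD; congr (cexp _); rewrite /h rmorphB rmorph1; ring.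
have hc : c%:C = 1 + h%:C :> C by rewrite /h rmorphB rmorph1; ring.
move: n1 n2; rewrite /gker ec hc; move: (cexp y) (cexp (h%:C * y)) h%:C => a b k n1 n2.
by field; rewrite n1 n2.
Qed.

Lemma lerB1_normc_cexp (y : C) : expR (Re y) - 1 <= normc (cexp y - 1).
Proof. by apply: le_trans (lerB_normc _ _); rewrite normc_cexp normc1. Qed.

Lemma cexpB1_neq0 (y : C) : 0 < Re y -> cexp y - 1 != 0.
Proof.
move=> y0; rewrite -normc_gt0; apply: lt_le_trans (lerB1_normc_cexp y).
by rewrite subr_gt0 expR_gt1.
Qed.

Lemma expR_le_inv (x : R) : x < 1 -> expR x <= (1 - x)^-1.
Proof.
move=> x1; have h := expR_ge1Dx (- x).
rewrite -[expR x]invrK lef_pV2 ?posrE ?invr_gt0 ?expR_gt0 ?subr_gt0//.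
by rewrite -expRN.
Qed.

Lemma lin_le_expR (a x : R) : 0 < a -> x <= a * expR (x / a).
Proof.
move=> a0; rewrite -ler_pdivrMl//.
have := expR_ge1Dx (x / a); rewrite mulrC => h; lra.
Qed.

(** 56 = 7 * 8: in [gkerE] the numerator is at most (2 * 2 + 3) |h| |y|^2 and the denominator at
    least (|y| / 2)(|y| / 4). *)
Lemma gker_bound_small (c : R) (y : C) : `|c - 1| <= 1 / 4 -> normc y <= 1 / 4 ->
  normc (gker c y) <= 56 * `|c - 1|.
Proof.
move=> hc hy.
(* At y = 0 both denominators vanish and their inverses are 0 by convention, so the kernel takes the
   harmless value 0. *)
have [->|y0] := eqVneq y 0.
  by rewrite /gker mulr0 cexp0 subrr invr0 mulr0 subrr normc0 mulr_ge0.
set h := c - 1 in hc *.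
have [i1 i2 i3] : [/\ (1 - 1 / 4)^-1 = 4 / 3 :> R, (1 - 5 / 16)^-1 = 16 / 11 :> R &
    (1 - 1 / 2)^-1 = 2 :> R] by split; field.
have ny0 : 0 < normc y by rewrite normc_gt0.
have bnd (z : C) (b : R) : normc z <= b -> b < 1 ->
    normc (cexp z - 1 - z) <= normc z ^+ 2 * (1 - b)^-1.
  move=> zb b1; apply: le_trans (normc_cexpB1B z) _.
  rewrite ler_wpM2l ?sqr_ge0//; apply: le_trans (expR_le_inv b1).
  by rewrite ler_expR; apply: le_trans (le_Re_normc z) zb.
have low (z : C) (b : R) : normc z <= b -> b < 1 ->
    normc z * (1 - b / (1 - b)) <= normc (cexp z - 1).
  move=> zb b1; have := lerB_normcD z (cexp z - 1 - z).
  rewrite (addrC z) subrK; apply: le_trans.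
  rewrite mulrBr mulr1 lerB//; apply: le_trans (bnd z b zb b1) _.
  rewrite expr2 -mulrA ler_wpM2l ?normc_ge0// ler_wpM2r// invr_ge0; lra.
have [h1 h2] : - (1 / 4) <= h /\ h <= 1 / 4 by move: hc; rewrite ler_norml => /andP.
have c0 : 3 / 4 <= c <= 5 / 4 by rewrite /h in h1 h2; apply/andP; split; lra.
have [c1 c2] := andP c0.
have ncy : normc (c%:C * y) = c * normc y.
  by rewrite normcM normc_real ger0_norm//; lra.
have l1 : normc y / 2 <= normc (cexp y - 1).
  have hq : 1 / 4 < 1 :> R by lra.
  apply: le_trans (low y (1/4) hy hq); rewrite i1 ler_wpM2l ?normc_ge0//; lra.
have l2 : normc y / 4 <= normc (cexp (c%:C * y) - 1).
  have hq : 5 / 16 < 1 :> R by lra.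
  have cy : normc (c%:C * y) <= 5 / 16.
    rewrite ncy (_ : 5 / 16 = 5 / 4 * (1 / 4)); last by field.
    by rewrite ler_pM ?normc_ge0//; lra.
  apply: le_trans (low _ (5/16) cy hq); rewrite i2 ncy (mulrC c) -mulrA ler_wpM2l ?normc_ge0//.
  lra.
have n1 : cexp y - 1 != 0 by rewrite -normc_gt0; apply: lt_le_trans l1; rewrite divr_gt0.
have n2 : cexp (c%:C * y) - 1 != 0.
  by rewrite -normc_gt0; apply: lt_le_trans l2; rewrite divr_gt0.
rewrite gkerE// -/h normcM normcV normcM ler_pdivrMr ?mulr_gt0 ?normc_gt0//.
have num : normc (cexp y * (cexp (h%:C * y) - 1 - h%:C * y) +
    h%:C * ((y - 1) * (cexp y - 1 - y) + y ^+ 2)) <= 7 * `|h| * normc y ^+ 2.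
  apply: le_trans (ler_normcD _ _) _; rewrite (normcM (cexp y)) (normcM h%:C) normc_real.
  have e1 : normc (cexp y) <= 2.
    rewrite normc_cexp; apply: (@le_trans _ _ (expR (1 / 4))).
      by rewrite ler_expR; apply: le_trans (ler_norm _) _; apply: le_trans (le_Re_normc _) hy.
    have hq : 1 / 4 < 1 :> R by lra.
    apply: le_trans (expR_le_inv hq) _; rewrite i1; lra.
  have e2 : normc (cexp (h%:C * y) - 1 - h%:C * y) <= 2 * `|h| * normc y ^+ 2.
    have hhy : normc (h%:C * y) <= 1 / 2.
      rewrite normcM normc_real; apply: (@le_trans _ _ (1 / 4 * (1 / 4))).
        by rewrite ler_pM ?normc_ge0.
      lra.
    have hq : 1 / 2 < 1 :> R by lra.
    apply: le_trans (bnd _ _ hhy hq) _; rewrite i3 normcM normc_real exprMn.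
    have q : 0 <= normc y ^+ 2 by rewrite sqr_ge0.
    have q2 : `|h| ^+ 2 <= `|h| by rewrite expr2 ler_piMr//; lra.
    have := ler_wpM2r q q2; lra.
  have e3 : normc (y - 1) <= 5 / 4.
    by apply: le_trans (le_normcB _ _) _; rewrite normc1; lra.
  have e4 : normc (cexp y - 1 - y) <= normc y ^+ 2 * (4 / 3).
    have hq : 1 / 4 < 1 :> R by lra.
    apply: le_trans (bnd _ _ hy hq) _; rewrite i1 ler_wpM2l ?sqr_ge0//; lra.
  have e5 : normc ((y - 1) * (cexp y - 1 - y) + y ^+ 2) <= 3 * normc y ^+ 2.
    apply: le_trans (ler_normcD _ _) _; rewrite normcM normcX.
    have := sqr_ge0 (normc y); have := ler_pM (normc_ge0 _) (normc_ge0 _) e3 e4; lra.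
  have := ler_pM (normc_ge0 _) (normc_ge0 _) e1 e2.
  have := ler_wpM2l (normr_ge0 h) e5; lra.
apply: le_trans num _.
have := ler_pM _ _ l1 l2; rewrite !divr_ge0 ?normc_ge0// => /(_ isT isT) l12.
have := ler_wpM2l (normr_ge0 h) l12.
move: (normc (cexp y - 1) * normc (cexp (c%:C * y) - 1)) => D.
rewrite expr2; lra.
Qed.

(** In a sector away from 0, with a = Re y, the denominator is of size e^{a + c a} and the numerator
    at most |h| e^a e^{a/2} up to constants, powers of y being absorbed by exponentials; c >= 3/4
    leaves e^{-a/4}. *)
Lemma gker_bound_large (L b : R) : 0 <= L -> 0 < b -> exists2 K : R, 0 < K &
  forall (c : R) (y : C), `|c - 1| <= 1 / 4 -> b <= Re y ->
    normc y <= L * Re y ->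
    normc (gker c y) <= K * `|c - 1| * expR (- (Re y / 4)).
Proof.
(* Re z >= b/2 gives |e^z - 1| >= e^{Re z} - 1 >= m e^{Re z}; this serves z = y and z = c y, since c
   >= 3/4. *)
move=> L0 b0; pose m : R := 1 - expR (- (b / 2)).
have m0 : 0 < m by rewrite subr_gt0 -expR0 ltr_expR oppr_lt0 divr_gt0.
exists ((64 * L ^+ 2 + 8 * L + 2) / m ^+ 2).
  rewrite divr_gt0 ?exprn_gt0//; have := sqr_ge0 L; lra.
move=> c y hc hb hL; set a := Re y in hb hL *.
set h := c - 1 in hc *.
have [h1 h2] : - (1 / 4) <= h /\ h <= 1 / 4 by move: hc; rewrite ler_norml => /andP.
have c1 : 3 / 4 <= c by rewrite /h in h1; lra.
have a0 : 0 < a by exact: lt_le_trans hb.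
have Rcy : Re (c%:C * y) = c * a by rewrite cReM /= mul0r subr0.
have low (z : C) : b / 2 <= Re z -> m * expR (Re z) <= normc (cexp z - 1).
  move=> hz; apply: le_trans (lerB1_normc_cexp z).
  rewrite /m mulrBl mul1r lerB// -expRD -[leLHS]expR0 ler_expR; lra.
have cab : b / 2 <= c * a.
  have := ler_wpM2r (ltW a0) c1; lra.
have l1 : m * expR a <= normc (cexp y - 1) by apply: low; rewrite -/a; lra.
have l2 : m * expR (c * a) <= normc (cexp (c%:C * y) - 1).
  by rewrite -Rcy; apply: low; rewrite Rcy.
have n1 : cexp y - 1 != 0.
  by rewrite -normc_gt0; apply: lt_le_trans l1; rewrite mulr_gt0 ?expR_gt0.
have n2 : cexp (c%:C * y) - 1 != 0.
  by rewrite -normc_gt0; apply: lt_le_trans l2; rewrite mulr_gt0 ?expR_gt0.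
have den : m ^+ 2 * (expR a * expR (c * a)) <=
    normc (cexp y - 1) * normc (cexp (c%:C * y) - 1).
  have := ler_pM _ _ l1 l2; rewrite !mulr_ge0 ?expR_ge0 ?(ltW m0)// => /(_ isT isT).
  by apply: le_trans; rewrite expr2; lra.
have a8 : a <= 8 * expR (a / 8) by exact: lin_le_expR.
have ea : 1 <= expR a by rewrite -expR0 ler_expR ltW.
have num : normc (cexp y * (cexp (h%:C * y) - 1 - h%:C * y) +
    h%:C * ((y - 1) * (cexp y - 1 - y) + y ^+ 2)) <=
    `|h| * expR a * ((64 * L ^+ 2 + 8 * L + 2) * expR (a / 2)).
  apply: le_trans (ler_normcD _ _) _.
  rewrite (normcM (cexp y)) (normcM h%:C) normc_real normc_cexp -/a.
  have -> : (y - 1) * (cexp y - 1 - y) + y ^+ 2 = (y - 1) * cexp y + 1 by ring.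
  have e1 : normc (cexp (h%:C * y) - 1 - h%:C * y) <= `|h| * (64 * L ^+ 2 * expR (a / 2)).
    apply: le_trans (normc_cexpB1B _) _.
    rewrite normcM normc_real exprMn cReM /= mul0r subr0 -/a normrM (ger0_norm (ltW a0)).
    have q1 : expR (`|h| * a) <= expR (a / 4).
      by rewrite ler_expR; have := ler_wpM2r (ltW a0) hc; lra.
    have q2 : normc y ^+ 2 <= 64 * L ^+ 2 * expR (a / 4).
      have -> : expR (a / 4) = expR (a / 8) ^+ 2.
        by rewrite expr2 -expRD; congr expR; field.
      rewrite (_ : 64 * L ^+ 2 * _ = (L * (8 * expR (a / 8))) ^+ 2); last by ring.
      rewrite lerXn2r ?nnegrE ?normc_ge0 ?mulr_ge0 ?expR_ge0//.
      by apply: le_trans hL _; rewrite ler_wpM2l.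
    have q3 : `|h| ^+ 2 <= `|h| by rewrite expr2 ler_piMr//; lra.
    have -> : expR (a / 2) = expR (a / 4) * expR (a / 4).
      by rewrite -expRD; congr expR; field.
    rewrite -[leLHS]mulrA; apply: ler_pM; [exact: sqr_ge0| |exact: q3|].
      by rewrite mulr_ge0 ?sqr_ge0 ?expR_ge0.
    by rewrite mulrA; apply: ler_pM; [exact: sqr_ge0|exact: expR_ge0|exact: q2|exact: q1].
  have e2 : normc ((y - 1) * cexp y + 1) <= expR a * ((8 * L + 2) * expR (a / 2)).
    apply: le_trans (ler_normcD _ _) _; rewrite normcM normc1 normc_cexp -/a.
    have q1 : normc (y - 1) <= 8 * L * expR (a / 2) + expR (a / 2).
      apply: le_trans (le_normcB _ _) _; rewrite normc1; apply: lerD.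
        apply: le_trans hL _; rewrite (mulrC 8) -mulrA ler_wpM2l//.
        apply: le_trans a8 _; rewrite ler_wpM2l// ler_expR; lra.
      by rewrite -[leLHS]expR0 ler_expR; lra.
    have q2 : 1 <= expR a * expR (a / 2).
      by rewrite -expRD -[leLHS]expR0 ler_expR; lra.
    have := ler_wpM2r (expR_ge0 a) q1; lra.
  have := ler_wpM2l (expR_ge0 a) e1; have := ler_wpM2l (normr_ge0 h) e2.
  lra.
rewrite gkerE// -/h normcM normcV normcM ler_pdivrMr ?mulr_gt0 ?normc_gt0//.
apply: le_trans num _.
have K0 : 0 <= (64 * L ^+ 2 + 8 * L + 2) by have := sqr_ge0 L; lra.
apply: (@le_trans _ _ ((64 * L ^+ 2 + 8 * L + 2) / m ^+ 2 * `|h| * expR (- (a / 4)) *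
    (m ^+ 2 * (expR a * expR (c * a))))); last first.
  rewrite ler_wpM2l//.
  by rewrite !mulr_ge0 ?invr_ge0 ?sqr_ge0 ?expR_ge0.
have -> : (64 * L ^+ 2 + 8 * L + 2) / m ^+ 2 * `|h| * expR (- (a / 4)) *
    (m ^+ 2 * (expR a * expR (c * a))) =
    `|h| * expR a * ((64 * L ^+ 2 + 8 * L + 2) * (expR (- (a / 4)) * expR (c * a))).
  by field; rewrite gt_eqF.
rewrite ler_wpM2l ?mulr_ge0 ?expR_ge0// ler_wpM2l// -expRD ler_expR.
have := ler_wpM2r (ltW a0) c1; lra.
Qed.

(* On the Hankel contour of radius [e], [t_j + ... + t_r = X + z] with [X >= 0] and [|z| <= r e]. *)
Lemma gker_bound (gam : C) : 0 < Re gam -> exists2 k : R, 0 < k &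
  forall k' X z c, 0 < k' <= k -> 0 <= X -> normc z <= k' -> `|c - 1| <= k' ->
    normc (gker c (gam * (X%:C + z))) <= k'^-1 * `|c - 1| * expR (- (k' * X)).
Proof.
move=> g0; set g := Re gam in g0; pose G := normc gam.
have gG : g <= G by apply: le_trans (ler_norm _) (le_Re_normc _).
have G0 : 0 < G by exact: lt_le_trans gG.
have [K K0 hK] := @gker_bound_large (4 * G / g) (g / (16 * G))
  (divr_ge0 (mulr_ge0 (ler0n _ _) (ltW G0)) (ltW g0))
  (divr_gt0 g0 (mulr_gt0 (ltr0n R 16) G0)).
pose k := Num.min (g / (16 * G ^+ 2)) (Num.min (1 / 112) (Num.min (G / 2) (Num.min (g / 8) K^-1))).
exists k.
  by rewrite !lt_min !divr_gt0 ?mulr_gt0 ?exprn_gt0// invr_gt0.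
move=> k' X z c /andP[k0]; rewrite !le_min => /and5P[k1 k2 k3 k4 k5] X0 hz hc.
set y := gam * (X%:C + z).
have c4 : `|c - 1| <= 1 / 4 by lra.
have Gk : G * k' <= g / (16 * G).
  apply: le_trans (ler_wpM2l (ltW G0) k1) _.
  by rewrite le_eqVlt; apply/orP; left; apply/eqP; field; rewrite gt_eqF.
have Gk8 : G * k' <= 1 / 8.
  apply: le_trans Gk _; rewrite ler_pdivrMr ?mulr_gt0//; lra.
have Gz : normc (gam * z) <= G * k' by rewrite normcM ler_wpM2l// ltW.
have yE : y = X%:C * gam + gam * z by rewrite /y; ring.
have nX : normc (X%:C * gam) = X * G by rewrite normcM normc_real ger0_norm.
have ny : normc y <= X * G + G * k'.
  by rewrite yE; apply: le_trans (ler_normcD _ _) _; rewrite nX lerD2l.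
have ny' : X * G - G * k' <= normc y.
  by rewrite yE; apply: le_trans (lerB_normcD _ _); rewrite nX lerB.
have Ry : X * g - G * k' <= Re y.
  rewrite yE cReD cReM /= mul0r subr0 -/g lerD2l.
  rewrite lerNl; apply: le_trans Gz; apply: le_trans (le_Re_normc _).
  by rewrite -normrN ler_norm.
(* For small y the abscissa X is bounded, so the exponential on the right is at least 1/2 and the
   bound with 56 suffices. Otherwise X G >= 1/8 dominates gamma z, and y lies in a sector away from
   0. *)
have [ys|yl] := leP (normc y) (1 / 4).
  apply: le_trans (gker_bound_small c4 ys) _.
  have XG : X * G <= 1 by lra.
  have kX : k' * X <= 1 / 2.
    have := ler_wpM2r X0 k3; lra.
  have e2 : 1 / 2 <= expR (- (k' * X)).
    by have := expR_ge1Dx (- (k' * X)); lra.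
  rewrite mulrAC ler_wpM2r//.
  have kV : 112 <= k'^-1.
    by rewrite -(invrK 112) lef_pV2 ?posrE ?invr_gt0//; lra.
  have := ler_pM _ _ kV e2; rewrite ler0n divr_ge0// => /(_ isT isT); lra.
have XG : 1 / 8 <= X * G by lra.
have Xg : g / (8 * G) <= X * g.
  rewrite ler_pdivrMr ?mulr_gt0//; have := ler_wpM2r (ltW g0) XG; lra.
have e16 : g / (16 * G) = g / (8 * G) / 2 by field; rewrite gt_eqF.
have Ry2 : X * g / 2 <= Re y by lra.
have b1 : g / (16 * G) <= Re y by lra.
have b2 : normc y <= 4 * G / g * Re y.
  apply: (@le_trans _ _ (2 * (X * G))).
    by apply: le_trans ny _; lra.
  have h : 4 * G / g * (X * g / 2) <= 4 * G / g * Re y.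
    by rewrite ler_wpM2l// divr_ge0 ?mulr_ge0 ?(ltW G0) ?(ltW g0).
  apply: le_trans h; rewrite le_eqVlt; apply/orP; left; apply/eqP; field.
  by rewrite gt_eqF.
apply: le_trans (hK c y c4 b1 b2) _.
apply: ler_pM.
- by rewrite mulr_ge0 ?(ltW K0).
- exact: expR_ge0.
- rewrite ler_wpM2r// -(invrK K) lef_pV2 ?posrE ?invr_gt0//.
- rewrite ler_expR lerN2; have := ler_wpM2r X0 k4; lra.
Qed.

Lemma cvgc_prod (I : Type) (s : seq I) (F : nat -> I -> C) (l : I -> C) :
  (forall i, F m i @[m --> \oo] --> l i) ->
  \prod_(i <- s) F m i @[m --> \oo] --> \prod_(i <- s) l i.
Proof.
move=> h; elim: s => [|i s IH].
  by under eq_fun do rewrite big_nil; rewrite big_nil; exact: cvg_cst.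
under eq_fun do rewrite big_cons; rewrite big_cons.
exact: cvgcM (h i) IH.
Qed.

Lemma cvgc_sum (I : Type) (s : seq I) (F : nat -> I -> C) (l : I -> C) :
  (forall i, F m i @[m --> \oo] --> l i) ->
  \sum_(i <- s) F m i @[m --> \oo] --> \sum_(i <- s) l i.
Proof.
move=> h; elim: s => [|i s IH].
  by under eq_fun do rewrite big_nil; rewrite big_nil; exact: cvg_cst.
under eq_fun do rewrite big_cons; rewrite big_cons.
exact: cvgcD (h i) IH.
Qed.

Lemma cvg_real_complex (u : nat -> R) (l : R) : u m @[m --> \oo] --> l ->
  ((u m)%:C : C) @[m --> \oo] --> l%:C.
Proof.
move=> /cvgrPdist_lt h; apply/cvgcP => e e0.
by have := h e e0; apply: filterS => m; rewrite -rmorphB normc_real distrC.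
Qed.

(** After division of [gkerE] by h, the part quadratic in h becomes e^y (e^{hy} - 1 - hy) / h and
    tends to 0; the linear part gives [hker]. *)
Lemma gker_cvg (y : C) (c : nat -> R) : 0 < Re y ->
  (forall m, c m != 1) -> c m @[m --> \oo] --> (1 : R) ->
  (- gker (c m) y) / ((c m)%:C - 1) @[m --> \oo] --> hker y.
Proof.
move=> y0 c1 cc; pose h m := c m - 1.
have hh : h m @[m --> \oo] --> (0 : R).
  by rewrite -[X in _ --> X](subrr 1); apply: cvgB => //; exact: cvg_cst.
have n1 := cexpB1_neq0 y0.
pose E m : C := (cexp ((h m)%:C * y) - 1 - (h m)%:C * y) / (h m)%:C.
have h0 m : h m != 0 by rewrite subr_eq0.
have hC0 m : (h m)%:C != 0 :> C.
  by rewrite -(rmorph0 (real_complex R)) (inj_eq (@complexI R)).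
have cE : E m @[m --> \oo] --> (0 : C).
  apply/cvgcP => e e0.
  have d0 : 0 < e / (normc y ^+ 2 * expR (normc y) + 1).
    by rewrite divr_gt0// ltr_wpDl// mulr_ge0 ?sqr_ge0 ?expR_ge0.
  have n1' : \forall m \near \oo, `|h m| < 1 by apply: (cvgr0_norm_lt _ hh).
  have n2' : \forall m \near \oo, `|h m| < e / (normc y ^+ 2 * expR (normc y) + 1).
    by apply: (cvgr0_norm_lt _ hh).
  move: n1' n2'; apply: filterS2 => m hm1.
  rewrite ltr_pdivlMr; last by rewrite ltr_wpDl// mulr_ge0 ?sqr_ge0 ?expR_ge0.
  move=> hm2; rewrite subr0 /E normcM normcV normc_real.
  rewrite ltr_pdivrMr ?normr_gt0//; apply: le_lt_trans (normc_cexpB1B _) _.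
  rewrite normcM normc_real exprMn cReM /= mul0r subr0 normrM.
  have q1 : expR (`|h m| * `|Re y|) <= expR (normc y).
    rewrite ler_expR; apply: le_trans (le_Re_normc y); rewrite ler_piMl// ltW//.
  apply: (@le_lt_trans _ _ (`|h m| * (`|h m| * (normc y ^+ 2 * expR (normc y))))).
    rewrite expr2 -!mulrA; do 2 rewrite ler_wpM2l//.
    by do 2 rewrite ler_wpM2l ?normc_ge0//.
  rewrite mulrC ltr_pM2r ?normr_gt0//; apply: le_lt_trans hm2.
  by rewrite ler_wpM2l// lerDl.
have cexpc : cexp ((c m)%:C * y) @[m --> \oo] --> cexp y.
  have h2 : ((c m)%:C * y : C) @[m --> \oo] --> y.
    by rewrite -[X in _ --> X]mul1r; exact: (cvgcMr (cvg_real_complex cc) y).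
  have := @differentiable_continuous _ _ _ _ _ (differentiable_cexp y).
  by move=> h3; exact: (cvg_comp _ _ h2 h3).
have lim : (- (cexp y * E m + ((y - 1) * (cexp y - 1 - y) + y ^+ 2)) *
   ((cexp y - 1) * (cexp ((c m)%:C * y) - 1))^-1) @[m --> \oo] --> hker y.
  have -> : hker y = - (cexp y * 0 + ((y - 1) * (cexp y - 1 - y) + y ^+ 2)) *
      ((cexp y - 1) * (cexp y - 1))^-1.
    by rewrite mulr0 add0r -expr2 /hker; congr (_ / _); ring.
  have s1 := cvgcN (cvgcDr (cvgcMl cE (cexp y)) ((y - 1) * (cexp y - 1 - y) + y ^+ 2)).
  have s2 := cvgcMl (cvgcBr cexpc 1) (cexp y - 1).
  exact: (cvgcM s1 (cvgcV s2 (mulf_neq0 n1 n1))).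
apply: cvg_trans lim; apply: near_eq_cvg.
have : \forall m \near \oo, 0 < c m by apply: (cvgr_gt _ cc).
apply: filterS => m cm0.
have n2 : cexp ((c m)%:C * y) - 1 != 0.
  by apply: cexpB1_neq0; rewrite cReM /= mul0r subr0 mulr_gt0.
rewrite gkerE// -/(h m).
have -> : (c m)%:C - 1 = (h m)%:C :> C by rewrite /h rmorphB.
rewrite /E; move: (hC0 m) n2 n1.
move: (h m)%:C (cexp ((c m)%:C * y)) (cexp y) (cexp _) => k u v x k0 u0 v0.
by field; rewrite k0 u0 v0.
Qed.

(** Partial sums of the series h, over 1 <= n <= N through the shift [n.+1]. *)
Definition hsum (N : nat) (y : C) : C :=
  \sum_(n < N) (1 - n.+1%:R * y) * cexp (- (n.+1%:R * y)).

Lemma hsum_closed N (y : C) (q := cexp (- y)) :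
  (1 - q) ^+ 2 * hsum N y = q * (1 - q ^+ N) * (1 - q)
     - y * q * (1 - N.+1%:R * q ^+ N + N%:R * q ^+ N.+1).
Proof.
elim: N => [|N IH]; first by rewrite /hsum big_ord0 expr0 mulr0; ring.
rewrite /hsum big_ord_recr /= mulrDr -/(hsum N y) IH.
have -> : cexp (- (N.+1%:R * y)) = q ^+ N.+1 by rewrite -mulrN cexpMn.
rewrite !exprS -![N.+2]addn1 -![N.+1]addn1 !natrD.
move: (q ^+ N) (N%:R : C) => p k; ring.
Qed.

Lemma hker_closed (y : C) (q := cexp (- y)) : 0 < Re y ->
  hker y = (q * (1 - q) - y * q) / (1 - q) ^+ 2.
Proof.
move=> y0; have n1 := cexpB1_neq0 y0.
have qe : q = (cexp y)^-1 by rewrite /q cexpN.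
have c0 := cexp_neq0 y.
rewrite /hker qe; move: (cexp y) n1 c0 => a n1 a0.
by field; rewrite a0 n1.
Qed.

(** In the closed form q^N and N q^N tend to 0, since (N + 1) e^{-aN} is at most a constant times
    e^{-aN/2}. *)
Lemma hsum_cvg (y : C) : 0 < Re y -> hsum N y @[N --> \oo] --> hker y.
Proof.
move=> y0; set a := Re y in y0; pose q := cexp (- y).
have nq N : normc (q ^+ N) = expR (- a * N%:R).
  by rewrite normcX normc_cexp cReN -expRM_natr.
have q1 : 1 - q != 0.
  rewrite -normc_gt0; apply: lt_le_trans (lerB_normc _ _); rewrite normc1 subr_gt0.
  by rewrite normc_cexp cReN -expR0 ltr_expR oppr_lt0.
have key (N : nat) : (N.+1%:R : R) * expR (- a * N%:R) <= (2 / a + 1) * (expR (- (a / 2))) ^+ N.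
  have e1 : expR (- a * N%:R) = expR (- (a / 2)) ^+ N * expR (- (a / 2)) ^+ N.
    by rewrite -exprMn -expRD -expRM_natr; congr expR; field.
  have e2 : N%:R * expR (- (a / 2)) ^+ N <= 2 / a.
    have := @lin_le_expR (2 / a) N%:R (divr_gt0 (ltr0Sn R 1) y0).
    rewrite -expRM_natr mulNr expRN ler_pdivrMr ?expR_gt0//.
    have -> : N%:R / (2 / a) = a / 2 * N%:R by field; rewrite gt_eqF.
    by [].
  have p0 : 0 <= expR (- (a / 2)) ^+ N by rewrite exprn_ge0// expR_ge0.
  have p1 : expR (- (a / 2)) ^+ N <= 1.
    by rewrite exprn_ile1 ?expR_ge0// -expR0 ler_expR oppr_le0 divr_ge0// ltW.
  rewrite e1 mulrA ler_wpM2r// -addn1 natrD mulrDl mul1r; exact: lerD.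
have cgeo : (2 / a + 1) * (expR (- (a / 2))) ^+ N @[N --> \oo] --> (0 : R).
  rewrite -[X in _ --> X](mulr0 (2 / a + 1)); apply: cvgMr; apply: cvg_expr.
  by rewrite ger0_norm ?expR_ge0// -expR0 ltr_expR oppr_lt0 divr_gt0.
have cn : (N.+1%:R * q ^+ N : C) @[N --> \oo] --> (0 : C).
  apply/cvgc_normc0.
  apply: (squeeze_cvgr _ (cvg_cst 0) cgeo); apply: nearW => N.
  by rewrite normc_ge0/= subr0 normcM normc_nat nq key.
have cq : (q ^+ N : C) @[N --> \oo] --> (0 : C).
  apply/cvgc_normc0.
  apply: (squeeze_cvgr _ (cvg_cst 0) cgeo); apply: nearW => N.
  rewrite normc_ge0/= subr0; apply: le_trans (key N); rewrite nq.
  by rewrite ler_peMl ?expR_ge0// ler1n.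
have -> : (fun N => hsum N y) = (fun N => (q * (1 - q ^+ N) * (1 - q)
     - y * q * (1 - N.+1%:R * q ^+ N + (N.+1%:R * q ^+ N - q ^+ N) * q)) / (1 - q) ^+ 2).
  apply/funext => N; apply: (mulfI (expf_neq0 2 q1)).
  rewrite hsum_closed -/q [RHS]mulrC divfK ?expf_neq0//.
  rewrite -[in RHS]addn1 natrD exprS; move: (q ^+ N) => p; ring.
have hk : hker y = (q * (1 - q) - y * q) / (1 - q) ^+ 2 := hker_closed y0.
rewrite hk.
have -> : q * (1 - q) - y * q = q * (1 - 0) * (1 - q) - y * q * (1 - 0 + (0 - 0) * q) by ring.
have s1 := cvgcMr (cvgcMl (cvgcBl cq 1) q) (1 - q).
have s2 := cvgcMl (cvgcD (cvgcBl cn 1) (cvgcMr (cvgcB cn cq) q)) (y * q).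
exact: (cvgcMr (cvgcB s1 s2) ((1 - q) ^+ 2)^-1).
Qed.

(** In the sector |1 - n y| is at most (1 + 2 L) e^{n Re y / 2}, so a geometric series of ratio
    e^{-Re y / 2} dominates. Uniformity in N costs the singular factor 1 / Re y. *)
Lemma hsum_bound (L : R) (y : C) N : 0 <= L -> 0 < Re y ->
  normc y <= L * Re y ->
  normc (hsum N y) <= (1 + 2 * L) * 4 * (Re y)^-1 * expR (- (Re y / 4)).
Proof.
move=> L0; set a := Re y => a0 hL.
pose p := expR (- (a / 2)).
have p0 : 0 < p by exact: expR_gt0.
have p1 : p < 1 by rewrite /p -expR0 ltr_expR oppr_lt0 divr_gt0.
have term n : normc ((1 - n.+1%:R * y) * cexp (- (n.+1%:R * y))) <= (1 + 2 * L) * p ^+ n.+1.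
  set u := n.+1%:R * a.
  have u0 : 0 <= u by rewrite mulr_ge0 ?ler0n ?ltW.
  have Ru : Re (- (n.+1%:R * y)) = - u.
    by rewrite cReN -(rmorph_nat (real_complex R)) cReM /= mul0r subr0.
  rewrite normcM normc_cexp Ru.
  have h1 : normc (1 - n.+1%:R * y) <= 1 + L * u.
    apply: le_trans (le_normcB _ _) _; rewrite normc1 lerD2l normcM normc_nat.
    by rewrite /u mulrCA ler_wpM2l.
  have h2 : u <= 2 * expR (u / 2) by exact: lin_le_expR.
  have h3 : 1 <= expR (u / 2) by rewrite -expR0 ler_expR divr_ge0.
  have h4 : normc (1 - n.+1%:R * y) <= (1 + 2 * L) * expR (u / 2).
    apply: le_trans h1 _; have := ler_wpM2l L0 h2; lra.
  have -> : p ^+ n.+1 = expR (u / 2) * expR (- u).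
    by rewrite /p -expRM_natr -expRD; congr expR; rewrite /u; field.
  by rewrite mulrA ler_wpM2r// expR_ge0.
have S : \sum_(n < N) p ^+ n.+1 <= p / (1 - p).
  rewrite ler_pdivlMr ?subr_gt0//.
  suff -> : (\sum_(n < N) p ^+ n.+1) * (1 - p) = p - p ^+ N.+1.
    by rewrite gerBl exprn_ge0// ltW.
  elim: N => [|M IH]; first by rewrite big_ord0 mul0r expr1 subrr.
  by rewrite big_ord_recr /= mulrDl IH !exprS; ring.
apply: le_trans (ler_normc_sum _ _ _) _.
apply: (@le_trans _ _ ((1 + 2 * L) * (p / (1 - p)))).
  apply: (@le_trans _ _ (\sum_(n < N) (1 + 2 * L) * p ^+ n.+1)).
    by apply: ler_sum => n _; exact: term.
  by rewrite -mulr_sumr ler_wpM2l//; lra.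
rewrite -!mulrA ler_wpM2l//; first lra.
rewrite mulrA.
(* p / (1 - p) = exp (- a / 4) / (exp (a / 4) - exp (- a / 4)) *)
have e4 : p = expR (- (a / 4)) ^+ 2.
  by rewrite /p expr2 -expRD; congr expR; field.
have v0 : 0 < expR (- (a / 4)) by exact: expR_gt0.
have h5 : a / 4 * expR (- (a / 4)) <= 1 - p.
  have h6 := expR_ge1Dx (a / 4).
  have h7 : expR (a / 4) * expR (- (a / 4)) = 1 by rewrite -expRD subrr expR0.
  have h8 : expR (- (a / 4)) <= 1 by rewrite -expR0 ler_expR oppr_le0 divr_ge0// ltW.
  have := ler_wpM2r (ltW v0) h6; rewrite mulrDl mul1r h7 e4 expr2.
  have := ler_wpM2r (ltW v0) h8; lra.
rewrite ler_pdivrMr ?subr_gt0//.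
have h9 := ler_wpM2l _ h5.
have h10 : 0 <= 4 / a * expR (- (a / 4)) by rewrite !mulr_ge0 ?invr_ge0 ?(ltW a0) ?ltW.
apply: le_trans (h9 _ h10); rewrite e4 expr2 le_eqVlt; apply/orP; left; apply/eqP.
by field; rewrite gt_eqF.
Qed.

(** At y = ln x this reads x^p <= e^A e^{k x}. For p > 0 the constant A is the maximum of p y - k
    e^y, reached at y = ln (p / k). *)
Lemma lin_le_exp_log (p k : R) : 0 <= p -> 0 < k -> exists A : R,
  forall y, p * y <= A + k * expR y.
Proof.
rewrite le_eqVlt => /orP[/eqP <-|p0] k0.
  by exists 0 => y; rewrite mul0r add0r mulr_ge0 ?expR_ge0 ?ltW.
exists (- (p * (1 + ln (k / p)))) => y.
have h := expR_ge1Dx (y + ln (k / p)).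
have : expR (y + ln (k / p)) = expR y * (k / p) by rewrite expRD lnK// posrE divr_gt0.
move=> e; rewrite e in h.
have := ler_wpM2l (ltW p0) h.
have -> : p * (expR y * (k / p)) = k * expR y by field; rewrite gt_eqF.
lra.
Qed.

End KernelEstimates.

Arguments cvgcMl {R f a} fa c.
Arguments cvgcMr {R f a} fa c.
Arguments cvgcBl {R f a} fa c.
Arguments cvgcBr {R f a} fa c.
Arguments cvgcDr {R f a} fa c.
Arguments cvgc_cst {R} c _ _.

(** * Euler's integral *)

Section GammaIntegral.
Variable R : realType.
Local Notation C := (complex (Real.sort R)).
Local Notation mu := (@lebesgue_measure R).

Lemma Re_natC (n : nat) : Re (n%:R : C) = n%:R.
Proof. by rewrite -(rmorph_nat (real_complex R)). Qed.

Lemma Im_natC (n : nat) : Im (n%:R : C) = 0.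
Proof. by rewrite -(rmorph_nat (real_complex R)). Qed.

Lemma cintegral_FTC (F f df : R -> C) (a b : R) : a < b ->
  (forall x, a <= x <= b -> cderiv F x (f x)) ->
  (forall x, a <= x <= b -> cderiv f x (df x)) ->
  cintegral `[a, b] f = F b - F a.
Proof.
move=> ab hF hf.
have key (g h : R -> R) (dh : R -> R) :
    (forall x, a <= x <= b -> is_derive x (1 : R) g (h x)) ->
    (forall x, a <= x <= b -> is_derive x (1 : R) h (dh x)) ->
    \int[mu]_(x in `[a, b]) h x = g b - g a.
  move=> hg hh.
  have cg x : a <= x <= b -> {for x, continuous g}.
    by move=> /hg[/derivable1_diffP/differentiable_continuous].
  rewrite /Rintegral (@continuous_FTC2 _ h g a b ab) //=.
  - apply/continuous_in_subspaceT => x /[!inE] /=; rewrite in_itv => hx.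
    by have [/derivable1_diffP/differentiable_continuous] := hh x hx.
  - split.
    + move=> x; rewrite in_itv /= => /andP[ax xb].
      by have [] := hg x; rewrite ?(ltW ax) ?(ltW xb).
    + by apply: cvg_at_right_filter; apply: cg; rewrite lexx ltW.
    + by apply: cvg_at_left_filter; apply: cg; rewrite lexx ltW.
  - move=> x; rewrite in_itv /= => /andP[ax xb].
    by have [|dg eg] := hg x; rewrite ?(ltW ax) ?(ltW xb)// derive1E.
apply: eqcP; rewrite ?cReD ?cImD ?cReN ?cImN /=.
- apply: (key (fun x => Re (F x)) _ (fun x => Re (df x))) => x hx.
  + by have [] := hF x hx.
  + by have [] := hf x hx.
- apply: (key (fun x => Im (F x)) _ (fun x => Im (df x))) => x hx.
  + by have [] := hF x hx.
  + by have [] := hf x hx.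
Qed.

Lemma cderiv_under_integral (D : set R) (H H' : R -> R -> C) (t u v : R) (G : R -> R) :
  measurable D -> u < t < v ->
  (forall x, u < x < v -> cintegrable D (H x)) ->
  (forall x y, u < x < v -> D y -> cderiv (H ^~ y) x (H' x y)) ->
  mu.-integrable D (EFin \o G) -> (forall y, 0 <= G y) ->
  (forall x y, u < x < v -> D y -> normc (H' x y) <= G y) ->
  cderiv (fun x => cintegral D (H x)) t (cintegral D (H' t)).
Proof.
move=> mD tuv iH dH iG G0 HG.
have key (f f' : R -> R -> R) :
    (forall x, u < x < v -> mu.-integrable D (EFin \o f x)) ->
    (forall x y, u < x < v -> D y -> is_derive x (1 : R) (f ^~ y) (f' x y)) ->
    (forall x y, u < x < v -> D y -> `|f' x y| <= G y) ->
    is_derive t (1 : R) (fun x => \int[mu]_(y in D) f x y) (\int[mu]_(y in D) f' t y).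
  move=> fi fd fG.
  have It : `]u, v[%classic t by rewrite /= in_itv.
  have e1 x y : u < x < v -> D y -> partial1of2 f x y = f' x y.
    by move=> hx hy; have [_ <-] := fd x y hx hy; rewrite partial1of2E.
  have h1 x : `]u, v[%classic x -> mu.-integrable D (EFin \o f x).
    by rewrite /= in_itv /=; exact: fi.
  have h2 x y : `]u, v[%classic x -> D y -> derivable (f ^~ y) x 1.
    by rewrite /= in_itv /= => hx hy; have [] := fd x y hx hy.
  have h3 x y : `]u, v[%classic x -> D y -> `|partial1of2 f x y| <= G y.
    by rewrite /= in_itv /= => hx hy; rewrite e1//; exact: fG.
  have dd := derivable_under_integral (mu := mu) mD It h1 h2 G0 iG h3.
  apply: (DeriveDef dd).
  rewrite -derive1E (differentiation_under_integral (mu := mu) mD It h1 h2 G0 iG h3).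
  by apply: eq_Rintegral => y /set_mem hy; exact: e1.
split.
- apply: (key (fun x y => Re (H x y)) (fun x y => Re (H' x y))) => [x hx|x y hx hy|x y hx hy].
  + by have [] := iH x hx.
  + by have [] := dH x y hx hy.
  + exact: le_trans (le_Re_normc _) (HG x y hx hy).
- apply: (key (fun x y => Im (H x y)) (fun x y => Im (H' x y))) => [x hx|x y hx hy|x y hx hy].
  + by have [] := iH x hx.
  + by have [] := dH x y hx hy.
  + exact: le_trans (le_Im_normc _) (HG x y hx hy).
Qed.

Definition gint (s M : C) (x : R) : C := cexp ((s - 1) * (ln x)%:C - M * x%:C).

(** The integral of x^{s-1} e^{-M x}, whose expected value is Gamma(s) M^{-s}. *)
Definition gammaI (s M : C) : C := cintegral `]0, +oo[ (gint s M).

Lemma euler_integralE (s : C) : euler_integral s = gammaI s 1.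
Proof.
by rewrite /euler_integral; apply: eq_cintegral => x _; rewrite /gint mul1r.
Qed.

Lemma expR_ln_bound (P k : R) : 0 <= P -> 0 < k -> exists2 A : R, 0 < A &
  forall p x, 0 <= p <= P -> 0 < x -> expR (p * ln x) <= A * expR (k * x).
Proof.
move=> P0 k0; have [A hA] := lin_le_exp_log P0 k0.
exists (expR `|A|) => [|p x /andP[p0 pP] x0]; first exact: expR_gt0.
rewrite -expRD ler_expR.
have kx : 0 <= k * x by rewrite mulr_ge0 ?ltW.
have [l0|l0] := leP 0 (ln x).
- have h := hA (ln x); rewrite lnK// in h.
  have h1 := ler_wpM2r l0 pP; have h2 := ler_norm A; lra.
- have h : p * ln x <= 0 by rewrite mulr_ge0_le0// ltW.
  have := normr_ge0 A; lra.
Qed.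

Lemma normc_gint (s M : C) (x : R) :
  normc (gint s M x) = expR ((Re s - 1) * ln x - Re M * x).
Proof.
by rewrite /gint normc_cexp cReD cReN !cReM cReD cReN /= !mulr0 !subr0.
Qed.

Lemma gint_bound (P d : R) : 0 <= P -> 0 < d -> exists2 A : R, 0 < A &
  forall (s M : C) x, 1 <= Re s <= P + 1 -> d <= Re M -> 0 < x ->
    normc (gint s M x) <= A * expR (- (d / 2 * x)).
Proof.
move=> P0 d0; have d20 : 0 < d / 2 by rewrite divr_gt0.
have [A A0 hA] := expR_ln_bound P0 d20; exists A => // s M x /andP[s1 sP] dM x0.
rewrite normc_gint expRD.
have h : 0 <= Re s - 1 <= P by rewrite subr_ge0 s1 lerBlDr.
have := hA _ x h x0 => h1.
have h2 : expR (- (Re M * x)) <= expR (- (d * x)).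
  by rewrite ler_expR lerN2 ler_wpM2r// ltW.
apply: le_trans (ler_pM (expR_ge0 _) (expR_ge0 _) h1 h2) _.
rewrite -(mulrA A) -expRD; apply: ler_wpM2l; first exact: ltW.
by rewrite ler_expR; move: (x) => y; lra.
Qed.

Lemma cmeasurable_gint (s M : C) (D : set R) : cmeasurable D (gint s M).
Proof.
apply: (@cmeasurableS _ _ _ _ setT) => //.
apply: cmeasurable_cexp; apply: cmeasurableB; apply: cmeasurableM.
- exact: cmeasurable_cst.
- by apply: cmeasurable_real; exact: measurable_ln.
- exact: cmeasurable_cst.
- by apply: cmeasurable_real; exact: measurable_id.
Qed.

Lemma cintegrable_gint (s M : C) : 1 <= Re s -> 0 < Re M ->
  cintegrable `]0, +oo[ (gint s M).
Proof.
move=> s1 M0; have P0 : 0 <= Re s - 1 by rewrite subr_ge0.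
have [A A0 hA] := gint_bound P0 M0.
have M20 : 0 < Re M / 2 by rewrite divr_gt0.
apply: (@cintegrable_dominated _ _ _ (fun x => A * expR (- (Re M / 2 * x)))).
- exact: measurable_itv.
- exact: cmeasurable_gint.
- by apply: integrableZl_EFin; [exact: measurable_itv|exact: integrable_expRN_pos].
- move=> x /=; rewrite in_itv /= andbT => x0; apply: hA => //.
  by rewrite s1 subrK lexx.
Qed.

Lemma gintS (s M : C) (x : R) : 0 < x -> gint (s + 1) M x = x%:C * gint s M x.
Proof.
move=> x0; have {2}<- : expR (ln x) = x by rewrite lnK.
rewrite -cexp_real -cexpD /gint; congr (cexp _); ring.
Qed.

Lemma cderiv_gint (s M : C) (x : R) : 0 < x ->
  cderiv (gint (s + 1) M) x (s * gint s M x - M * gint (s + 1) M x).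
Proof.
move=> x0; rewrite /gint.
have h1 : cderiv (fun t => (ln t)%:C) x (x^-1)%:C by exact: (cderiv_real (is_derive1_ln x0)).
have h2 := cderivM (cderiv_cst (s + 1 - 1) x) h1.
have h3 := cderivN (cderivM (cderiv_cst M x) (cderiv_id x)).
have h4 := cderiv_cexp (cderivD h2 h3); rewrite /= in h4.
suff <- : (0 * (ln x)%:C + (s + 1 - 1) * (x^-1)%:C - (0 * x%:C + M * 1)) *
  cexp ((s + 1 - 1) * (ln x)%:C - M * x%:C) = s * gint s M x - M * gint (s + 1) M x by [].
have -> : s * gint s M x = s * (x^-1)%:C * gint (s + 1) M x.
  by rewrite gintS// mulrA -(mulrA s) -rmorphM /= mulVf ?rmorph1 ?mulr1// gt_eqF.
rewrite /gint; move: (cexp _) => E; move: (x^-1)%:C => y; ring.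
Qed.

(** The shift to n + 2 makes every interval nondegenerate, as the fundamental theorem of calculus
    will ask; |Re f| + |Im f| dominates. *)
Lemma cvgn_itv_pos (f : R -> C) : cintegrable `]0, +oo[ f ->
  cintegral `[n.+2%:R^-1, n.+2%:R] f @[n --> \oo] --> cintegral `]0, +oo[ f.
Proof.
move=> fi.
have sub (n : nat) : [set` `[n.+2%:R^-1, n.+2%:R : R]] `<=` [set` `]0 : R, +oo[].
  move=> x /=; rewrite !in_itv /= andbT => /andP[+ _]; apply: lt_le_trans.
  by rewrite invr_gt0.
under eq_fun do rewrite (cintegral_mkcond _ (sub _)).
have [fr fim] := fi.
have mD := measurable_itv `]0 : R, +oo[.
have ig : mu.-integrable `]0, +oo[
    (EFin \o (fun x => `|Re (f x)| + `|Im (f x)|)).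
  by apply: integrableD_EFin => //; exact: integrable_norm.
apply: (proj2 (cvg_cintegral (g := fun x => `|Re (f x)| + `|Im (f x)|)
  mD _ _ ig _)).
- move=> n; have [m1 m2] := cintegrable_measurable fi.
  have key (g : R -> R) : measurable_fun [set` `]0 : R, +oo[] g ->
      measurable_fun [set` `]0 : R, +oo[]
        (fun x => if x \in [set` `[n.+2%:R^-1, n.+2%:R]] then g x else 0).
    move=> mg; apply: measurable_fun_if => //.
    + apply: (@measurable_fun_bool _ _ _ _ true) => //=.
      rewrite (_ : _ @^-1` _ = [set` `[n.+2%:R^-1, n.+2%:R : R]]).
        by apply: measurableI.
      by apply/seteqP; split => y; [move/set_mem|move/mem_set].
    + by apply: measurable_funS mg => //; exact: subIsetl.
  split.
  + by apply: eq_measurable_fun (key _ m1) => x _; case: ifP.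
  + by apply: eq_measurable_fun (key _ m2) => x _; case: ifP.
- move=> x /=; rewrite in_itv /= andbT => x0.
  apply/cvgcP => e e0.
  have [N _ hN] : \forall n \near \oo, x^-1 + x <= n%:R by exact: nbhs_infty_ger.
  exists N => // n /= /hN h.
  have x10 : 0 < x^-1 by rewrite invr_gt0.
  have nn : (n%:R : R) <= n.+2%:R by rewrite ler_nat leqW.
  rewrite ifT ?subrr ?normc0//; rewrite inE /= in_itv /=; apply/andP; split; last by lra.
  by rewrite -(invrK x) lef_pV2 ?posrE//; lra.
- move=> n x _; case: ifP => _; first exact: normc_le.
  by rewrite normc0 addr_ge0.
Qed.

(** Integration by parts: the difference of the two integrands is the derivative of x^s e^{-M x},
    which vanishes at both ends. *)
Lemma gammaI_parts (s M : C) : 1 <= Re s -> 0 < Re M ->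
  s * gammaI s M = M * gammaI (s + 1) M.
Proof.
move=> s1 M0.
have s2 : 1 <= Re (s + 1) by rewrite cReD /=; lra.
have mD := measurable_itv `]0 : R, +oo[.
have i1 := cintegrableZ s mD (cintegrable_gint s1 M0).
have i2 := cintegrableZ M mD (cintegrable_gint s2 M0).
have i3 := cintegrableB mD i1 i2.
apply/eqP; rewrite -subr_eq0; apply/eqP.
rewrite /gammaI -(cintegralZ s mD (cintegrable_gint s1 M0)).
rewrite -(cintegralZ M mD (cintegrable_gint s2 M0)) -(cintegralB mD i1 i2).
apply: (cvgc_unique (cvgn_itv_pos i3)).
have p0 : 0 <= Re s by lra.
have P0 : 0 <= Re s + 1 by lra.
have [A A0 hA] := expR_ln_bound P0 M0.
have p1 : 0 <= Re s + 1 <= Re s + 1 by rewrite P0 lexx.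
have E n : cintegral `[n.+2%:R^-1, n.+2%:R]
    (fun x => s * gint s M x - M * gint (s + 1) M x) =
    gint (s + 1) M n.+2%:R - gint (s + 1) M n.+2%:R^-1.
  (* The function supplied is the derivative of the integrand; it serves to certify that the
     integrand is continuous. *)
  apply: (@cintegral_FTC _ _ (fun x => s * ((s - 1) * gint (s - 1) M x - M * gint s M x)
     - M * (s * gint s M x - M * gint (s + 1) M x))).
  - by apply: (@lt_trans _ _ 1); [rewrite invf_lt1// ltr1n|rewrite ltr1n].
  - move=> x /andP[hx _]; apply: cderiv_gint; apply: lt_le_trans hx.
    by rewrite invr_gt0.
  - move=> x /andP[hx _].
    have x0 : 0 < x by apply: lt_le_trans hx; rewrite invr_gt0.
    have h1 : cderiv (gint s M) x ((s - 1) * gint (s - 1) M x - M * gint s M x).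
      by have := @cderiv_gint (s - 1) M x x0; rewrite subrK.
    have h2 := cderivM (cderiv_cst s x) h1.
    have h3 := cderivM (cderiv_cst M x) (@cderiv_gint s M x x0).
    have h4 := cderivD h2 (cderivN h3); rewrite /= !mul0r !add0r in h4.
    exact: h4.
under eq_fun do rewrite E.
apply/cvgc_normc0.
(* The right end contributes at most A / (n + 2), since x^{Re s + 1} <= A e^{Re M x}; the left end
   at most 1 / (n + 2), since Re s >= 1. *)
have c0 : (A + 1) * n.+2%:R^-1 @[n --> \oo] --> (0 : R).
  rewrite -[X in _ --> X](mulr0 (A + 1)); apply: cvgMr.
  have := @cvg_harmonic R; rewrite -(cvg_shiftn 1) => h.
  rewrite (_ : (fun n => _) = (fun n => [sequence harmonic (n + 1)%N]_n n))//.
  by apply/funext => n /=; rewrite addn1.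
apply: (squeeze_cvgr _ (cvg_cst 0) c0); apply: nearW => n.
rewrite normc_ge0 /= subr0; apply: le_trans (le_normcB _ _) _.
have n0 : 0 < n.+2%:R :> R by [].
rewrite mulrDl mul1r; apply: lerD.
- rewrite normc_gint cReD /= addrK (ler_pdivlMr _ _ n0).
  have {3}<- : expR (ln n.+2%:R) = n.+2%:R :> R by rewrite lnK.
  rewrite -expRD.
  have := hA _ _ p1 n0; rewrite -ler_pdivrMr ?expR_gt0// -expRN -expRD.
  by apply: le_trans; rewrite ler_expR; move: (ln _) => y; lra.
- rewrite normc_gint cReD /= addrK.
  have {3}<- : expR (ln n.+2%:R^-1) = n.+2%:R^-1 :> R by rewrite lnK// posrE invr_gt0.
  rewrite ler_expR.
  have h : ln (n.+2%:R^-1 : R) <= 0 by rewrite ln_le0// invf_le1// ler1n.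
  have h2 : 0 <= Re M * n.+2%:R^-1 by rewrite mulr_ge0// ?ltW// invr_ge0.
  have : (Re s - 1) * ln (n.+2%:R^-1 : R) <= 0 by rewrite mulr_ge0_le0// subr_ge0.
  rewrite mulrBl mul1r => h3; move: h2 h3; move: (Re M / _) => z h2 h3.
  lra.
Qed.

Lemma cexp_clog (M : C) : 0 < Re M -> cexp (clog M) = M.
Proof.
move=> a0; have M0 : M != 0 by apply: contraTneq a0 => ->; rewrite ltxx.
rewrite /clog Re_normr /cexp /= lnK ?posrE ?normc_gt0//.
case: M a0 M0 => a b /= a0 _.
have c0 : 0 < cos (atan (b / a)).
  by apply: cos_gt0_pihalf; rewrite atan_gtNpi2 atan_ltpi2.
have ht : sin (atan (b / a)) = b / a * cos (atan (b / a)).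
  by have := atanK (b / a); rewrite /tan => /(canRL (divfK (lt0r_neq0 c0))).
have hn : normc (a +i* b) * cos (atan (b / a)) = a.
  apply/eqP; rewrite -(@eqrXn2 _ 2) ?mulr_ge0 ?normc_ge0 ?(ltW c0) ?(ltW a0)//.
  rewrite exprMn normc_sqr /=; have := cos2Dsin2 (atan (b / a)); rewrite ht.
  move: (cos _) => c hc; apply/eqP.
  have {}hc : c ^+ 2 * (a ^+ 2 + b ^+ 2) = a ^+ 2.
    rewrite -[RHS]mulr1 -hc; field; exact: lt0r_neq0.
  by rewrite mulrC hc.
apply: eqcP; rewrite /= !mul0r ?subr0 ?addr0//.
by rewrite ht mulrCA hn divfK// gt_eqF.
Qed.

(** The path M^t from 1 to M has argument t arg M, so it never leaves the right half-plane. *)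
Lemma Re_cexp_clog_gt0 (M : C) (t : R) : 0 < Re M -> 0 <= t <= 1 ->
  0 < Re (cexp (t%:C * clog M)).
Proof.
move=> M0 /andP[t0 t1]; rewrite Re_cexp mulr_gt0 ?expR_gt0//.
rewrite cImM /= mul0r addr0; set y := atan _.
have y1 : - (pi / 2) < y := atan_gtNpi2 _.
have y2 : y < pi / 2 := atan_ltpi2 _.
have p0 : 0 < pi / 2 :> R by rewrite divr_gt0 ?pi_gt0.
apply: cos_gt0_pihalf; apply/andP; split; last by nra.
have : t * - y < pi / 2 by nra.
lra.
Qed.

(** The function t |-> M^{ts} times the integral with parameter M^t has zero derivative on [0, 1] by
    [gammaI_parts]; its values at t = 1 and t = 0 are the two sides. *)
Lemma gammaI_rotation (s M : C) : 1 <= Re s -> 0 < Re M ->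
  cexp (s * clog M) * gammaI s M = gammaI s 1.
Proof.
move=> s1 M0; set l := clog M.
have s2 : 1 <= Re (s + 1) by rewrite cReD /=; lra.
have mD := measurable_itv `]0 : R, +oo[.
pose A t : C := t%:C * (s * l).
pose N t : C := cexp (t%:C * l).
pose H t x : C := cexp (A t) * gint s (N t) x.
pose H' t x : C := l * cexp (A t) * (s * gint s (N t) x - N t * gint (s + 1) (N t) x).
have dA t : cderiv A t (s * l) by exact: cderiv_scale.
have dN t : cderiv N t (l * N t) by exact: cderiv_cexp (cderiv_scale l t).
have dH t x : 0 < x -> cderiv (H ^~ x) t (H' t x).
  move=> x0.
  have h1 := cderiv_cexp (cderivD (cderiv_cst ((s - 1) * (ln x)%:C) t)
     (cderivN (cderivM (dN t) (cderiv_cst x%:C t)))).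
  have h2 := cderivM (cderiv_cexp (dA t)) h1; rewrite /= in h2.
  suff <- : s * l * cexp (A t) * cexp ((s - 1) * (ln x)%:C - N t * x%:C) +
       cexp (A t) * ((0 - (l * N t * x%:C + N t * 0)) *
        cexp ((s - 1) * (ln x)%:C - N t * x%:C)) = H' t x by [].
  rewrite /H' gintS// /gint; move: (cexp (A t)) (N t) => u v; move: (cexp _) => w; ring.
have H'0 t : 0 < Re (N t) -> cintegral `]0, +oo[ (H' t) = 0.
  move=> N0.
  have i1 := cintegrableZ s mD (cintegrable_gint s1 N0).
  have i2 := cintegrableZ (N t) mD (cintegrable_gint s2 N0).
  rewrite (cintegralZ _ mD (cintegrableB mD i1 i2)) (cintegralB mD i1 i2).
  rewrite (cintegralZ s mD (cintegrable_gint s1 N0)).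
  rewrite (cintegralZ (N t) mD (cintegrable_gint s2 N0)).
  by rewrite (gammaI_parts s1 N0) subrr mulr0.
have dI t : 0 <= t <= 1 -> cderiv (fun x => cintegral `]0, +oo[ (H x)) t 0.
  move=> t01; have N0 : 0 < Re (N t) by exact: Re_cexp_clog_gt0.
  rewrite -(H'0 t N0); set d := Re (N t) / 2.
  have d0 : 0 < d by rewrite divr_gt0.
  (* Near t the real part of M^x stays above d, which gives one integrable majorant for the
     derivative. As e <= 1 there, |x| <= 2; hence the factors 2 below. *)
  have [e e0 he] : exists2 e, 0 < e <= 1 & forall x, t - e < x < t + e ->
      d <= Re (N x).
    have [c1 _] := cderiv_continuous (dN t).
    have dN0 : d < Re (N t) by rewrite /d; lra.
    have /nbhs_ballP[e /= e0 he] : \forall x \near t, d < Re (N x).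
      exact: (@cvgr_gt _ _ _ _ _ _ c1 _ dN0).
    exists (Num.min e 1); first by rewrite lt_min e0 ltr01 ge_min lexx orbT.
    move=> x /andP[x1 x2]; apply/ltW/he; rewrite /ball /= ltr_norml.
    have := ge_min e e 1; have : Num.min e 1 <= e by rewrite ge_min lexx.
    by move: (Num.min e 1) x1 x2 => m x1 x2 hm _; apply/andP; split; lra.
  have /andP[e00 e1] := e0.
  have P0 : 0 <= Re s by lra.
  have [K K0 hK] := gint_bound P0 d0.
  pose B := expR (2 * `|Re (s * l)|).
  pose B2 := normc l * B * (normc s * K + expR (2 * `|Re l|) * K).
  have K00 := ltW K0.
  have B20 : 0 <= B2.
    by rewrite !mulr_ge0 ?addr_ge0 ?mulr_ge0 ?normc_ge0 ?expR_ge0.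
  have hexp (z : C) x : t - e < x < t + e -> normc (cexp (x%:C * z)) <=
      expR (2 * `|Re z|).
    move=> /andP[x1 x2]; rewrite normc_cexp cReM /= mul0r subr0 ler_expR.
    apply: le_trans (ler_norm _) _; rewrite normrM ler_wpM2r// ler_norml.
    by move/andP: t01 => [t0 t1]; apply/andP; split; lra.
  apply: (@cderiv_under_integral _ H H' t (t - e) (t + e)
    (fun x => B2 * expR (- (d / 2 * x)))) => //.
  - by apply/andP; split; lra.
  - move=> x hx; apply: cintegrableZ => //; apply: cintegrable_gint => //.
    exact: lt_le_trans d0 (he x hx).
  - by move=> x y _; rewrite /= in_itv /= andbT; exact: dH.
  - apply: integrableZl_EFin => //; apply: integrable_expRN_pos.
    by rewrite divr_gt0.
  - by move=> y; rewrite mulr_ge0 ?expR_ge0.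
  - move=> x y hx; rewrite /= in_itv /= andbT => y0.
    have g1 : 1 <= Re s <= Re s + 1 by rewrite s1 /=; lra.
    have g2 : 1 <= Re (s + 1) <= Re s + 1.
      by rewrite s2 cReD /= lexx.
    have k1 := hK s (N x) y g1 (he x hx) y0.
    have k2 := hK (s + 1) (N x) y g2 (he x hx) y0.
    rewrite /H' normcM (normcM l) /B2 -mulrA -[leRHS]mulrA -[leRHS]mulrA.
    apply: ler_wpM2l; first exact: normc_ge0.
    apply: ler_pM; rewrite ?normc_ge0//; first exact: hexp.
    apply: le_trans (le_normcB _ _) _; rewrite (normcM s) (normcM (N x)) mulrDl -(mulrA (normc s)) -(mulrA (expR (2 * _))).
    apply: lerD; first by apply: ler_wpM2l => //; exact: normc_ge0.
    by apply: ler_pM => //; rewrite ?normc_ge0//; exact: hexp.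
have HE t : 0 <= t <= 1 -> cintegral `]0, +oo[ (H t) = cexp (A t) * gammaI s (N t).
  move=> t01; have N0 : 0 < Re (N t) by exact: Re_cexp_clog_gt0.
  by rewrite (cintegralZ _ mD (cintegrable_gint s1 N0)).
have := mean_value_normc ler01 dI (fun _ _ => lexx _).
rewrite normc0 mul0r !HE ?lexx ?ler01// /A /N !mul0r !mul1r cexp0 mul1r cexp_clog//.
move=> h; apply/eqP; rewrite -subr_eq0 -normc_eq0; apply/eqP/le_anti.
by rewrite h normc_ge0.
Qed.

Lemma cGammaE (s : C) : 0 < Re s -> cGamma s = gammaI s 1.
Proof. by move=> s0; rewrite /cGamma s0 addr0 /rising big_ord0 divr1 euler_integralE. Qed.

Lemma gammaI_rising (s : C) l : 1 <= Re s ->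
  gammaI (s + l%:R) 1 = rising s l * gammaI s 1.
Proof.
move=> s1; elim: l => [|l IHl]; first by rewrite addr0 /rising big_ord0 mul1r.
have h : 1 <= Re (s + l%:R).
  by rewrite cReD Re_natC; apply: (le_trans s1); rewrite lerDl.
rewrite /rising big_ord_recr /= -/(rising s l) mulrAC -IHl mulrC gammaI_parts ?mul1r//.
  by rewrite -addrA -[in LHS]addn1 natrD.
Qed.

Lemma gammaI_cpow (s M : C) l : 1 <= Re s -> 0 < Re M ->
  gammaI (s + l%:R) M = rising s l * cGamma s * cpow M (- (s + l%:R)).
Proof.
move=> s1 M0; rewrite cGammaE; last exact: lt_le_trans s1.
rewrite -gammaI_rising//.
have h : 1 <= Re (s + l%:R).
  by rewrite cReD Re_natC; apply: (le_trans s1); rewrite lerDl.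
rewrite -(gammaI_rotation h M0) /cpow mulNr cexpN mulrAC divff ?mul1r//.
exact: cexp_neq0.
Qed.

Lemma gammaI_cvg (s : nat -> C) (s0 : C) (P : R) :
  (forall n, 1 <= Re (s n) <= P) ->
  s n @[n --> \oo] --> s0 -> gammaI (s n) 1 @[n --> \oo] --> gammaI s0 1.
Proof.
move=> sP cs.
have P0 : 0 <= P - 1 by have /andP[h1 h2] := sP 0%N; lra.
have [A A0 hA] := gint_bound P0 ltr01.
have mD := measurable_itv `]0 : R, +oo[.
apply: (proj2 (cvg_cintegral (g := fun x => A * expR (- (1 / 2 * x))) mD _ _ _ _)).
- by move=> n; exact: cmeasurable_gint.
- move=> x _; rewrite /gint.
  have h := cvgcBr (cvgcMr (cvgcBr cs 1) (ln x)%:C) (1 * x%:C).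
  exact: (continuous_cvg _ (differentiable_continuous (differentiable_cexp _)) h).
- by apply: integrableZl_EFin => //; exact: integrable_expRN_pos.
- move=> n x; rewrite /= in_itv /= andbT => x0; apply: hA => //.
  by rewrite subrK.
Qed.

(** At a real argument the integrand is positive, and at least e^{-2} on [1, 2]. *)
Lemma gammaI_neq0 (x : R) : 1 <= x -> gammaI x%:C 1 != 0.
Proof.
move=> x1; suff : 0 < Re (gammaI x%:C 1).
  by apply: contraTneq => ->; rewrite ltxx.
have [ri _] : cintegrable `]0, +oo[ (gint x%:C 1).
  by apply: cintegrable_gint => //; exact: ltr01.
have rE y : Re (gint x%:C 1 y) = expR ((x - 1) * ln y - y).
  rewrite /gint mul1r -(rmorph1 (real_complex R)) -rmorphB -rmorphM -rmorphB.
  by rewrite cexp_real.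
rewrite /gammaI /cintegral /=.
rewrite (@eq_Rintegral _ _ _ mu _ (fun y => expR ((x - 1) * ln y - y))); last by move=> y _; exact: rE.
apply: (@lt_le_trans _ _ (\int[mu]_(y in `[1, 2]) expR (- 2))).
  by rewrite Rintegral_cst_itv ?mulr_gt0 ?expR_gt0 ?subr_gt0 ?ltr1n// ler1n.
have i0 : mu.-integrable `]0, +oo[ (EFin \o (fun y => expR ((x - 1) * ln y - y))).
  have -> : (fun y => expR ((x - 1) * ln y - y)) = (fun y => Re (gint x%:C 1 y)).
    by apply/funext => y; rewrite rE.
  exact: ri.
have i1 : mu.-integrable `[1, 2] (EFin \o (fun y => expR ((x - 1) * ln y - y))).
  apply: integrableS i0 => // y; rewrite /= !in_itv /= andbT => /andP[+ _].
  exact: lt_le_trans.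
apply: (@le_trans _ _ (\int[mu]_(y in `[1, 2]) expR ((x - 1) * ln y - y))).
  apply: le_Rintegral => //; first exact: integrable_cst_itv.
  move=> y; rewrite /= in_itv /= => /andP[y1 y2]; rewrite ler_expR.
  have : 0 <= (x - 1) * ln y by rewrite mulr_ge0 ?subr_ge0 ?ln_ge0.
  lra.
rewrite -lee_fin /Rintegral !fineK; try exact: integrable_fin_num.
apply: ge0_subset_integral => //.
- by have /measurable_int := i0.
- move=> y; rewrite /= !in_itv /= andbT => /andP[+ _]; exact: lt_le_trans.
Qed.

(** Zeros accumulating at x would contradict [gammaI_neq0] by continuity. A zero-free disc is what
    division by the Gamma factors on an open set requires. *)
Lemma cGamma_neq0_near (x : R) : 1 < x -> exists2 e : R, 0 < e &
  forall s : C, normc (s - x%:C) < e -> cGamma s != 0.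
Proof.
move=> x1; apply: contrapT => h.
pose e n : R := Num.min (x - 1) n.+1%:R^-1.
have e0 n : 0 < e n by rewrite lt_min subr_gt0 x1 invr_gt0 ltr0Sn.
have hs n : exists s : C, normc (s - x%:C) < e n /\ cGamma s = 0.
  apply: contrapT => h2; apply: h; exists (e n) => // s hs; apply/eqP => s0.
  by apply: h2; exists s.
have [s {}hs] := choice hs.
have hRe n : 1 <= Re (s n) <= x + (x - 1).
  have [h1 _] := hs n; have := le_Re_normc (s n - x%:C).
  rewrite cReD cReN /= => h2; have := le_lt_trans h2 h1.
  rewrite /e lt_min => /andP[+ _]; rewrite ltr_norml => /andP[]; lra.
have cs : s n @[n --> \oo] --> x%:C.
  apply/cvgcP => d d0; have [N _ hN] : \forall n \near \oo, d^-1 <= n%:R by exact: nbhs_infty_ger.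
  exists N => // n /= /hN hn; have [h1 _] := hs n; apply: (lt_le_trans h1).
  rewrite /e ge_min; apply/orP; right; rewrite -(invrK d) lef_pV2 ?posrE ?invr_gt0//.
  by apply: (le_trans hn); rewrite ler_nat.
have := gammaI_cvg hRe cs.
have -> : (fun n => gammaI (s n) 1) = (fun=> 0).
  apply/funext => n; have [_ <-] := hs n; rewrite cGammaE//.
  have /andP[h3 _] := hRe n; exact: lt_le_trans h3.
move=> h2; have := gammaI_neq0 (ltW x1).
by rewrite (cvgc_unique h2 (cvgc_cst 0)) eqxx.
Qed.

End GammaIntegral.

(** * Specialization of the generating identity *)

Section FractionEvaluation.
Variables (A : idomainType) (K : fieldType) (phi : {rmorphism A -> K}).

(** Evaluation of fractions is partial, hence a relation: some representation of x has a denominator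
    that does not vanish under [phi]. *)
Definition fraction_value (x : {fraction A}) (z : K) :=
  exists p q : A, [/\ x = tofrac p / tofrac q, phi q != 0 & z = phi p / phi q].

Let tofrac_neq0 (q : A) : phi q != 0 -> tofrac q != 0.
Proof. by apply: contraNneq => /eqP; rewrite tofrac_eq0 => /eqP ->; rewrite rmorph0. Qed.

Lemma fraction_value_unique x z z' : fraction_value x z -> fraction_value x z' -> z = z'.
Proof.
move=> [p [q [-> q0 ->]]] [p' [q' [+ q'0 ->]]].
move=> /eqP; rewrite eqr_div ?tofrac_neq0// -!tofracM tofrac_eq => /eqP h.
by apply/eqP; rewrite eqr_div// -!rmorphM h.
Qed.

Lemma fraction_value_tofrac p : fraction_value (tofrac p) (phi p).
Proof. by exists p, 1; rewrite rmorph1 rmorph1 !divr1 oner_neq0. Qed.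

Lemma fraction_value_int (m : int) : fraction_value m%:~R m%:~R.
Proof. by have := fraction_value_tofrac m%:~R; rewrite !rmorph_int. Qed.

Lemma fraction_valueM x y z w : fraction_value x z -> fraction_value y w ->
  fraction_value (x * y) (z * w).
Proof.
move=> [p [q [-> q0 ->]]] [p' [q' [-> q'0 ->]]]; exists (p * p'), (q * q').
by rewrite !tofracM !rmorphM mulf_neq0// !mulf_div.
Qed.

Lemma fraction_valueD x y z w : fraction_value x z -> fraction_value y w ->
  fraction_value (x + y) (z + w).
Proof.
move=> [p [q [-> q0 ->]]] [p' [q' [-> q'0 ->]]]; exists (p * q' + p' * q), (q * q').
rewrite !addf_div ?tofrac_neq0// tofracD !tofracM rmorphD !rmorphM mulf_neq0//.
Qed.

Lemma fraction_valueN x z : fraction_value x z -> fraction_value (- x) (- z).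
Proof.
move=> h; rewrite -mulN1r -[- z]mulN1r; apply: fraction_valueM => //.
by have := fraction_value_int (-1); rewrite !rmorphN1.
Qed.

Lemma fraction_valueB x y z w : fraction_value x z -> fraction_value y w ->
  fraction_value (x - y) (z - w).
Proof. by move=> h /fraction_valueN; exact: fraction_valueD. Qed.

Lemma fraction_valueV x z : z != 0 -> fraction_value x z -> fraction_value x^-1 z^-1.
Proof.
move=> + [p [q [-> q0 ez]]]; rewrite ez mulf_eq0 invr_eq0 negb_or => /andP[p0 _].
by exists q, p; rewrite !invf_div.
Qed.

Lemma fraction_value_sum (I : Type) (s : seq I) (P : pred I) (x : I -> {fraction A}) (z : I -> K) :
  (forall i, fraction_value (x i) (z i)) ->
  fraction_value (\sum_(i <- s | P i) x i) (\sum_(i <- s | P i) z i).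
Proof.
move=> h; elim/big_rec2: _ => [|i y1 y2 _ hy]; last exact: fraction_valueD.
by have := fraction_value_int 0.
Qed.

Lemma fraction_value_prod (I : Type) (s : seq I) (P : pred I) (x : I -> {fraction A}) (z : I -> K) :
  (forall i, fraction_value (x i) (z i)) ->
  fraction_value (\prod_(i <- s | P i) x i) (\prod_(i <- s | P i) z i).
Proof.
move=> h; elim/big_rec2: _ => [|i y1 y2 _ hy]; last exact: fraction_valueM.
by have := fraction_value_int 1.
Qed.

Lemma fraction_valueX x z n : fraction_value x z -> fraction_value (x ^+ n) (z ^+ n).
Proof.
move=> h; elim: n => [|n IHn]; first by have := fraction_value_int 1.
by rewrite !exprS; exact: fraction_valueM.
Qed.

Lemma fraction_valueXz x z (m : int) : z != 0 -> fraction_value x z ->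
  fraction_value (x ^ m) (z ^ m).
Proof.
move=> z0 h; case: m => n; first exact: fraction_valueX.
by apply: fraction_valueV; [exact: expf_neq0|exact: fraction_valueX].
Qed.

End FractionEvaluation.

Section DesingCoefEvaluation.
Variables (r : nat) (K : fieldType).

(** Both sides of the generating identity have a value at (u, v), the only inverted elements being
    the v_j; equal fractions have equal values. *)
Lemma desing_coef_eval
    (a : {fsfun ({ffun 'I_r -> nat} * {ffun 'I_r -> int})%type -> int with 0})
    (u v : 'I_r -> K) : (forall j, v j != 0) -> desing_coef a ->
  \prod_(j < r) (1 - (\sum_(k < r | (j <= k)%N) u k * v k)
                     * ((v j)^-1 - \sum_(k < r | k.+1 == j :> nat) (v k)^-1))
  = \sum_(lm <- finsupp a)
      (a lm)%:~R * \prod_(j < r) (u j ^+ lm.1 j * v j ^ lm.2 j).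
Proof.
move=> v0 [_ ha].
pose ev (i : 'I_(r + r)) := match fintype.split i with inl j => u j | inr j => v j end.
pose phi : {rmorphism mpoly.mpoly (r + r) int -> K} := mpoly.mmap intr ev.
have hX i : fraction_value phi (indet i) (ev i).
  have := fraction_value_tofrac phi (mpoly.mpolyX int (mpoly.mnm1 i)).
  by rewrite /phi /= mpoly.mmapX mpoly.mmap1U.
have hu j : fraction_value phi (uvar j) (u j).
  by have := hX (lshift r j); rewrite /ev (unsplitK (inl j)).
have hv j : fraction_value phi (vvar j) (v j).
  by have := hX (rshift r j); rewrite /ev (unsplitK (inr j)).
have hV j := fraction_valueV (v0 j) (hv j).
have L := @fraction_value_prod _ _ phi _ (index_enum 'I_r) xpredT _ _ (fun j => fraction_valueB
  (fraction_value_int phi 1) (fraction_valueM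
    (fraction_value_sum (index_enum 'I_r) (fun k => (j <= k)%N) (fun k => fraction_valueM (hu k) (hv k)))
    (fraction_valueB (hV j) (fraction_value_sum (index_enum 'I_r) (fun k : 'I_r => k.+1 == j :> nat) hV)))).
have R := @fraction_value_sum _ _ phi _ (finsupp a) xpredT _ _ (fun lm => fraction_valueM
   (fraction_value_int phi (a lm)) (fraction_value_prod (index_enum 'I_r) xpredT (fun j =>
   fraction_valueM (fraction_valueX (lm.1 j) (hu j)) (fraction_valueXz (lm.2 j) (v0 j) (hv j))))).
move: R; rewrite -ha => R.
exact: (fraction_value_unique L R).
Qed.

Lemma desing_coef_identity
    (a : {fsfun ({ffun 'I_r -> nat} * {ffun 'I_r -> int})%type -> int with 0})
    (t M : 'I_r -> K) : (forall j, M j != 0) -> desing_coef a ->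
  \prod_(j < r) (1 - (\sum_(k < r | (j <= k)%N) t k)
                     * (M j - \sum_(k < r | k.+1 == j :> nat) M k))
  = \sum_(lm <- finsupp a)
      (a lm)%:~R * \prod_(j < r) (t j ^+ lm.1 j * (M j ^+ lm.1 j * M j ^ (- lm.2 j))).
Proof.
move=> M0 ha.
have v0 j : (M j)^-1 != 0 by rewrite invr_eq0.
have h := desing_coef_eval (fun j => t j * M j) v0 ha.
transitivity (\sum_(lm <- finsupp a) (a lm)%:~R *
    \prod_(j < r) ((t j * M j) ^+ lm.1 j * (M j)^-1 ^ lm.2 j)).
  rewrite -h; apply: eq_bigr => j _; congr (1 - _ * (_ - _)).
  - by apply: eq_bigr => k _; rewrite mulfK.
  - by rewrite invrK.
  - by apply: eq_bigr => k _; rewrite invrK.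
apply: eq_bigr => lm _; congr (_ * _); apply: eq_bigr => j _.
by rewrite exprMn mulrA exprz_inv.
Qed.

End DesingCoefEvaluation.

(** * Termwise integration *)

Section HomogeneousFunctionals.
Variable R : realType.
Local Notation C := (complex (Real.sort R)).
Local Notation mu := (@lebesgue_measure R).

(** The proportionality is required only on the contour, and the domination of [phi] makes the
    integrals converge. This serves to pull (-1)^r / (c - 1)^r out of the iterated integral. *)
Definition homogeneous_functional (dl : R) (S : set C) (I : (C -> C) -> C) :=
  forall (phi psi : C -> C) (a : C) B, fmeasurable phi ->
    (forall w, S w -> normc (phi w) <= B * weight dl w) ->
    (forall w, S w -> psi w = a * phi w) -> I psi = a * I phi.

Lemma iterI_homogeneous dl H S I : measurable_functional I -> bounded_functional dl H S I ->
  homogeneous_functional dl S I ->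
  forall n (f g : 'rV[C]_n -> C) (a : C) B, vmeasurable f ->
  (forall w, on_contour S w -> normc (f w) <= B * \prod_k weight dl (w 0 k)) ->
  (forall w, on_contour S w -> g w = a * f w) ->
  iterI I g = a * iterI I f.
Proof.
move=> mI bI hI; elim=> [|n IH] f g a B mf bf gf /=; first by apply: gf => -[].
apply: (hI _ _ a (B * H ^+ n)); first exact: fmeasurable_iterI.
- move=> w0 S0; rewrite mulrAC.
  apply: (iterI_bound mI bI); first exact: vmeasurable_row_mx.
  move=> w Sw; rewrite -mulrA -prod_row_mx; apply: bf; exact: on_contour_row_mx.
- move=> w0 S0; apply: (IH _ _ a (B * weight dl w0)); first exact: vmeasurable_row_mx.
    move=> w Sw; rewrite -mulrA -prod_row_mx; apply: bf; exact: on_contour_row_mx.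
  by move=> w Sw; apply: gf; exact: on_contour_row_mx.
Qed.

Lemma homogeneous_hankel dl (e : R) : 0 < dl -> 0 < e ->
  homogeneous_functional dl (hankel_set e) (hankel e).
Proof.
move=> dl0 e0 phi psi a B mphi hB hpsi.
have B0 : 0 <= B.
  have h : hankel_set e (ln e +i* 0) by left; exists e => //; left.
  by have := le_trans (normc_ge0 _) (hB _ h); rewrite pmulr_lge0// expR_gt0.
have ray y : y = 0 \/ y = 2 * pi ->
    cintegral `[e, +oo[ (fun x => psi (ln x +i* y)) =
    a * cintegral `[e, +oo[ (fun x => phi (ln x +i* y)).
  move=> hy.
  have hS x : `[e, +oo[%classic x -> hankel_set e (ln x +i* y).
    by rewrite /= in_itv /= andbT => ex; left; exists x => //; case: hy => ->; [left|right].
  have ie : mu.-integrable `[e, +oo[ (EFin \o (fun x => B * expR (- (dl * x)))).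
    apply: integrableZl_EFin => //; apply: integrableS (integrable_expRN dl0) => //.
    by move=> x /=; rewrite !in_itv /= !andbT; apply: le_trans; exact: ltW.
  rewrite -cintegralZ//.
    by apply: eq_cintegral => x hx; apply: hpsi; exact: hS.
  apply: (cintegrable_dominated _ _ ie) => //; first exact: fmeasurable_line.
  move=> x hx; have := hB _ (hS _ hx); rewrite /weight normc_cexp_ln//.
  by move: hx; rewrite /= in_itv /= andbT; exact: lt_le_trans.
have circ : cintegral `[0, 2 * pi]
      (fun th => psi (ln e +i* th) * ((0 +i* e) * cexp (0 +i* th))) =
    a * cintegral `[0, 2 * pi]
      (fun th => phi (ln e +i* th) * ((0 +i* e) * cexp (0 +i* th))).
  have hS th : `[0, 2 * pi]%classic th -> hankel_set e (ln e +i* th).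
    by rewrite /= in_itv /= => hth; right; exists th.
  rewrite -cintegralZ//.
    by apply: eq_cintegral => th hth; rewrite (hpsi _ (hS _ hth)) -(mulrA a).
  apply: (cintegrable_dominated _ _ (@integrable_cst_itv _ 0 (2 * pi) (B * e))) => //.
    apply: cmeasurableM; apply: (@cmeasurableS _ _ _ _ setT) => //.
      exact: mphi (cmeasurable_circle e).
    exact: cmeasurable_circle_jac.
  move=> th hth; rewrite normcM normc_circle_jac// ler_wpM2r ?(ltW e0)//.
  apply: le_trans (hB _ (hS _ hth)) _.
  rewrite ler_piMr// /weight -[leRHS]expR0 ler_expR oppr_le0 mulr_ge0 ?(ltW dl0)//.
  exact: normc_ge0.
rewrite /hankel; have h0 := ray 0 (or_introl erefl).
have h1 := ray (2 * pi) (or_intror erefl).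
by rewrite h1 circ -[X in - cintegral _ X]/(fun x => psi (ln x +i* 0)) h0 !mulrDr mulrN.
Qed.

End HomogeneousFunctionals.

(** * Estimates on the contours and the cut integral of t^{s+l-1} e^{-M t} *)

Section ContourEstimates.
Variable R : realType.
Local Notation C := (complex (Real.sort R)).

Lemma cexp_cut (x y : R) : 0 < x -> y = 0 \/ y = 2 * pi -> cexp (ln x +i* y) = x%:C :> C.
Proof.
move=> x0 hy; rewrite /cexp /= lnK//.
have -> : cos y +i* sin y = 1 :> C.
  case: hy => ->; first by rewrite cos0 sin0.
  by have := @cexp_2ipi R; rewrite /cexp /= expR0 mul1r.
exact: mulr1.
Qed.

Lemma cut_linesP (w : C) : cut_lines w ->
  exists2 x : R, 0 < x & [/\ cexp w = x%:C, Re w = ln x & 0 <= Im w <= 2 * pi].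
Proof.
move=> [x x0 hw]; exists x => //.
have p0 : 0 <= 2 * pi :> R by rewrite mulr_ge0// pi_ge0.
by case: hw => ->; rewrite /= cexp_cut ?lexx ?p0//; [left|right].
Qed.

(** On the two sides z = 0, on the circle x = 0. Sums of such decompositions put t_j + ... + t_r in
    the form X + z of [gker_bound]. *)
Lemma hankel_setP (e : R) (w : C) : 0 < e -> hankel_set e w -> exists (x : R) (z : C),
  [/\ cexp w = x%:C + z, 0 <= x, normc z <= e, normc (cexp w) <= x + e &
      0 <= Im w <= 2 * pi].
Proof.
move=> e0; have p0 : 0 <= 2 * pi :> R by rewrite mulr_ge0// pi_ge0.
case=> [[x ex hw]|[th hth ->]].
- have x0 : 0 < x by exact: lt_le_trans ex.
  have [x' x'0 [h1 h2 h3]] : exists2 x' : R, 0 < x' &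
     [/\ cexp w = x'%:C, Re w = ln x' & 0 <= Im w <= 2 * pi].
    by apply: cut_linesP; exists x.
  exists x', 0; rewrite addr0 normc0 h1 normc_real ger0_norm ?(ltW x'0)// lerDl; split=> //; exact: ltW.
- exists 0, (cexp (ln e +i* th)); rewrite add0r normc_cexp_ln// add0r.
  by split.
Qed.

(** |t^p| is at most |t|^{Re p} up to a constant because arg t stays in [0, 2 pi]. *)
Lemma normc_cexpM (p w : C) : 0 <= Im w <= 2 * pi ->
  normc (cexp (p * w)) <=
    expR (2 * pi * `|Im p|) * expR (Re p * Re w).
Proof.
move=> /andP[w0 w1]; rewrite normc_cexp cReM -expRD ler_expR addrC lerD2r.
apply: le_trans (ler_norm _) _; rewrite normrN normrM mulrC.
by rewrite ler_wpM2r// ger0_norm.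
Qed.

Lemma expR_Re_normc (w : C) : expR (Re w) = normc (cexp w).
Proof. by rewrite normc_cexp. Qed.

(** Passing to the lower side multiplies t^{s+l-1} by e^{2 pi i s}, the integer l - 1 contributing a
    factor 1; e^{-M t} is the same on both sides. *)
Lemma gint_cut (s M : C) l (x : R) : 0 < x ->
  cexp ((s + l%:R - 1) * (ln x +i* (2 * pi)) - M * cexp (ln x +i* (2 * pi))) -
  cexp ((s + l%:R - 1) * (ln x +i* 0) - M * cexp (ln x +i* 0)) =
  (cexp ((0 +i* (2 * pi)) * s) - 1) * gint (s + l%:R) M x.
Proof.
move=> x0.
rewrite (cexp_cut x0 (or_intror erefl)) (cexp_cut x0 (or_introl erefl)) /gint.
have -> : ln x +i* 0 = (ln x)%:C :> C by [].
have -> : ln x +i* (2 * pi) = (ln x)%:C + (0 +i* (2 * pi)) :> C.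
  by apply: eqcP; rewrite ?cReD ?cImD /= ?addr0 ?add0r.
set A := (s + l%:R - 1) * (ln x)%:C - M * x%:C.
have -> : (s + l%:R - 1) * ((ln x)%:C + (0 +i* (2 * pi))) - M * x%:C =
    (0 +i* (2 * pi)) * s + (l%:R * (0 +i* (2 * pi)) - (0 +i* (2 * pi))) + A.
  by rewrite /A; move: (_ +i* _) (ln x)%:C => u v; ring.
rewrite (cexpD _ A) (cexpD (_ * s)) (cexpD (l%:R * _)) cexpMn cexpN cexp_2ipi.
by rewrite expr1n invr1 !mulr1 mulrBl mul1r.
Qed.

Lemma cintegrable_cut (s M : C) l : 1 <= Re s -> 0 < Re M ->
  cintegrable `]0, +oo[ (fun x =>
    cexp ((s + l%:R - 1) * (ln x +i* (2 * pi)) - M * cexp (ln x +i* (2 * pi))) -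
    cexp ((s + l%:R - 1) * (ln x +i* 0) - M * cexp (ln x +i* 0))).
Proof.
move=> s1 M0.
apply: (@eq_cintegrable _ _ _ (fun x => (cexp ((0 +i* (2 * pi)) * s) - 1) * gint (s + l%:R) M x)) => //.
  by move=> x; rewrite /= in_itv /= andbT => x0; rewrite gint_cut.
apply: cintegrableZ => //; apply: cintegrable_gint => //.
by rewrite cReD Re_natC; apply: (le_trans s1); rewrite lerDl.
Qed.

Lemma cut_integral_gamma (s M : C) l :
  1 <= Re s -> 0 < Re M ->
  cut_integral (fun w => cexp ((s + l%:R - 1) * w - M * cexp w)) =
  (cexp ((0 +i* (2 * pi)) * s) - 1) * (rising s l * cGamma s * cpow M (- (s + l%:R))).
Proof.
move=> s1 M0; rewrite -gammaI_cpow// /gammaI -cintegralZ//; last first.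
  apply: cintegrable_gint => //.
  by rewrite cReD Re_natC; apply: (le_trans s1); rewrite lerDl.
by apply: eq_cintegral => x; rewrite /= in_itv /= andbT => x0; rewrite gint_cut.
Qed.

Lemma cexpMz (m : int) (z : C) : cexp (m%:~R * z) = cexp z ^ m.
Proof.
case: m => n; first by rewrite cexpMn.
by rewrite NegzE mulrNz mulNr cexpN cexpMn -exprnN.
Qed.

Lemma cpow_shift (s M : C) (l : nat) (m : int) : 0 < Re M ->
  M ^+ l * M ^ (- m) * cpow M (- (s + l%:R)) = cpow M (- (s + m%:~R)).
Proof.
move=> M0; have := cexp_clog M0; set L := clog M => ML.
rewrite -{1 2}ML -cexpMn -cexpMz /cpow -/L -!cexpD rmorphN /=.
by congr (cexp _); move: (m%:~R) => k; ring.
Qed.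

End ContourEstimates.

(** * Expansion of the truncated kernel over lattice points *)

Section Expansion.
Variables (R : realType) (r : nat).
Local Notation C := (complex (Real.sort R)).
Variables (gamma : 'rV[C]_r) (hgamma : forall j, 0 < Re (gamma 0 j)).
Local Notation tail w := (fun j : 'I_r => \sum_(k < r | (j <= k)%N) cexp (w 0 k : C)).
Local Notation lattice n := (fun j : 'I_r => \sum_(k < r | (k <= j)%N) (n k)%:R * gamma 0 k).

Lemma Re_lattice_gt0 (n : 'I_r -> nat) (j : 'I_r) : (forall k, (0 < n k)%N) ->
  0 < Re (lattice n j).
Proof.
move=> n0; rewrite Re_sum (bigD1 j) //= ltr_pwDl//.
  by rewrite cReM Re_natC Im_natC mul0r subr0 mulr_gt0// ltr0n.
apply: sumr_ge0 => k _; rewrite cReM Re_natC Im_natC mul0r subr0 mulr_ge0//.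
exact: ltW.
Qed.

Lemma lattice_neq0 (n : 'I_r -> nat) (j : 'I_r) : (forall k, (0 < n k)%N) ->
  lattice n j != 0.
Proof.
by move=> n0; have := Re_lattice_gt0 j n0; apply: contraTneq => /= ->; rewrite ltxx.
Qed.

(** The subtracted sum has at most one term, M_{j-1}, and is empty at the first index: the
    convention v_0^{-1} = 0 becomes M_0 = 0. *)
Lemma lattice_step (n : 'I_r -> nat) (j : 'I_r) :
  lattice n j - \sum_(k < r | k.+1 == j :> nat) lattice n k = (n j)%:R * gamma 0 j.
Proof.
have -> : lattice n j = (n j)%:R * gamma 0 j + \sum_(k < r | (k < j)%N) (n k)%:R * gamma 0 k.
  rewrite /= (bigD1 j)//=; congr (_ + _); apply: eq_bigl => k.
  by rewrite ltn_neqAle andbC.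
case: (posnP j) => j0.
  rewrite [X in _ - X]big1 ?subr0; last by move=> k; rewrite j0.
  by rewrite big1 ?addr0// => k; rewrite j0 ltn0.
have jr : (j.-1 < r)%N by rewrite (leq_ltn_trans (leq_pred _)).
rewrite [X in _ - X](big_pred1 (Ordinal jr)) /=; last first.
  move=> k /=; apply/eqP/eqP => [h|->]; last by rewrite /= prednK.
  by apply: val_inj => /=; rewrite -h.
rewrite [X in _ - X](eq_bigl (fun k : 'I_r => (k < j)%N)) ?addrK// => k; lia.
Qed.

Variable a : {fsfun ({ffun 'I_r -> nat} * {ffun 'I_r -> int})%type -> int with 0}.
Hypothesis ha : desing_coef a.

Lemma prod_hsum (s : 'rV[C]_r) N (w : 'rV[C]_r) :
  \prod_j hsum N (gamma 0 j * tail w j) * \prod_k cexp ((s 0 k - 1) * w 0 k) =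
  \sum_(n : {ffun 'I_r -> 'I_N}) \sum_(lm <- finsupp a)
    ((a lm)%:~R * \prod_j (lattice (fun k => (n k).+1) j ^+ lm.1 j *
       lattice (fun k => (n k).+1) j ^ (- lm.2 j))) *
    \prod_k cexp ((s 0 k + (lm.1 k)%:R - 1) * w 0 k -
       lattice (fun k => (n k).+1) k * cexp (w 0 k)).
Proof.
rewrite /hsum bigA_distr_bigA /= big_distrl /=; apply: eq_bigr => n _.
pose n' k := (n k).+1; pose M := lattice n'.
have M0 j : M j != 0 by exact: lattice_neq0.
have -> : \prod_i ((1 - (n i).+1%:R * (gamma 0 i * tail w i)) *
      cexp (- ((n i).+1%:R * (gamma 0 i * tail w i)))) =
   \prod_j (1 - tail w j * (M j - \sum_(k < r | k.+1 == j :> nat) M k)) *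
   \prod_k cexp (- (M k * cexp (w 0 k))).
  rewrite big_split /=; congr (_ * _).
    apply: eq_bigr => j _; rewrite /M lattice_step /n'; congr (1 - _).
    by rewrite mulrA mulrC.
  (* Exchange of summations: the sum over j of n_j gamma_j (t_j + ... + t_r) is the sum over k of
     M_k t_k. *)
  rewrite -!cexp_sum; congr (cexp _); rewrite !sumrN; congr (- _).
  under eq_bigr => j _ do rewrite mulrA mulr_sumr.
  rewrite (exchange_big_dep xpredT)//=; apply: eq_bigr => k _.
  by rewrite mulr_suml.
rewrite (desing_coef_identity _ M0 ha) !mulr_suml; apply: eq_bigr => lm _.
rewrite big_split /=.
have <- : \prod_j cexp (w 0 j) ^+ lm.1 j * \prod_k cexp (- (M k * cexp (w 0 k))) *
    \prod_k cexp ((s 0 k - 1) * w 0 k) =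
    \prod_k cexp ((s 0 k + (lm.1 k)%:R - 1) * w 0 k - M k * cexp (w 0 k)).
  rewrite -!big_split /=; apply: eq_bigr => k _.
  rewrite -cexpMn -!cexpD; congr (cexp _); move: (cexp _) => t; ring.
move: (\prod_j cexp (w 0 j) ^+ _) (\prod_k cexp (- _)) (\prod_k cexp (_ * _)) => p1 p2 p3.
move: (\prod_i _) => p4; ring.
Qed.

(** At level N all sums are finite, and the right side already contains the cubic partial sums that
    appear in [zeta_continuation]. *)
Lemma iterI_prod_hsum (s : 'rV[C]_r) N : (forall k, 1 <= Re (s 0 k)) ->
  iterI (@cut_integral R) (fun w =>
    \prod_j hsum N (gamma 0 j * tail w j) * \prod_k cexp ((s 0 k - 1) * w 0 k)) =
  \prod_k ((cexp ((0 +i* (2 * pi)) * s 0 k) - 1) * cGamma (s 0 k)) *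
  \sum_(lm <- finsupp a) (a lm)%:~R * (\prod_(j < r) rising (s 0 j) (lm.1 j)) *
    \sum_(n : {ffun 'I_r -> 'I_N})
      zeta_term gamma (\row_j (s 0 j + (lm.2 j)%:~R)) (fun k => (n k).+1).
Proof.
move=> s1.
pose c (p : {ffun 'I_r -> 'I_N} * ({ffun 'I_r -> nat} * {ffun 'I_r -> int})) : C :=
  (a p.2)%:~R * \prod_j (lattice (fun k => (p.1 k).+1) j ^+ p.2.1 j *
       lattice (fun k => (p.1 k).+1) j ^ (- p.2.2 j)).
pose f (p : {ffun 'I_r -> 'I_N} * ({ffun 'I_r -> nat} * {ffun 'I_r -> int}))
    (k : 'I_r) (w : C) : C :=
  cexp ((s 0 k + (p.2.1 k)%:R - 1) * w - lattice (fun k => (p.1 k).+1) k * cexp w).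
pose S := [seq (n, lm) | n <- index_enum {ffun 'I_r -> 'I_N}, lm <- enum_fset (finsupp a)].
have Mpos (n : {ffun 'I_r -> 'I_N}) j : 0 < Re (lattice (fun k => (n k).+1) j).
  exact: Re_lattice_gt0.
transitivity (iterI (@cut_integral R) (fun w : 'rV[C]_r =>
    \sum_(p <- S) c p * \prod_k f p k (w 0 k))).
  by congr (iterI _ _); apply/funext => w; rewrite prod_hsum /S big_allpairs.
rewrite iterI_cut_sum_prod; last by move=> p k; exact: cintegrable_cut.
rewrite /S big_allpairs /= exchange_big mulr_sumr /=; apply: eq_bigr => lm _.
rewrite [RHS]mulrA mulr_sumr; apply: eq_bigr => n _.
under [X in _ * X]eq_bigr => k _ do rewrite /f cut_integral_gamma//.
rewrite /c /= /zeta_term -!mulrA [RHS]mulrCA; congr (_ * _).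
rewrite -!big_split /=; apply: eq_bigr => k _.
rewrite mxE -(cpow_shift (s 0 k) (lm.1 k) (lm.2 k) (Mpos n k)).
move: (cGamma _) (cexp _) (rising _ _) (cpow _ _) (_ ^+ _) (_ ^ _) => x1 x2 x3 x4 x5 x6.
ring.
Qed.

End Expansion.

(** * Dominated convergence for the iterated contour integrals *)

Section LimitsUnderContourIntegrals.
Variables (R : realType) (r : nat).
Local Notation C := (complex (Real.sort R)).
Variables (gamma : 'rV[C]_r) (hgamma : forall j, 0 < Re (gamma 0 j)).
Local Notation tail w := (fun j : 'I_r => \sum_(k < r | (j <= k)%N) cexp (w 0 k : C)).

(** The inverse of 1 plus the sum of the 1 / k j lies below every k j and makes sense for an empty
    family. *)
Lemma exists_common_lb (k : 'I_r -> R) : (forall j, 0 < k j) ->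
  exists2 k' : R, 0 < k' & forall j, k' <= k j.
Proof.
move=> k0; pose S := 1 + \sum_j (k j)^-1.
have S0 : 0 < S by rewrite ltr_wpDr// sumr_ge0// => j _; rewrite invr_ge0 ltW.
exists S^-1 => [|j]; first by rewrite invr_gt0.
rewrite -[leRHS]invrK lef_pV2 ?posrE ?invr_gt0// /S (bigD1 j)//= addrCA lerDl.
by rewrite addr_ge0// sumr_ge0// => i _; rewrite invr_ge0 ltW.
Qed.

(** Common shape of the integrands before, during and after the limits: h is [gker c], [hsum N] or
    [hker]. *)
Definition kernel_integrand (h : C -> C) (s w : 'rV[C]_r) : C :=
  \prod_j h (gamma 0 j * tail w j) * \prod_k cexp ((s 0 k - 1) * w 0 k).

Lemma vmeasurable_kernel_integrand h (s : 'rV[C]_r) : fmeasurable h ->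
  vmeasurable (kernel_integrand h s).
Proof.
move=> mh d T g mg; apply: cmeasurableM; apply: cmeasurable_prod => k _.
- apply: mh; apply: cmeasurableM; first exact: cmeasurable_cst.
  by apply: cmeasurable_sum => i _; apply: cmeasurable_cexp; exact: mg.
- apply: cmeasurable_cexp; apply: cmeasurableM; [exact: cmeasurable_cst|exact: mg].
Qed.

Lemma fmeasurable_gker (c : R) : fmeasurable (gker c).
Proof.
move=> d T g mg; apply: cmeasurableB.
- apply: cmeasurableV; apply: cmeasurableB; last exact: cmeasurable_cst.
  exact: cmeasurable_cexp.
- apply: cmeasurableM; first exact: cmeasurable_cst.
  apply: cmeasurableV; apply: cmeasurableB; last exact: cmeasurable_cst.
  apply: cmeasurable_cexp; apply: cmeasurableM => //; exact: cmeasurable_cst.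
Qed.

Lemma fmeasurable_hsum N : fmeasurable (@hsum R N).
Proof.
move=> d T g mg; apply: cmeasurable_sum => n _.
have m1 : cmeasurable setT (fun t => n.+1%:R * g t).
  by apply: cmeasurableM => //; exact: cmeasurable_cst.
apply: cmeasurableM; first by apply: cmeasurableB => //; exact: cmeasurable_cst.
by apply: cmeasurable_cexp; exact: cmeasurableN.
Qed.

Lemma tail_cut (w : 'rV[C]_r) : on_contour (@cut_lines R) w ->
  exists x : 'I_r -> R, [/\ forall k, 0 < x k,
    forall k, Re (w 0 k) = ln (x k), forall k, cexp (w 0 k) = (x k)%:C,
    forall k, 0 <= Im (w 0 k) <= 2 * pi &
    forall j, tail w j = (\sum_(k < r | (j <= k)%N) x k)%:C].
Proof.
move=> hw; have h k := cut_linesP (hw k).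
have {}h k : exists x : R, [/\ 0 < x, cexp (w 0 k) = x%:C,
    Re (w 0 k) = ln x & 0 <= Im (w 0 k) <= 2 * pi].
  by have [x x0 [h1 h2 h3]] := h k; exists x.
have [x hx] := choice h; exists x; split.
- by move=> k; have [] := hx k.
- by move=> k; have [] := hx k.
- by move=> k; have [] := hx k.
- by move=> k; have [] := hx k.
- move=> j; rewrite rmorph_sum /=; apply: eq_bigr => k _; by have [] := hx k.
Qed.

Lemma sum_tail_ge (x : 'I_r -> R) j : (forall k, 0 <= x k) ->
  x j <= \sum_(k < r | (j <= k)%N) x k.
Proof. by move=> x0; rewrite (bigD1 j)//= lerDl sumr_ge0. Qed.

Lemma Re_tail_gt0 (w : 'rV[C]_r) j : on_contour (@cut_lines R) w ->
  0 < Re (gamma 0 j * tail w j).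
Proof.
move=> /tail_cut[x [x0 _ _ _ ->]]; rewrite cReM /= mulr0 subr0 mulr_gt0//.
by apply: (lt_le_trans (x0 j)); apply: sum_tail_ge => k; exact: ltW.
Qed.

Lemma kernel_integrand_cvg (h : nat -> C -> C) (l : C -> C) (s w : 'rV[C]_r) :
  (forall y, 0 < Re y -> h m y @[m --> \oo] --> l y) ->
  on_contour (@cut_lines R) w ->
  kernel_integrand (h m) s w @[m --> \oo] --> kernel_integrand l s w.
Proof.
move=> hl hw; rewrite /kernel_integrand.
have c1 := @cvgc_prod _ _ (index_enum 'I_r) (fun m j => h m (gamma 0 j * tail w j))
  (fun j => l (gamma 0 j * tail w j)) (fun j => hl _ (Re_tail_gt0 j hw)).
exact: (cvgcMr c1 _).
Qed.

(** Half of the decay rate k absorbs the power |t|^{Re s - 1}; the other half remains as the weight.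
    The term k e pays for |t| <= x + e. *)
Lemma kernel_factor_bound (s w : C) (k A e : R) :
  0 < k ->
  (forall y, (Re s - 1) * y <= A + k / 2 * expR y) ->
  forall x : R, normc (cexp w) <= x + e -> 0 <= Im w <= 2 * pi ->
  expR (- (k * x)) * normc (cexp ((s - 1) * w)) <=
    expR (k * e + 2 * pi * `|Im (s - 1)| + A) * weight (k / 2) w.
Proof.
move=> k0 hA x hx hI.
have h1 := normc_cexpM (s - 1) hI.
rewrite cReD /= in h1.
apply: (le_trans (ler_wpM2l (expR_ge0 _) h1)).
rewrite /weight -!expRD ler_expR.
have h2 := hA (Re w); rewrite expR_Re_normc in h2.
have h3 := ler_wpM2l (ltW k0) hx.
move: h2 h3; move: (normc _) (Re w) (Re s) (`|_|) => a b c d.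
by move: (2 * pi * d) => q h2 h3; lra.
Qed.

(** The j-th kernel factor is paired with t_j^{s_j - 1}: its decay in X >= x_j controls that power,
    and it supplies one factor |c - 1|. *)
Lemma gker_integrand_bound (s : 'rV[C]_r) : (forall k, 1 <= Re (s 0 k)) ->
  exists dl k B : R, [/\ 0 < dl, 0 < k & forall (e c : R) (w : 'rV[C]_r),
    0 < e <= k -> `|c - 1| <= k -> on_contour (hankel_set e) w ->
    normc (kernel_integrand (gker c) s w) <=
      B * `|c - 1| ^+ r * \prod_j weight dl (w 0 j)].
Proof.
move=> s1.
have /choice[kj hkj] : forall j : 'I_r, exists k : R, 0 < k /\ forall k' X (z : C) c,
    0 < k' <= k -> 0 <= X -> normc z <= k' -> `|c - 1| <= k' ->
    normc (gker c (gamma 0 j * (X%:C + z))) <= k'^-1 * `|c - 1| * expR (- (k' * X)).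
  by move=> j; have [k k0 hk] := gker_bound (hgamma j); exists k.
have [k' k'0 hk'] := exists_common_lb (fun j => proj1 (hkj j)).
have k20 : 0 < k' / 2 by rewrite divr_gt0.
have /choice[A hA] : forall k : 'I_r, exists A : R, forall y,
    (Re (s 0 k) - 1) * y <= A + k' / 2 * expR y.
  by move=> k; apply: lin_le_exp_log => //; rewrite subr_ge0.
(* A tail sum of at most r deviations z_i, each of modulus at most e <= k, then has modulus at most
   k'. *)
pose k := k' / r.+1%:R.
have k0 : 0 < k by rewrite divr_gt0.
have kk' : k <= k' by rewrite ler_pdivrMr// ler_peMr ?ler1n// ltW.
pose B j : R := k'^-1 * expR (k' * k + 2 * pi * `|Im (s 0 j - 1)| + A j).
exists (k' / 2), k, (\prod_j B j); split => // e c w /andP[e0 ek] ck hw.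
have /choice[x /choice[z hxz]] : forall j, exists (x : R), exists (z : C),
  [/\ cexp (w 0 j) = x%:C + z, 0 <= x, normc z <= e, normc (cexp (w 0 j)) <= x + e &
      0 <= Im (w 0 j) <= 2 * pi].
  by move=> j; exact: hankel_setP e0 (hw j).
have fac j : normc (gker c (gamma 0 j * tail w j) * cexp ((s 0 j - 1) * w 0 j)) <=
    B j * `|c - 1| * weight (k' / 2) (w 0 j).
  have -> : tail w j = (\sum_(i < r | (j <= i)%N) x i)%:C + \sum_(i < r | (j <= i)%N) z i.
    rewrite rmorph_sum -big_split /=; apply: eq_bigr => i _.
    by have [] := hxz i.
  set X := \sum_(i < r | _) x i; set Z := \sum_(i < r | _) z i.
  have xX : x j <= X by apply: sum_tail_ge => i; have [] := hxz i.
  have [_ xj0 _ tj wj] := hxz j.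
  have hZ : normc Z <= k'.
    apply: le_trans (ler_normc_sum _ _ _) _.
    apply: (@le_trans _ _ (\sum_(i < r) k)).
      apply: le_trans (ler_sum _ _) (_ : \sum_(i < r | (j <= i)%N) k <= _).
        by move=> i _; have [_ _ h _ _] := hxz i; exact: le_trans ek.
      by rewrite [leRHS](bigID (fun i : 'I_r => (j <= i)%N)) /= lerDl sumr_ge0// => i _; exact: ltW.
    rewrite sumr_const card_ord -mulr_natr /k mulrAC -mulrA ler_piMr ?(ltW k'0)//.
    by rewrite ler_pdivrMr// mul1r ler_nat.
  have hk'j : 0 < k' <= kj j by rewrite k'0 hk'.
  have h1 := (proj2 (hkj j)) k' X Z c hk'j (le_trans xj0 xX) hZ (le_trans ck kk').
  have h2 := kernel_factor_bound k'0 (hA j) tj wj.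
  rewrite normcM; apply: (le_trans (ler_wpM2r (normc_ge0 _) h1)).
  have h3 : expR (- (k' * X)) <= expR (- (k' * x j)).
    by rewrite ler_expR lerN2 ler_wpM2l// ltW.
  have h4 := le_trans (ler_wpM2r (normc_ge0 (cexp ((s 0 j - 1) * w 0 j))) h3) h2.
  have k'V : 0 <= k'^-1 * `|c - 1| by rewrite mulr_ge0// invr_ge0 ltW.
  rewrite -[leLHS]mulrA; apply: (le_trans (ler_wpM2l k'V h4)).
  rewrite /B; set E := expR (k' * k + _ + _).
  have -> : k'^-1 * E * `|c - 1| * weight (k' / 2) (w 0 j) =
    k'^-1 * `|c - 1| * (E * weight (k' / 2) (w 0 j)) by ring.
  apply: ler_wpM2l => //; apply: ler_wpM2r; first exact: weight_ge0.
  by rewrite ler_expR lerD2r lerD2r ler_wpM2l// ltW.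
rewrite /kernel_integrand -big_split /= normc_prod.
have -> : \prod_j B j * `|c - 1| ^+ r * \prod_j weight (k' / 2) (w 0 j) =
    \prod_(j < r) (B j * `|c - 1| * weight (k' / 2) (w 0 j)).
  by rewrite [RHS]big_split [X in _ = X * _]big_split /= prodr_const card_ord.
by apply: ler_prod => j _; rewrite normc_ge0 fac.
Qed.

(** The singular factor of [hsum_bound] is at most a constant times 1 / x_j and lowers the exponent
    of t_j by one; this is the reason for asking Re s_j >= 2. *)
Lemma hsum_integrand_bound (s : 'rV[C]_r) : (forall k, 2 <= Re (s 0 k)) ->
  exists2 dl : R, 0 < dl & exists B : R, forall N (w : 'rV[C]_r),
    on_contour (@cut_lines R) w ->
    normc (kernel_integrand (hsum N) s w) <= B * \prod_j weight dl (w 0 j).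
Proof.
move=> s2; pose g j := Re (gamma 0 j).
have g4 j : 0 < g j / 4 by rewrite divr_gt0// hgamma.
have [k k0 hk] := exists_common_lb g4.
have k20 : 0 < k / 2 by rewrite divr_gt0.
have /choice[A hA] : forall j : 'I_r, exists A : R, forall y,
    (Re (s 0 j) - 2) * y <= A + k / 2 * expR y.
  by move=> j; apply: lin_le_exp_log => //; rewrite subr_ge0.
pose L j := normc (gamma 0 j) / g j.
pose K j := (1 + 2 * L j) * 4 * (g j)^-1.
pose B j := K j * expR (2 * pi * `|Im (s 0 j - 1)| + A j).
exists (k / 2) => //; exists (\prod_j B j) => N w hw.
have [x [x0 xRe xE xIm xtail]] := tail_cut hw.
have fac j : normc (hsum N (gamma 0 j * tail w j) * cexp ((s 0 j - 1) * w 0 j)) <=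
    B j * weight (k / 2) (w 0 j).
  rewrite xtail; set X := \sum_(i < r | _) x i.
  have xX : x j <= X by apply: sum_tail_ge => i; exact: ltW.
  have X0 : 0 < X := lt_le_trans (x0 j) xX.
  have gj0 : 0 < g j := hgamma j.
  have yRe : Re (gamma 0 j * X%:C) = g j * X by rewrite cReM /= mulr0 subr0.
  have y0 : 0 < Re (gamma 0 j * X%:C) by rewrite yRe mulr_gt0.
  have L0 : 0 <= L j by rewrite divr_ge0 ?normc_ge0 ?(ltW gj0).
  have yL : normc (gamma 0 j * X%:C) <= L j * Re (gamma 0 j * X%:C).
    rewrite normcM normc_real (ger0_norm (ltW X0)) yRe /L mulrA divfK//.
    exact: lt0r_neq0.
  have h1 := hsum_bound N L0 y0 yL.
  have h2 := normc_cexpM (s 0 j - 1) (xIm j).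
  rewrite normcM; apply: (le_trans (ler_pM (normc_ge0 _) (normc_ge0 _) h1 h2)).
  rewrite yRe invfM xRe cReD /=.
  have h3 : X^-1 <= expR (- ln (x j)).
    by rewrite expRN lnK ?posrE// lef_pV2 ?posrE.
  have h4 : expR (- (g j * X / 4)) <= expR (- (k * x j)).
    rewrite ler_expR lerN2 mulrAC; apply: ler_pM => //; exact: ltW.
  have h5 := hA j (ln (x j)); rewrite lnK ?posrE// in h5.
  rewrite /B /K /weight xE normc_real (ger0_norm (ltW (x0 j))).
  set c1 := (1 + 2 * L j) * 4; set c2 := 2 * pi * _.
  have c10 : 0 <= c1 * (g j)^-1.
    by rewrite mulr_ge0 ?invr_ge0 ?(ltW gj0)// /c1 mulr_ge0// addr_ge0// mulr_ge0.
  have XV0 : 0 <= X^-1 by rewrite invr_ge0 ltW.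
  have h6 := ler_pM XV0 (expR_ge0 _) h3 h4.
  have -> : c1 * ((g j)^-1 * X^-1) * expR (- (g j * X / 4)) *
      (expR c2 * expR ((Re (s 0 j) - 1) * ln (x j))) =
      c1 * (g j)^-1 * ((X^-1 * expR (- (g j * X / 4))) *
      (expR c2 * expR ((Re (s 0 j) - 1) * ln (x j)))) by ring.
  rewrite -[leRHS]mulrA; apply: ler_wpM2l => //.
  apply: (le_trans (ler_wpM2r _ h6)); first by rewrite mulr_ge0 ?expR_ge0.
  rewrite -!expRD ler_expR.
  by move: h5; move: (Re (s 0 j)) (x j) (ln (x j)) => t z y h5; lra.
rewrite /kernel_integrand -big_split /= normc_prod.
have -> : \prod_j B j * \prod_j weight (k / 2) (w 0 j) =
    \prod_(j < r) (B j * weight (k / 2) (w 0 j)).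
  by rewrite [RHS]big_split.
by apply: ler_prod => j _; rewrite normc_ge0 fac.
Qed.

Lemma cvg_cut_hsum (s : 'rV[C]_r) : (forall k, 2 <= Re (s 0 k)) ->
  iterI (@cut_integral R) (kernel_integrand (hsum N) s) @[N --> \oo] -->
  iterI (@cut_integral R) (kernel_integrand (@hker R) s).
Proof.
move=> s2; have [dl dl0 [B hB]] := hsum_integrand_bound s2.
apply: (@iterI_cvg _ dl _ (fun=> @cut_lines R) (fun=> @cut_integral R) (@cut_lines R)
  (@cut_integral R) _ _ _ _ _ _ _ B).
- by move=> m; exact: measurable_cut_integral.
- by move=> m; exact: bounded_cut_integral.
- by move=> w hw; exact: nearW.
- exact: cvg_cut_integral.
- by move=> N; apply: vmeasurable_kernel_integrand; exact: fmeasurable_hsum.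
- by apply: nearW => N w hw; exact: hB.
- move=> w hw; apply: kernel_integrand_cvg => // y y0; exact: hsum_cvg.
Qed.

(** The prefactor goes under the integral and is shared among the r factors, each becoming - gker /
    (c - 1), which tends to [hker]; in the majorant it cancels |c - 1|^r exactly. *)
Lemma cvg_hankel_gker (s : 'rV[C]_r) (e c : nat -> R) :
  (forall k, 1 <= Re (s 0 k)) ->
  (forall m, 0 < e m <= 1) -> e m @[m --> \oo] --> (0 : R) ->
  (forall m, c m != 1) -> c m @[m --> \oo] --> (1 : R) ->
  (-1) ^+ r / ((c m)%:C - 1) ^+ r * iterI (hankel (e m)) (kernel_integrand (gker (c m)) s)
    @[m --> \oo] --> iterI (@cut_integral R) (kernel_integrand (@hker R) s).
Proof.
move=> s1 e01 ce c1 cc; have [dl [k [B [dl0 k0 hB]]]] := gker_integrand_bound s1.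
pose H := 2 * tailmass dl + 2 * pi.
have e0 m : 0 < e m by have /andP[] := e01 m.
have bI m := bounded_hankel dl0 (e01 m).
pose a m : C := (-1) ^+ r / ((c m)%:C - 1) ^+ r.
pose f m (w : 'rV[C]_r) := a m * kernel_integrand (gker (c m)) s w.
have na m : normc (a m) * `|c m - 1| ^+ r = 1.
  have n0 : `|c m - 1| != 0 by rewrite normr_eq0 subr_eq0.
  rewrite /a normcM normcV !normcX normc_opp normc1 expr1n mul1r.
  rewrite -(rmorph1 (real_complex R)) -rmorphB normc_real mulVf// expf_neq0//.
have near_k : \forall m \near \oo, forall w, on_contour (hankel_set (e m)) w ->
    normc (kernel_integrand (gker (c m)) s w) <=
      B * `|c m - 1| ^+ r * \prod_j weight dl (w 0 j).
  have h1 : \forall m \near \oo, e m < k by apply: (cvgr_lt _ ce).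
  have h2 : \forall m \near \oo, `|1 - c m| < k by have /cvgrPdist_lt/(_ _ k0) := cc.
  move: h1 h2; apply: filterS2 => m em cm w hw.
  by apply: hB => //; [rewrite e0 ltW|rewrite distrC ltW].
have lim : iterI (hankel (e m)) (f m) @[m --> \oo] -->
    iterI (@cut_integral R) (kernel_integrand (@hker R) s).
  apply: (@iterI_cvg _ dl _ (fun m => hankel_set (e m)) (fun m => hankel (e m)) (@cut_lines R)
    (@cut_integral R) _ _ _ _ _ _ _ B).
  - by move=> m; exact: measurable_hankel.
  - exact: bI.
  - exact: near_hankel_set.
  - exact: cvg_hankel.
  - move=> m d T g mg; apply: cmeasurableM; first exact: cmeasurable_cst.
    by apply: vmeasurable_kernel_integrand mg; exact: fmeasurable_gker.
  - move: near_k; apply: filterS => m hm w hw; rewrite /f normcM.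
    apply: (le_trans (ler_wpM2l (normc_ge0 _) (hm w hw))).
    set p := \prod_(_ | _) _.
    have -> : normc (a m) * (B * `|c m - 1| ^+ r * p) =
       normc (a m) * `|c m - 1| ^+ r * (B * p) by ring.
    by rewrite na mul1r.
  - move=> w hw.
    pose h m y : C := (- gker (c m) y) / ((c m)%:C - 1).
    have -> : (fun m => f m w) = (fun m => kernel_integrand (h m) s w).
      apply/funext => m; rewrite /f /kernel_integrand mulrA; congr (_ * _).
      have hE y : h m y = -1 / ((c m)%:C - 1) * gker (c m) y by rewrite /h; ring.
      under [RHS]eq_bigr => j _ do rewrite hE.
      by rewrite [RHS]big_split /= prodr_const card_ord /a exprMn exprVn.
    by apply: kernel_integrand_cvg => // y y0; exact: gker_cvg.
(* The prefactor can be moved through the iterated integral only where the domination holds, that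
   is, for large m. *)
apply: cvg_trans lim; apply: near_eq_cvg; move: near_k; apply: filterS => m hm.
apply: (iterI_homogeneous (measurable_hankel (e m)) (bI m) (homogeneous_hankel dl0 (e0 m)) _ hm) => //.
by apply: vmeasurable_kernel_integrand; exact: fmeasurable_gker.
Qed.

End LimitsUnderContourIntegrals.

(** * The identity of meromorphic functions *)

Section Identity.
Variables (R : realType) (r : nat).
Local Notation C := (complex (Real.sort R)).
Variables (gamma : 'rV[C]_r) (hgamma : forall j, 0 < Re (gamma 0 j)).
Variables (D Z : 'rV[C]_r -> C).
Hypotheses (hD : zeta_des gamma D) (hZ : zeta_continuation gamma Z).
Variable a : {fsfun ({ffun 'I_r -> nat} * {ffun 'I_r -> int})%type -> int with 0}.
Hypothesis ha : desing_coef a.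

Let G (s : 'rV[C]_r) : C :=
  \prod_k ((cexp ((0 +i* (2 * pi)) * s 0 k) - 1) * cGamma (s 0 k)).

Let zeta_comb (s : 'rV[C]_r) : C :=
  \sum_(lm <- finsupp a)
      (a lm)%:~R * (\prod_(j < r) rising (s 0 j) (lm.1 j))
      * Z (\row_j (s 0 j + (lm.2 j)%:~R)).

(** Diagonal choice: for each m a radius below 1/(m+1) is fixed first, then c so close to 1 that the
    approximation is within 1/(m+1) of D s. *)
Lemma zeta_des_sequence (s : 'rV[C]_r) : (forall k (n : int), s 0 k != n%:~R) ->
  exists e c : nat -> R, [/\ forall m, 0 < e m <= 1, e m @[m --> \oo] --> (0 : R),
    forall m, c m != 1, c m @[m --> \oo] --> (1 : R) &
    des_approx (e m) gamma s (c m) @[m --> \oo] --> D s].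
Proof.
move=> sZ; have [_ hlim] := hD.
have /choice[ec hec] : forall m : nat, exists p : R * R,
    [/\ 0 < p.1, p.1 < m.+1%:R^-1, p.2 != 1, `|1 - p.2| < m.+1%:R^-1 &
       normc (des_approx p.1 gamma s p.2 - D s) < m.+1%:R^-1].
  move=> m; have m0 : 0 < m.+1%:R^-1 :> R by rewrite invr_gt0.
  have f1 : \forall e \near (0 : R)^'+, 0 < e < m.+1%:R^-1.
    by near=> e; apply/andP; split; near: e; [exact: nbhs_right_gt|exact: nbhs_right_lt].
  have [e [he /andP[e0 em]]] := @filter_ex _ _ (at_right_proper_filter 0) _ (filterI hlim f1).
  have /cvgcP/(_ _ m0) h := he s sZ.
  have [c [hc [hb /eqP c1]]] :=
    @filter_ex _ _ (Proper_dnbhs_numFieldType 1) _ (filterI h (dnbhs_ball (1 : R) m0)).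
  by exists (e, c).
have small (d : R) : 0 < d -> \forall m \near \oo, m.+1%:R^-1 < d.
  by move=> d0; exact: (near_infty_natSinv_lt (PosNum d0)).
exists (fun m => (ec m).1), (fun m => (ec m).2); split.
- move=> m; have [-> h _ _ _] := hec m; apply: (le_trans (ltW h)).
  by rewrite invf_le1// ler1n.
- apply/cvgrPdist_lt => d d0; have := small d d0; apply: filterS => m hm.
  have [h0 h _ _ _] := hec m.
  by rewrite sub0r normrN ger0_norm ?ltW//; exact: lt_trans hm.
- by move=> m; have [] := hec m.
- apply/cvgrPdist_lt => d d0; have := small d d0; apply: filterS => m hm.
  by have [_ _ _ h _] := hec m; exact: lt_trans hm.
- apply/cvgcP => d d0; have := small d d0; apply: filterS => m hm.
  by have [_ _ _ _ h] := hec m; exact: lt_trans hm.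
Unshelve. all: by end_near. Qed.

(** Where G s is nonzero it cancels the inverse normalising factors of [des_approx], so both sides
    are limits of one sequence. *)
Lemma zeta_des_integral (s : 'rV[C]_r) : (forall k, 1 <= Re (s 0 k)) ->
  (forall k (n : int), s 0 k != n%:~R) -> G s != 0 ->
  G s * D s = iterI (@cut_integral R) (kernel_integrand gamma (@hker R) s).
Proof.
move=> s1 sZ G0; have [e [c [e01 ce c1 cc lim]]] := zeta_des_sequence sZ.
have h1 := cvg_hankel_gker hgamma s1 e01 ce c1 cc.
have h2 := cvgcMl lim (G s).
apply: (cvgc_unique h2).
suff -> : (fun m => G s * des_approx (e m) gamma s (c m)) =
  (fun m => (-1) ^+ r / ((c m)%:C - 1) ^+ r *
     iterI (hankel (e m)) (kernel_integrand gamma (gker (c m)) s)) by exact: h1.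
apply/funext => m; rewrite /des_approx prodfV -/(G s) hankel_iterE.
rewrite mulrA [in LHS]mulrCA divff// mulr1; congr (_ * iterI _ _).
apply/funext => w; rewrite /kernel_integrand; congr (_ * _).
rewrite /des_kernel; apply: eq_bigr => j _.
by under eq_bigr => k _ do rewrite mxE.
Qed.

(** After multiplication by G s both sides are limits, as N -> oo, of the cut integrals of the
    truncated kernel. *)
Lemma zeta_des_eq_zeta_comb (s : 'rV[C]_r) : (forall k, 2 <= Re (s 0 k)) ->
  (forall k (n : int), s 0 k != n%:~R) -> G s != 0 ->
  (forall lm, lm \in finsupp a -> zeta_domain (\row_j (s 0 j + (lm.2 j)%:~R))) ->
  D s = zeta_comb s.
Proof.
move=> s2 sZ G0 hdom.
have s1 k : 1 <= Re (s 0 k) by apply: le_trans (s2 k); rewrite ler1n.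
apply: (mulfI G0); rewrite (zeta_des_integral s1 sZ G0).
have h := cvg_cut_hsum hgamma s2.
apply: (cvgc_unique h).
under eq_fun => N do rewrite /kernel_integrand (iterI_prod_hsum hgamma ha N s1).
apply: cvgcMl; rewrite /zeta_comb.
(* [cvgc_sum] asks for convergence at every index, but the zeta sums are known to converge only for
   [lm] in the support; elsewhere the summand is replaced by 0. *)
have E (X : {ffun 'I_r -> nat} * {ffun 'I_r -> int} -> C) : \sum_(lm <- finsupp a) X lm =
    \sum_(lm <- finsupp a) (if lm \in finsupp a then X lm else 0).
  by rewrite [LHS]big_seq [LHS]big_mkcond.
rewrite E; under eq_fun => N do rewrite E.
apply: cvgc_sum => lm; case: ifPn => hlm; last exact: cvgc_cst.
by apply: cvgcMl; have [_] := hZ; apply; exact: hdom.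
Qed.

Lemma normc_coord_le (z : 'rV[C]_r) k : normc (z 0 k) <= vnorm z.
Proof.
apply/ler_addgt0Pr => e e0.
have h : ball (0 : 'rV[C]_r) (vnorm z + e)%:C z.
  by rewrite -ball_normE /= sub0r normrN vnormE ltcR ltrDl.
have [_ /(_ 0 k)] := h; rewrite mxE -ball_normE /= sub0r normrN normrcE ltcR.
exact: ltW.
Qed.

Lemma zeta_domain_ge (s : 'rV[C]_r) : (forall k, 2 <= Re (s 0 k)) -> zeta_domain s.
Proof.
move=> s2 j; rewrite Re_sum.
have -> : (r - j)%:R = \sum_(k < r | (j <= k)%N) 1 :> R.
  transitivity (\sum_(j <= k < r) (1 : R)); first by rewrite sumr_const_nat.
  exact: big_geq_mkord.
apply: ltr_sum; first by apply/hasP; exists j; rewrite ?mem_index_enum.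
by move=> k _; apply: lt_le_trans (s2 k); rewrite ltr1n.
Qed.

(** 2 pi (Re z - P) lies strictly between pi/2 and 3 pi/2, so e^{2 pi i z} has negative real part
    and cannot be 1. *)
Lemma near_half_integer (P : nat) (z : C) : normc (z - (P%:R + 2^-1)%:C) < 4^-1 ->
  P%:R < Re z < P.+1%:R /\ cexp ((0 +i* (2 * pi)) * z) - 1 != 0.
Proof.
move=> h; have := le_lt_trans (le_Re_normc _) h.
rewrite cReD cReN /= ltr_norml => /andP[h1 h2].
split; first by rewrite -natr1; apply/andP; split; lra.
rewrite subr_eq0; apply/eqP => hc.
have : cexp ((0 +i* (2 * pi)) * (z - P%:R)) = 1 :> C.
  by rewrite mulrBr cexpB hc (mulrC _ P%:R) cexpMn cexp_2ipi expr1n divr1.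
move=> /(congr1 (@Re R)); rewrite Re_cexp => {}hc.
have : cos (Im ((0 +i* (2 * pi)) * (z - P%:R))) < 0.
  rewrite cImM cReD cReN Re_natC /= mul0r add0r.
  rewrite -[X in cos X](subrK pi) cosDpi oppr_lt0; apply: cos_gt0_pihalf.
  have p0 := pi_gt0 R.
  have q1 : 0 < pi * (Re z - P%:R - 4^-1) by rewrite mulr_gt0//; lra.
  have q2 : 0 < pi * (4^-1 + P%:R + 2^-1 - Re z) by rewrite mulr_gt0//; lra.
  by apply/andP; split; lra.
have := expR_gt0 (Re ((0 +i* (2 * pi)) * (z - P%:R))) => e0 c0.
have : expR (Re ((0 +i* (2 * pi)) * (z - P%:R))) *
    cos (Im ((0 +i* (2 * pi)) * (z - P%:R))) < 0 by rewrite pmulr_rlt0.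
by rewrite hc /= ltr10.
Qed.

Lemma zeta_des_eq_near : exists s0 : 'rV[C]_r, \forall s \near s0, D s = zeta_comb s.
Proof.
(* [P] exceeds every |m_k| of the support by at least 3, so that all shifted arguments s_k + m_k
   have real part above 2. *)
pose P : nat := (3 + \sum_(lm <- finsupp a) \sum_k absz (lm.2 k))%N.
have [e e0 he] : exists2 e : R, 0 < e & forall z : C, normc (z - (P%:R + 2^-1)%:C) < e -> cGamma z != 0.
  apply: cGamma_neq0_near; have : (3 : R) <= P%:R by rewrite ler_nat leq_addr.
  lra.
exists (const_mx (P%:R + 2^-1)%:C); apply/nbhs_vnormP.
exists (Num.min e 4^-1); first by rewrite lt_min e0 invr_gt0 ltr0n.
move=> s hs.
have near_k k : normc (s 0 k - (P%:R + 2^-1)%:C) < e /\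
    normc (s 0 k - (P%:R + 2^-1)%:C) < 4^-1.
  have := le_lt_trans (normc_coord_le _ k) hs; rewrite !mxE lt_min => /andP[] //.
have hP k : P%:R < Re (s 0 k) < P.+1%:R.
  by have [] := near_half_integer (proj2 (near_k k)).
have P3 : (3 : R) <= P%:R by rewrite ler_nat leq_addr.
apply: zeta_des_eq_zeta_comb.
- move=> k; have /andP[h _] := hP k; apply: ltW; apply: lt_trans h; lra.
- move=> k n; apply/eqP => h; have := hP k; rewrite h.
  have -> : Re (n%:~R : C) = n%:~R by rewrite -(rmorph_int (real_complex R)).
  rewrite !pmulrn !ltr_int; lia.
- apply/prodf_neq0 => k _; rewrite mulf_neq0 ?(he _ (proj1 (near_k k)))//.
  by have [] := near_half_integer (proj2 (near_k k)).
- move=> lm hlm; apply: zeta_domain_ge => k; rewrite mxE cReD.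
  have -> : Re ((lm.2 k)%:~R : C) = (lm.2 k)%:~R by rewrite -(rmorph_int (real_complex R)).
  have h1 : (3 + absz (lm.2 k) <= P)%N.
    rewrite leq_add2l (big_rem lm)//= (bigD1 k)//= -addnA leq_addr//.
  have h2 : - (absz (lm.2 k))%:R <= (lm.2 k)%:~R :> R.
    by rewrite pmulrn -mulrNz ler_int; lia.
  have h3 : 3 + (absz (lm.2 k))%:R <= P%:R :> R by rewrite -natrD ler_nat.
  have /andP[h4 _] := hP k; lra.
Qed.

Lemma meromorphic_zeta_comb : meromorphic zeta_comb.
Proof.
apply: meromorphic_sum => lm.
apply: (@meromorphicMl _ _ (fun s => (a lm)%:~R * \prod_(j < r) rising (s 0 j) (lm.1 j))).
  move=> z; apply: differentiableM; first exact: differentiable_cst.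
  by apply: entire_prod => j; exact: entire_rising.
have -> : (fun s : 'rV[C]_r => Z (\row_j (s 0 j + (lm.2 j)%:~R))) =
    (fun s => Z (s + \row_j (lm.2 j)%:~R)).
  by apply/funext => s; congr Z; apply/rowP => j; rewrite !mxE.
by apply: meromorphic_shift; have [] := hZ.
Qed.

Lemma zeta_des_meromorphic_eq : meromorphic_eq D zeta_comb.
Proof.
have mD : meromorphic D by apply: meromorphic_entire; have [] := hD.
have mF : meromorphic (fun s => D s + (-1) * zeta_comb s).
  apply: meromorphicD => //; apply: meromorphicMl meromorphic_zeta_comb.
  by move=> z; exact: differentiable_cst.
split => //; first exact: meromorphic_zeta_comb.
move=> s /nbhs_singleton hDs /nbhs_singleton hs.
have [s0 h0] := zeta_des_eq_near.
have F0 : \forall z \near s0, D z + -1 * zeta_comb z = 0.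
  by move: h0; apply: filterS => z ->; rewrite mulN1r subrr.
(* Holomorphy of both sides at s gives the continuity that excludes an arbitrary value of the
   representatives there. *)
have cF : {for s, continuous (fun z => D z + -1 * zeta_comb z)}.
  apply: differentiable_continuous; apply: differentiableD => //.
  by apply: differentiableM => //; exact: differentiable_cst.
have /eqP := meromorphic_identity mF F0 cF.
by rewrite mulN1r subr_eq0 => /eqP.
Qed.

End Identity.

Theorem theorem1p23 (R : realType) (r : nat) (hr : (0 < r)%N)
    (gamma : 'rV[complex R]_r) (hgamma : forall j, 0 < complex.Re (gamma 0 j))
    (a : {fsfun ({ffun 'I_r -> nat} * {ffun 'I_r -> int})%type -> int with 0})
    (ha : desing_coef a)
    (Z : 'rV[complex R]_r -> complex R) (hZ : zeta_continuation gamma Z)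
    (D : 'rV[complex R]_r -> complex R) (hD : zeta_des gamma D) :
  meromorphic_eq D (fun s =>
    \sum_(lm <- finsupp a)
      (a lm)%:~R * (\prod_(j < r) rising (s 0 j) (lm.1 j))
      * Z (\row_(j < r) (s 0 j + (lm.2 j)%:~R))).
Proof. exact: (zeta_des_meromorphic_eq hgamma hD hZ ha). Qed.
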